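(* Let $n\geq 1$ be an integer, let $D\geq 1$ be an odd square-free integer, and let $\chi$ be a primitive Dirichlet character mod $D$. There exists $K_0=K_0(n,D)$ such that for every even integer $K\geq K_0$ the following holds: if $\ell_1<\ell_2<\cdots<\ell_n$ are integers with $3\leq \ell_1$, $\ell_n\leq \frac{K-4}{2}$ and $\chi(-1)=(-1)^{\ell_i}$ for all $1\leq i\leq n$, then the twisted periods $r_{\ell_1,\chi},\dots,r_{\ell_n,\chi}$, viewed as elements of $\mathrm{Hom}_{\mathbb{C}}(S_K,\mathbb{C})$, are linearly independent over $\mathbb{C}$.
   Context: $S_K$ is the space of cusp forms of weight $K$ for $\mathrm{SL}_2(\mathbb{Z})$, $q=e^{2\pi i z}$. For $f(z)=\sum_{n\ge1}a_f(n)q^n\in S_K$ and a Dirichlet character $\chi$, put $f_\chi(z)=\sum_{n\geq1}\chi(n)a_f(n)q^n$ and $L(f,\chi,s)=\sum_{n\ge1}\chi(n)a_f(n)n^{-s}$ (analytically continued to $\mathbb{C}$). For a primitive Dirichlet character $\chi$ mod $D$ and $0\leq m\leq K-2$, the $m$-th twisted period is the linear functional on $S_K$ given by $r_{m,\chi}(f)=\int_0^{i\infty}f_\chi(z)z^m\,dz=\frac{m!}{(-2\pi i)^{m+1}}L(f,\chi,m+1)$. *)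

(* Defs.v *)
From mathcomp Require Import all_boot all_order all_algebra.
From mathcomp Require Import complex.
From mathcomp Require Import all_classical all_reals all_analysis.

Set Implicit Arguments.
Unset Strict Implicit.
Unset Printing Implicit Defensive.

Import Order.TTheory GRing.Theory Num.Theory.
Import numFieldNormedType.Exports.

Local Open Scope classical_set_scope.
Local Open Scope ring_scope.

Definition squarefree (D : nat) : Prop :=
  forall d : nat, (d ^ 2 %| D)%N -> d = 1%N.

(* As usual, a character of (Z/D)^* is extended to the integers by zero.
   The value chi 1 = 1 follows, since chi 1 is a nonzero idempotent. *)
Record dirichlet_character (F : fieldType) (D : nat) (chi : int -> F) : Prop :=
  DirichletCharacter {
    dchar_periodic : forall a : int, chi (a + D%:Z) = chi a;
    dcharM : forall a b : int, chi (a * b) = chi a * chi b;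
    dchar_neq0 : forall a : int, (chi a != 0) = coprimez a D%:Z
  }.

(* No proper divisor d of D is an induced modulus of chi. *)
Definition primitive_character (F : fieldType) (D : nat) (chi : int -> F) :
    Prop :=
  dirichlet_character D chi /\
  forall d : nat, (d %| D)%N -> (d < D)%N ->
    exists a : int,
      [/\ coprimez a D%:Z, (a = 1 %[mod d%:Z])%Z & chi a <> 1].

Definition upper_half_plane (R : realType) : set R[i] :=
  [set z | 0 < complex.Im z].

Definition cexp (R : realType) (z : R[i]) : R[i] :=
  let r := expR (complex.Re z) in
  Complex (r * cos (complex.Im z)) (r * sin (complex.Im z)).

Definition qparam (R : realType) (z : R[i]) : R[i] :=
  cexp (Complex 0 (2 * pi) * z).

(* K-fold slash invariance under SL_2(Z) *)
Definition modular_of_weight (R : realType) (K : nat) (f : R[i] -> R[i]) :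
    Prop :=
  forall a b c d : int, a * d - b * c = 1 ->
  forall z : R[i], upper_half_plane z ->
    f ((a%:~R * z + b%:~R) / (c%:~R * z + d%:~R)) =
    (c%:~R * z + d%:~R) ^+ K * f z.

(* Differentiation is over the field R[i], hence in the complex sense. *)
Definition holomorphic_on_uhp (R : realType) (f : R[i] -> R[i]) : Prop :=
  forall z : R[i], upper_half_plane z ->
    derivable (f : R[i]^o -> R[i]^o) z 1.

Definition q_expansion (R : realType) (f : R[i] -> R[i]) (a : nat -> R[i]) :
    Prop :=
  forall z : R[i], upper_half_plane z ->
    (\sum_(0 <= k < N) a k * qparam z ^+ k : R[i]^o) @[N --> \oo]
      --> (f z : R[i]^o).

(* S_K. A function on the upper half-plane is represented by its extension
   by zero to the whole plane, so that distinct elements of this set are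
   distinct cusp forms. *)
Definition cusp_form (R : realType) (K : nat) : set (R[i] -> R[i]) :=
  [set f | [/\ holomorphic_on_uhp f,
               modular_of_weight K f,
               exists2 a : nat -> R[i], q_expansion f a & a 0%N = 0 &
               forall z : R[i], ~ upper_half_plane z -> f z = 0]].

(* The q-expansion of f, which is unique if it exists. *)
Definition fourier_coef (R : realType) (f : R[i] -> R[i]) : nat -> R[i] :=
  xget (fun=> 0) [set a | q_expansion f a].

Definition twist (R : realType) (chi : int -> R[i]) (f : R[i] -> R[i])
    (z : R[i]) : R[i] :=
  limn (fun N => \sum_(1 <= k < N) chi k%:Z * fourier_coef f k * qparam z ^+ k
                 : R[i]^o).

(* The integral of g along the imaginary half-axis z = it, dz = i dt. *)
Definition integral_0_ioo (R : realType) (g : R[i] -> R[i]) : R[i] :=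
  Complex 0 1 *
  Complex
    (Rintegral (@lebesgue_measure R) `]0, +oo[
       (fun t : R => complex.Re (g (Complex 0 t))))
    (Rintegral (@lebesgue_measure R) `]0, +oo[
       (fun t : R => complex.Im (g (Complex 0 t)))).

Definition twisted_period (R : realType) (m : nat) (chi : int -> R[i])
    (f : R[i] -> R[i]) : R[i] :=
  integral_0_ioo (fun z => twist chi f z * z ^+ m).

(* Linear independence over F of the restrictions of the r i to S, as
   F-valued functions on S. *)
Definition lin_indep_on (F : fieldType) (V : Type) (S : set V) (n : nat)
    (r : 'I_n -> V -> F) : Prop :=
  forall c : 'I_n -> F,
    (forall f : V, S f -> \sum_(i < n) c i * r i f = 0) ->
    forall i : 'I_n, c i = 0.

(* Main.v *)
Require Import Defs.
From mathcomp Require Import all_boot all_order all_algebra.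
From mathcomp Require Import complex finmap ring lra zify.
From mathcomp Require cyclic.
From mathcomp Require Import all_classical all_reals all_analysis.
From mathcomp Require Import measurable_realfun.

(* The cusp forms f = Delta^j E_(K-12j), where Delta = q + O(q^2), are close to
   q^j on Im z >= 1/D when K is large. The twist of f is a combination of the
   translates f(z + a/D), with a prime to D; a matrix of SL_2(Z) moves the cusp
   a/D to infinity, so near t = 0 the twist at z = it is a Gauss sum times
   (iDt)^-K exp(-2 pi j / (D^2 t)), provided that j = 1 mod D. Integrating gives
   r_m(f) = A_m j^-(K-m-1) (1 + o(1)), uniformly in 2m <= K - 4, with A_m nonzero
   since Gauss sums of primitive characters do not vanish. For j = B^(2k) with
   k < n and B = 4nD + 1, the matrix of periods is a small perturbation of a
   generalized Vandermonde matrix, which becomes diagonally dominant after a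
   rescaling of its rows and columns. *)

Set Implicit Arguments.
Unset Strict Implicit.
Unset Printing Implicit Defensive.

Import Order.TTheory GRing.Theory Num.Theory.
Import numFieldNormedType.Exports.

Local Open Scope complex_scope.
Local Open Scope ring_scope.

(** * Moduli and unconditional sums *)

Section ComplexModulus.
Variable R : realType.
Implicit Types (z w : R[i]) (x y : R).

(** Every error is measured against n! with n = K-m-2. Since 2m <= K-4 gives n >= K/2, a quantity
    bounded by Q^K, with Q fixed before K, is negligible. This matters because for 1/D <= Im z <= 1
    the Eisenstein factor is only controlled by a K-th power. The half-line is cut at t = 1/D, the
    fixed point of t -> 1/(D^2 t): on either side the form, or its image at the cusp, is evaluated
    at height at least 1/D. The side t >= 1/D contributes only at the scale of m!, the other one at
    the scale of n!. The congruence j = 1 mod D keeps the Gauss sum, hence A_m, the same for all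
    test forms, so that the matrix of periods is A_m times powers of j up to a relative error. The
    even exponents in j = B^(2k) leave room for the odd slopes 2i+1 of the weights that rescale the
    rows, and each off-diagonal entry then loses a factor B. With relative errors 1/2, a diagonal
    entry keeps half its size and an off-diagonal one grows by at most 3/2, so dominance needs 3n <
    B. *)

Definition cabs z : R := ComplexField.Normc.normc z.

Lemma normE z : `|z| = (cabs z)%:C. Proof. by []. Qed.

Lemma cabsE z : cabs z = Num.sqrt (complex.Re z ^+ 2 + complex.Im z ^+ 2).
Proof. by case: z. Qed.

Lemma cabs_sqr z : cabs z ^+ 2 = complex.Re z ^+ 2 + complex.Im z ^+ 2.
Proof. by rewrite cabsE sqr_sqrtr // addr_ge0 ?sqr_ge0. Qed.

Lemma cabs_ge0 z : 0 <= cabs z. Proof. by rewrite cabsE sqrtr_ge0. Qed.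

Lemma cabs0 : cabs 0 = 0. Proof. exact: ComplexField.Normc.normc0. Qed.
Lemma cabs1 : cabs 1 = 1. Proof. exact: ComplexField.Normc.normc1. Qed.
Lemma cabsM z w : cabs (z * w) = cabs z * cabs w.
Proof. exact: ComplexField.Normc.normcM. Qed.
Lemma cabsV z : cabs z^-1 = (cabs z)^-1.
Proof. exact: ComplexField.Normc.normcV. Qed.
Lemma cabsN z : cabs (- z) = cabs z. Proof. exact: normcN. Qed.
Lemma cabsD z w : cabs (z + w) <= cabs z + cabs w.
Proof. exact: le_normcD. Qed.
Lemma cabsB z w : cabs (z - w) = cabs (w - z).
Proof. by rewrite -cabsN opprB. Qed.
Lemma cabsX z n : cabs (z ^+ n) = cabs z ^+ n.
Proof. by elim: n => [|n IH]; rewrite ?expr0 ?cabs1 // !exprS cabsM IH. Qed.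
Lemma cabs_eq0 z : (cabs z == 0) = (z == 0).
Proof.
apply/eqP/eqP => [|->]; last exact: cabs0.
exact: ComplexField.Normc.eq0_normc.
Qed.
Lemma cabs_gt0 z : (0 < cabs z) = (z != 0).
Proof. by rewrite lt_neqAle cabs_ge0 andbT eq_sym cabs_eq0. Qed.
Lemma cabsC x : cabs x%:C = `|x|.
Proof. by rewrite cabsE /= expr0n addr0 sqrtr_sqr. Qed.
Lemma cabs_rect x y : cabs (Complex x y) <= `|x| + `|y|.
Proof.
have -> : Complex x y = x%:C + 'i%C * y%:C by rewrite [LHS]complexE.
apply: le_trans (cabsD _ _) _; rewrite cabsM !cabsC cabsE /=.
by rewrite expr0n expr1n add0r sqrtr1 mul1r.
Qed.
Lemma Re_le_cabs z : `|complex.Re z| <= cabs z.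
Proof. by rewrite cabsE -sqrtr_sqr ler_wsqrtr // lerDl sqr_ge0. Qed.
Lemma Im_le_cabs z : `|complex.Im z| <= cabs z.
Proof. by rewrite cabsE -sqrtr_sqr ler_wsqrtr // lerDr sqr_ge0. Qed.
Lemma cabs_sum (I : Type) (r : seq I) (P : pred I) (f : I -> R[i]) :
  cabs (\sum_(i <- r | P i) f i) <= \sum_(i <- r | P i) cabs (f i).
Proof.
elim/big_ind2 : _ => [|a b c d h1 h2|//]; first by rewrite cabs0.
by apply: le_trans (cabsD _ _) _; rewrite lerD.
Qed.
Lemma cabs_nat n : cabs n%:R = n%:R.
Proof. by rewrite -(rmorph_nat (real_complex R)) cabsC normr_nat. Qed.

End ComplexModulus.

(* A family is summed along the directed set of finite subsets of its index
   type, so that reindexing and Fubini need no choice of an enumeration. *)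
Section UnconditionalSums.
Variable R : realType.
Implicit Types (T I : choiceType).

Definition hsum T (f : T -> R[i]) (s : R[i]) : Prop :=
  forall e : R, 0 < e -> exists A : {fset T}, forall B : {fset T},
    (A `<=` B)%fset -> cabs (\sum_(x <- B) f x - s) <= e.

Definition asum T (f : T -> R[i]) (M : R) : Prop :=
  forall A : {fset T}, \sum_(x <- A) cabs (f x) <= M.

Lemma ler_sum_fset T (g : T -> R) (A B : {fset T}) :
  (forall x, 0 <= g x) -> (A `<=` B)%fset ->
  \sum_(x <- A) g x <= \sum_(x <- B) g x.
Proof.
move=> g0 AB; rewrite [leRHS](big_fsetID _ (mem A)) /=.
have -> : [fset x in B | x \in A]%fset = A.
  apply/fsetP => x; rewrite !inE /= andbC; case: (boolP (x \in A)) => //=.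
  by move=> /(fsubsetP AB) ->.
by rewrite lerDl sumr_ge0.
Qed.

Lemma sum_const_seq (J : Type) (r : seq J) (c : R) :
  \sum_(i <- r) c = c * (size r)%:R.
Proof. by rewrite big_const_seq count_predT iter_addr_0 mulr_natr. Qed.

Lemma hsum_unique T (f : T -> R[i]) s t : hsum f s -> hsum f t -> s = t.
Proof.
move=> fs ft; apply/eqP; rewrite -subr_eq0 -cabs_eq0 eq_le cabs_ge0 andbT.
apply/ler_addgt0Pr => e e0; rewrite add0r.
have [A HA] := fs (e / 2) (divr_gt0 e0 (ltr0Sn _ 1)).
have [B HB] := ft (e / 2) (divr_gt0 e0 (ltr0Sn _ 1)).
have := HA (A `|` B)%fset (fsubsetUl _ _).
have := HB (A `|` B)%fset (fsubsetUr _ _).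
set S := \sum_(x <- _) _ => h1 h2.
have -> : s - t = (S - t) - (S - s) by ring.
rewrite [e]splitr; apply: le_trans (cabsD _ _) _.
by rewrite cabsN lerD.
Qed.

Lemma eq_hsum T (f g : T -> R[i]) s : f =1 g -> hsum f s -> hsum g s.
Proof. by move=> /funext ->. Qed.

Lemma hsum_fin T (f : T -> R[i]) (A : {fset T}) :
  (forall x, x \notin A -> f x = 0) -> hsum f (\sum_(x <- A) f x).
Proof.
move=> f0 e e0; exists A => B AB.
rewrite (big_fset_incl _ AB) ?subrr ?cabs0 ?ltW // => x _; exact: f0.
Qed.

Lemma hsum0 T : hsum (fun _ : T => 0) 0.
Proof. by have := @hsum_fin T (fun=> 0) fset0 (fun _ _ => erefl); rewrite big_seq_fset0. Qed.

Lemma hsumD T (f g : T -> R[i]) s t :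
  hsum f s -> hsum g t -> hsum (fun x => f x + g x) (s + t).
Proof.
move=> fs gt e e0.
have [A HA] := fs (e / 2) (divr_gt0 e0 (ltr0Sn _ 1)).
have [B HB] := gt (e / 2) (divr_gt0 e0 (ltr0Sn _ 1)).
exists (A `|` B)%fset => D; rewrite fsubUset => /andP[AD BD].
rewrite big_split /= opprD addrACA [e]splitr.
by apply: le_trans (cabsD _ _) _; rewrite lerD ?HA ?HB.
Qed.

Lemma hsumZ T (f : T -> R[i]) c s :
  hsum f s -> hsum (fun x => c * f x) (c * s).
Proof.
move=> fs e e0; have c0 : 0 < cabs c + 1 by rewrite ltr_wpDl ?cabs_ge0.
have [A HA] := fs (e / (cabs c + 1)) (divr_gt0 e0 c0).
exists A => B AB; rewrite -mulr_sumr -mulrBr cabsM.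
apply: le_trans (ler_wpM2l (cabs_ge0 _) (HA _ AB)) _.
by rewrite mulrCA ler_piMr ?(ltW e0) // ler_pdivrMr // mul1r lerDl.
Qed.

Lemma hsumN T (f : T -> R[i]) s : hsum f s -> hsum (fun x => - f x) (- s).
Proof.
move=> /(hsumZ (-1)); rewrite mulN1r; apply: eq_hsum => x; exact: mulN1r.
Qed.

Lemma hsumB T (f g : T -> R[i]) s t :
  hsum f s -> hsum g t -> hsum (fun x => f x - g x) (s - t).
Proof. by move=> fs /hsumN; apply: hsumD. Qed.

Lemma hsum_sum T J (r : seq J) (f : J -> T -> R[i]) (s : J -> R[i]) :
  (forall j, hsum (f j) (s j)) ->
  hsum (fun x => \sum_(j <- r) f j x) (\sum_(j <- r) s j).
Proof.
move=> fs; elim: r => [|j r IH].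
  rewrite big_nil; apply: eq_hsum (hsum0 T) => x; by rewrite big_nil.
rewrite big_cons; apply: eq_hsum (hsumD (fs j) IH) => x.
by rewrite big_cons.
Qed.

Lemma asum_ge0 T (f : T -> R[i]) M : asum f M -> 0 <= M.
Proof. by move=> /(_ fset0); rewrite big_seq_fset0. Qed.

Lemma le_asum T (f g : T -> R[i]) M :
  (forall x, cabs (f x) <= cabs (g x)) -> asum g M -> asum f M.
Proof. by move=> fg gM A; apply: le_trans (gM A); apply: ler_sum. Qed.

Lemma asumD T (f g : T -> R[i]) M N :
  asum f M -> asum g N -> asum (fun x => f x + g x) (M + N).
Proof.
move=> fM gN A; apply: le_trans (lerD (fM A) (gN A)).
by rewrite -big_split /= ler_sum // => x _; apply: cabsD.
Qed.

Lemma asumZ T (f : T -> R[i]) c M :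
  asum f M -> asum (fun x => c * f x) (cabs c * M).
Proof.
move=> fM A; under eq_bigr do rewrite cabsM.
by rewrite -mulr_sumr ler_wpM2l ?cabs_ge0.
Qed.

Lemma hsum_le T (f : T -> R[i]) s M : hsum f s -> asum f M -> cabs s <= M.
Proof.
move=> fs fM; apply/ler_addgt0Pr => e e0; have [A /(_ A (fsubset_refl _)) HA] := fs e e0.
have -> : s = \sum_(x <- A) f x - (\sum_(x <- A) f x - s) by ring.
apply: le_trans (cabsD _ _) _; rewrite cabsN lerD //.
by apply: le_trans (cabs_sum _ _ _) (fM A).
Qed.

Lemma hsum_ge0_exists T (g : T -> R) M : (forall x, 0 <= g x) ->
  (forall A : {fset T}, \sum_(x <- A) g x <= M) ->
  exists s : R, hsum (fun x => (g x)%:C) s%:C.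
Proof.
move=> g0 gM; pose E := [set \sum_(x <- A) g x | A in [set: {fset T}]]%classic.
have hE : has_sup E.
  split; first by exists (\sum_(x <- fset0) g x); exists fset0.
  by exists M => _ [A _ <-].
exists (sup E) => e e0; have [_ [A _ <-] hA] := sup_adherent e0 hE.
exists A => B AB; rewrite -rmorph_sum -rmorphB cabsC ler_norml.
have h1 : \sum_(x <- B) g x <= sup E by apply: (sup_upper_bound hE); exists B.
have := ler_sum_fset g0 AB.
lra.
Qed.

Lemma asum_hsum T (f : T -> R[i]) M : asum f M -> exists s, hsum f s.
Proof.
move=> fM; have [S HS] := hsum_ge0_exists (fun x => cabs_ge0 (f x)) fM.
have part (p : T -> R) : (forall x, `|p x| <= cabs (f x)) ->
    exists s : R, hsum (fun x => (p x)%:C) s%:C.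
  (* Adding [cabs (f x)] makes the real family [p] nonnegative; the sum [S] of the moduli is
     subtracted afterwards. *)
  move=> pf; have [||s Hs] := @hsum_ge0_exists T (fun x => p x + cabs (f x)) (M + M).
  - by move=> x; have := pf x; rewrite ler_norml; lra.
  - move=> A; rewrite big_split /= lerD //.
    by apply: le_trans (fM A); apply: ler_sum => x _; apply: le_trans (pf x); apply: ler_norm.
  exists (s - S); rewrite rmorphB; apply: eq_hsum (hsumB Hs HS) => x /=.
  by rewrite -rmorphB addrK.
have [a Ha] := part (fun x => complex.Re (f x)) (fun x => Re_le_cabs _).
have [b Hb] := part (fun x => complex.Im (f x)) (fun x => Im_le_cabs _).
exists (a%:C + 'i%C * b%:C); apply: eq_hsum (hsumD Ha (hsumZ 'i%C Hb)) => x.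
by rewrite -complexE.
Qed.

Lemma hsum_inj T I (h : I -> T) (f : T -> R[i]) s : injective h ->
  (forall x, (forall i, h i != x) -> f x = 0) ->
  hsum (fun i => f (h i)) s -> hsum f s.
Proof.
move=> hi f0 fs e e0; have [A HA] := fs e e0.
exists [fset h i | i in A]%fset => B AB.
have [C HC] : exists C : {fset I}, (A `<=` C)%fset /\
    \sum_(x <- B) f x = \sum_(i <- C) f (h i).
  (* [C] is the preimage of [B]: one preimage is chosen for each element that has one, and the other
     elements of [B] contribute zero. *)
  pose C := [fset i in pmap (fun x => if pselect (exists i, h i == x) is left e
     then Some (xchoose e) else None) B]%fset.
  have inC i : (i \in C) = (h i \in B).
    rewrite !inE mem_pmap; apply/mapP/idP => [[x xB]|hB].
      by case: pselect => // ex [->]; rewrite (eqP (xchooseP ex)).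
    exists (h i) => //; case: pselect => [ex|[]]; last by exists i.
    by congr Some; apply: hi; rewrite (eqP (xchooseP ex)).
  exists C; split.
    by apply/fsubsetP => i iA; rewrite inC; apply: (fsubsetP AB); rewrite in_imfset.
  have CB : ([fset h i | i in C] `<=` B)%fset.
    by apply/fsubsetP => _ /imfsetP[i /= iC ->]; rewrite -inC.
  rewrite -(big_fset_incl _ CB) => [|x xB xC]; first by rewrite big_imfset //= => ? ? _ _ /hi.
  apply: f0 => i; apply: contra xC => /eqP ix; apply/imfsetP; exists i => //=.
  by rewrite inC ix.
by case: HC => AC ->; apply: HA.
Qed.

Lemma hsum_comp_inj T I (h : I -> T) (f : T -> R[i]) s : injective h ->
  (forall x, (forall i, h i != x) -> f x = 0) ->
  hsum f s -> hsum (fun i => f (h i)) s.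
Proof.
move=> hi f0 fs e e0; have [A HA] := fs e e0.
pose C := [fset i in pmap (fun x => if pselect (exists i, h i == x) is left e
     then Some (xchoose e) else None) A]%fset.
exists C => D CD.
have -> : \sum_(i <- D) f (h i) = \sum_(x <- (A `|` [fset h i | i in D])%fset) f x.
  rewrite -(big_fset_incl _ (fsubsetUr A [fset h i | i in D]%fset)).
    by rewrite big_imfset //= => ? ? _ _ /hi.
  move=> x; rewrite in_fsetU => /orP[xA|->//] xD; apply: f0 => i.
  apply: contra xD => /eqP ix; apply/imfsetP; exists i => //=.
  apply: (fsubsetP CD); rewrite !inE mem_pmap; apply/mapP; exists x => //.
  case: pselect => [ex|[]]; last by exists i; rewrite ix.
  by congr Some; apply: hi; rewrite (eqP (xchooseP ex)).
exact/HA/fsubsetUl.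
Qed.

Lemma hsum_bij T I (h : I -> T) (f : T -> R[i]) s : bijective h ->
  hsum f s -> hsum (fun i => f (h i)) s.
Proof.
move=> [g hg gh]; apply: hsum_comp_inj; first exact: can_inj hg.
by move=> x /(_ (g x)); rewrite gh eqxx.
Qed.

Lemma asum_inj T I (h : I -> T) (f : T -> R[i]) M : injective h ->
  asum f M -> asum (fun i => f (h i)) M.
Proof.
move=> hi fM A; apply: le_trans (fM [fset h i | i in A]%fset).
by rewrite big_imfset //= => ? ? _ _ /hi.
Qed.

(** Grouping by the values of [p] is the common source of Fubini's theorem, of Cauchy products and
    of divisor sums. Half of the error goes to the total sum, the other half is shared among the
    finitely many fibres over [B]. *)
Lemma hsum_fiber T I (p : T -> I) (f : T -> R[i]) (g : I -> R[i]) s :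
  hsum f s -> (forall i, hsum (fun x => if p x == i then f x else 0) (g i)) ->
  hsum g s.
Proof.
move=> fs fg e e0; have e2 : 0 < e / 2 by rewrite divr_gt0.
have [A HA] := fs _ e2; exists [fset p x | x in A]%fset => B AB.
have n0 : 0 < (size B).+1%:R :> R by rewrite ltr0n.
have /choice [K HK] : forall i, exists K : {fset T}, forall D, (K `<=` D)%fset ->
    cabs (\sum_(x <- D) (if p x == i then f x else 0) - g i) <= e / 2 / (size B).+1%:R.
  by move=> i; apply: fg; rewrite divr_gt0.
(* [D] is large enough for the total sum and for each fibre over [B] at once; [E] is its part lying
   over [B]. *)
pose D := (A `|` \bigcup_(i <- B) K i)%fset.
pose E := [fset x in D | p x \in B]%fset.
have hE : cabs (\sum_(x <- E) f x - s) <= e / 2.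
  apply: HA; apply/fsubsetP => x xA; rewrite !inE /= xA /=.
  by apply: (fsubsetP AB); rewrite in_imfset.
have EE : \sum_(x <- E) f x = \sum_(i <- B) \sum_(x <- D) if p x == i then f x else 0.
  rewrite big_fset /= exchange_big /= big_mkcond /=; apply: eq_bigr => x _.
  case: ifPn => pB; last first.
    rewrite big1_seq // => i /= iB; case: eqP => // pi; by rewrite pi iB in pB.
  rewrite (big_fsetD1 _ pB) /= eqxx big1_seq ?addr0 // => i /=.
  by rewrite !inE => /andP[/negPf]; rewrite eq_sym => ->.
have -> : \sum_(i <- B) g i - s = (\sum_(x <- E) f x - s) -
   \sum_(i <- B) (\sum_(x <- D) (if p x == i then f x else 0) - g i).
  by rewrite sumrB -EE; ring.
rewrite [e]splitr; apply: le_trans (cabsD _ _) _; rewrite cabsN lerD //.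
apply: le_trans (cabs_sum _ _ _) _.
apply: (@le_trans _ _ (\sum_(i <- B) (e / 2 / (size B).+1%:R))).
  rewrite big_seq_cond [leRHS]big_seq_cond; apply: ler_sum => i /andP[iB _].
  apply: HK; apply: fsubset_trans (fsubsetUr _ _).
  exact: bigfcup_sup.
rewrite sum_const_seq -[leLHS]mulrA ler_piMr ?(ltW e2) //.
by rewrite mulrC ler_pdivrMr // mul1r ler_nat.
Qed.

Lemma hsum_fubini T I (f : I * T -> R[i]) (g : I -> R[i]) s :
  hsum f s -> (forall i, hsum (fun x => f (i, x)) (g i)) -> hsum g s.
Proof.
move=> fs fg; apply: (@hsum_fiber _ _ fst _ _ _ fs) => i.
apply: (@hsum_inj _ _ (fun x => (i, x))) => [x y []//|[j x] /= h|].
  by case: eqP => // ji; move: (h x); rewrite ji eqxx.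
by apply: eq_hsum (fg i) => x /=; rewrite eqxx.
Qed.

(** A finite set of pairs is grouped by first coordinate; within a group the second coordinates are
    distinct, so the group of [i] contributes at most [cabs (f i) * N]. *)
Lemma asum_prod T I (f : I -> R[i]) (g : T -> R[i]) M N :
  asum f M -> asum g N -> asum (fun p => f p.1 * g p.2) (M * N).
Proof.
move=> fM gN A.
rewrite (partition_big_imfset _ fst) /=.
have N0 := asum_ge0 gN.
apply: (@le_trans _ _ (\sum_(i <- [fset p.1 | p in A]%fset) cabs (f i) * N)).
  apply: ler_sum => i _; rewrite big_fset_condE /=.
  rewrite (eq_big_seq (fun p => cabs (f i) * cabs (g p.2))); last first.
    by move=> p; rewrite !inE /= => /andP[_ /eqP <-]; rewrite cabsM.
  rewrite -mulr_sumr ler_wpM2l ?cabs_ge0 //.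
  have inj : {in [fset x | x in A & x.1 == i]%fset &, injective (@snd I T)}.
    move=> [a b] [c d]; rewrite !inE /= => /andP[_ /eqP ->] /andP[_ /eqP ->].
    by move=> ->.
  by have := gN [fset p.2 | p in [fset x | x in A & x.1 == i]]%fset; rewrite big_imfset.
by rewrite -mulr_suml ler_wpM2r.
Qed.

Lemma hsum_prod T I (f : I -> R[i]) (g : T -> R[i]) M N s t :
  asum f M -> asum g N -> hsum f s -> hsum g t ->
  hsum (fun p => f p.1 * g p.2) (s * t).
Proof.
move=> fM gN fs gt; have [u Hu] := asum_hsum (asum_prod fM gN).
have h : hsum (fun i => t * f i) u.
  apply: hsum_fubini Hu _ => i /=; rewrite mulrC; exact: hsumZ.
by rewrite mulrC -(hsum_unique h (hsumZ t fs)).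
Qed.

Lemma hsum_nat (f : nat -> R[i]) s : hsum f s -> forall e : R, 0 < e ->
  exists N0, forall N, (N0 <= N)%N -> cabs (\sum_(0 <= k < N) f k - s) <= e.
Proof.
move=> fs e e0; have [A HA] := fs e e0.
exists (\max_(k <- A) k.+1)%N => N AN.
have <- : \sum_(k <- [fset k in iota 0 N]%fset) f k = \sum_(0 <= k < N) f k.
  apply: perm_big; rewrite /index_iota subn0; apply: uniq_perm => //; first exact: iota_uniq.
  by move=> x; rewrite !inE.
apply: HA; apply/fsubsetP => k kA; rewrite !inE mem_iota /= add0n.
by apply: leq_trans AN; rewrite (big_rem k) //= leq_max leqnn.
Qed.

Lemma asum_nat (f : nat -> R[i]) M :
  (forall N, \sum_(0 <= k < N) cabs (f k) <= M) -> asum f M.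
Proof.
move=> fM A; pose N := (\max_(k <- A) k.+1)%N.
apply: le_trans (fM N).
have <- : \sum_(k <- [fset k in iota 0 N]%fset) cabs (f k) = \sum_(0 <= k < N) cabs (f k).
  apply: perm_big; rewrite /index_iota subn0; apply: uniq_perm => //; first exact: iota_uniq.
  by move=> x; rewrite !inE.
apply: ler_sum_fset => [k|]; first exact: cabs_ge0.
apply/fsubsetP => k kA; rewrite !inE mem_iota /= add0n.
by rewrite /N (big_rem k) //= leq_max leqnn.
Qed.

(** Dominated convergence for series: outside a finite set [A] the dominating family leaves a small
    tail, and on [A] finitely many pointwise limits are taken. *)
Lemma tannery T (f : nat -> T -> R[i]) (f0 g : T -> R[i]) (s : nat -> R[i]) s0 M :
  asum g M -> (forall N x, cabs (f N x) <= cabs (g x)) ->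
  (forall x (e : R), 0 < e -> exists N0, forall N, (N0 <= N)%N -> cabs (f N x - f0 x) <= e) ->
  (forall N, hsum (f N) (s N)) -> hsum f0 s0 ->
  forall e : R, 0 < e -> exists N0, forall N, (N0 <= N)%N -> cabs (s N - s0) <= e.
Proof.
move=> gM fg ff fs fs0 e e0.
have f0g x : cabs (f0 x) <= cabs (g x).
  apply/ler_addgt0Pr => d d0; have [N /(_ N (leqnn N)) h] := ff x d d0.
  have -> : f0 x = f N x - (f N x - f0 x) by ring.
  by apply: le_trans (cabsD _ _) _; rewrite cabsN lerD.
have e4 : 0 < e / 4 by lra.
have [S HS] := hsum_ge0_exists (fun x => cabs_ge0 (g x)) gM.
have [A HA] := HS _ e4.
have tail (h : T -> R[i]) t : (forall x, cabs (h x) <= cabs (g x)) -> hsum h t ->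
    (* The part of [g] beyond [A] costs e/4 and the comparison with the full sum e/8. Used for [f N]
       and for [f0], this gives 3e/4; the remaining e/4 is spent on [A]. *)
    cabs (\sum_(x <- A) h x - t) <= e / 4 + e / 8.
  move=> hg ht; have e8 : 0 < e / 8 by lra.
  have [B HB] := ht (e / 8) e8.
  have := HB _ (fsubsetUr A B); set D := (A `|` B)%fset => hD.
  have AD : (A `<=` D)%fset by apply: fsubsetUl.
  have -> : \sum_(x <- A) h x - t = (\sum_(x <- D) h x - t) - (\sum_(x <- D) h x - \sum_(x <- A) h x) by ring.
  rewrite addrC; apply: le_trans (cabsD _ _) _; rewrite addrC cabsN addrC lerD //.
  have := HA _ AD; have := HA _ (fsubset_refl A).
  have split_sum (V : zmodType) (k : T -> V) : \sum_(x <- D) k x - \sum_(x <- A) k x =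
     \sum_(x <- [fset x in D | x \notin A]%fset) k x.
    rewrite (big_fsetID _ (mem A)) /=.
    have -> : [fset x in D | x \in A]%fset = A.
      apply/fsetP => x; rewrite !inE /= andbC; case: (boolP (x \in A)) => //=.
    by rewrite addrAC subrr add0r.
  rewrite split_sum => h1 h2.
  apply: le_trans (cabs_sum _ _ _) _; apply: le_trans (ler_sum _ (fun x _ => hg x)) _.
  rewrite -split_sum.
  move: h1 h2; rewrite -!rmorph_sum -!rmorphB !cabsC !ler_norml.
  have mono (B' : {fset T}) : \sum_(x <- B') cabs (g x) <= S.
    apply/ler_addgt0Pr => d d0; have [A' HA'] := HS _ d0.
    have := HA' _ (fsubsetUl A' B'); rewrite -rmorph_sum -rmorphB cabsC ler_norml.
    have := ler_sum_fset (fun x => cabs_ge0 (g x)) (fsubsetUr A' B').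
    lra.
  have := mono D; lra.
have /choice [N0 HN0] : forall x, exists N0, forall N, (N0 <= N)%N ->
    cabs (f N x - f0 x) <= e / 4 / (size A).+1%:R.
  by move=> x; apply: ff; rewrite divr_gt0 ?ltr0n.
exists (\max_(x <- A) N0 x)%N => N hN.
have hA : cabs (\sum_(x <- A) f N x - \sum_(x <- A) f0 x) <= e / 4.
  rewrite -sumrB; apply: le_trans (cabs_sum _ _ _) _.
  apply: (@le_trans _ _ (\sum_(i <- A) (e / 4 / (size A).+1%:R))).
    rewrite big_seq_cond [leRHS]big_seq_cond; apply: ler_sum => x /andP[xA _].
    by apply: HN0; apply: leq_trans hN; rewrite (big_rem x) //= leq_max leqnn.
  rewrite sum_const_seq -[leLHS]mulrA ler_piMr ?(ltW e4) //.
  by rewrite mulrC ler_pdivrMr ?ltr0n // mul1r ler_nat.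
have h1 := tail _ _ (fg N) (fs N).
have h2 := tail _ _ f0g fs0.
have -> : s N - s0 = (\sum_(x <- A) f N x - \sum_(x <- A) f0 x)
   - (\sum_(x <- A) f N x - s N) + (\sum_(x <- A) f0 x - s0) by ring.
apply: le_trans (cabsD _ _) _; apply: le_trans (lerD (cabsD _ _) (lexx _)) _.
rewrite cabsN; lra.
Qed.

End UnconditionalSums.

(** * The complex exponential *)

Section ComplexExponential.
Variable R : realType.
Implicit Types (z w : R[i]) (x y t : R).

Lemma cReD z w : complex.Re (z + w) = complex.Re z + complex.Re w.
Proof. by case: z w => [a b] [c d]. Qed.
Lemma cImD z w : complex.Im (z + w) = complex.Im z + complex.Im w.
Proof. by case: z w => [a b] [c d]. Qed.
Lemma cReM z w : complex.Re (z * w) =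
  complex.Re z * complex.Re w - complex.Im z * complex.Im w.
Proof. by case: z w => [a b] [c d]. Qed.
Lemma cImM z w : complex.Im (z * w) =
  complex.Re z * complex.Im w + complex.Im z * complex.Re w.
Proof. by case: z w => [a b] [c d]. Qed.
Lemma rect_eq z w : complex.Re z = complex.Re w -> complex.Im z = complex.Im w -> z = w.
Proof. by case: z w => [a b] [c d] /= -> ->. Qed.
Lemma Re_nat n : complex.Re (n%:R : R[i]) = n%:R.
Proof. by rewrite -(rmorph_nat (real_complex R)). Qed.
Lemma Im_nat n : complex.Im (n%:R : R[i]) = 0.
Proof. by rewrite -(rmorph_nat (real_complex R)). Qed.
Lemma Re_int (n : int) : complex.Re (n%:~R : R[i]) = n%:~R.
Proof. by rewrite -(rmorph_int (real_complex R)). Qed.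
Lemma Im_int (n : int) : complex.Im (n%:~R : R[i]) = 0.
Proof. by rewrite -(rmorph_int (real_complex R)). Qed.

Lemma sin_mvt t : 0 < t -> exists2 s, 0 < s < t & sin t = t * cos s.
Proof.
move=> t0.
have [s] := MVT t0 (fun x _ => is_derive_sin x) (continuous_subspaceT (@continuous_sin R)).
by rewrite in_itv /= sin0 !subr0 mulrC => h ->; exists s.
Qed.

Lemma sin_le_id t : 0 <= t -> `|sin t| <= t.
Proof.
rewrite le_eqVlt => /predU1P[<-|t0]; first by rewrite sin0 normr0.
have [s _ ->] := sin_mvt t0.
by rewrite normrM gtr0_norm // ler_piMr ?(ltW t0) // cos_max.
Qed.

Lemma norm_sin_le t : `|sin t| <= `|t|.
Proof.
have [t0|t0] := leP 0 t; first by rewrite (ger0_norm t0) sin_le_id.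
by rewrite (ltr0_norm t0) -normrN -sinN sin_le_id // oppr_ge0 ltW.
Qed.

Lemma cos_ge t : 1 - t ^+ 2 / 2 <= cos t.
Proof.
have -> : t = (t / 2) *+ 2 by rewrite mulr2n -splitr.
rewrite cos_mulr2n cos2sin2.
have := norm_sin_le (t / 2); rewrite -ler_sqr ?nnegrE // ?normr_ge0 //.
rewrite !real_normK ?num_real // => h; set u := t / 2 in h *.
have -> : (u *+ 2) ^+ 2 / 2 = 2 * u ^+ 2 by field.
lra.
Qed.

(** Write sin t = 2 cos(t/2) sin(t/2) and sin(t/2) = (t/2) cos s with s < t/2. Then cos(t/2) cos s
    >= cos(t/2)^2 >= 1/2, the last step because cos t >= 0. *)
Lemma sin_ge_half t : 0 <= t <= pi / 2 -> t / 2 <= sin t.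
Proof.
rewrite le_eqVlt => /andP[/predU1P[<-|t0] tp]; first by rewrite sin0 mul0r.
have -> : sin t = (cos (t / 2) * sin (t / 2)) *+ 2.
  by rewrite -sin_mulr2n mulr2n -splitr.
have t20 : 0 < t / 2 by rewrite divr_gt0.
have [s /andP[s0 st] ->] := sin_mvt t20.
have pi0 := pi_gt0 R.
have hc : cos (t / 2) <= cos s.
  by rewrite leNgt ltr_cos ?in_itv /=; [rewrite -leNgt ltW|lra|lra].
have ct : 0 <= cos (t / 2) by apply: cos_ge0_pihalf; lra.
have h0 : 0 <= cos t by apply: cos_ge0_pihalf; lra.
have hh : cos t = cos (t / 2) ^+ 2 *+ 2 - 1.
  by rewrite -cos_mulr2n mulr2n -splitr.
have h1 : 1 / 2 <= cos (t / 2) * cos s.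
  apply: (@le_trans _ _ (cos (t / 2) * cos (t / 2))); last by rewrite ler_wpM2l.
  by move: h0; rewrite hh -expr2 -mulr_natr; lra.
have -> : cos (t / 2) * (t / 2 * cos s) *+ 2 = t * (cos (t / 2) * cos s) by field.
by rewrite ler_wpM2l ?(ltW t0) // -[leLHS]mul1r.
Qed.

Lemma Re_cexp z : complex.Re (cexp z) = expR (complex.Re z) * cos (complex.Im z).
Proof. by []. Qed.
Lemma Im_cexp z : complex.Im (cexp z) = expR (complex.Re z) * sin (complex.Im z).
Proof. by []. Qed.

Lemma cexpD z w : cexp (z + w) = cexp z * cexp w.
Proof.
apply: rect_eq; rewrite ?cReM ?cImM !Re_cexp !Im_cexp cReD cImD expRD ?cosD ?sinD; ring.
Qed.

Lemma cexp0 : cexp (0 : R[i]) = 1.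
Proof. by apply: rect_eq; rewrite ?Re_cexp ?Im_cexp /= expR0 ?cos0 ?sin0 mul1r. Qed.

Lemma cexpMn z n : cexp (n%:R * z) = cexp z ^+ n.
Proof.
elim: n => [|n IH]; first by rewrite mul0r cexp0.
by rewrite exprS -IH -cexpD; congr cexp; rewrite -natr1; ring.
Qed.

Lemma cabs_cexp z : cabs (cexp z) = expR (complex.Re z).
Proof.
rewrite cabsE Re_cexp Im_cexp !exprMn -mulrDr cos2Dsin2 mulr1 sqrtr_sqr.
by rewrite ger0_norm ?expR_ge0.
Qed.

Lemma cexp_neq0 z : cexp z != 0.
Proof. by rewrite -cabs_eq0 cabs_cexp expR_eq0. Qed.

Lemma cexpN z : cexp (- z) = (cexp z)^-1.
Proof.
by apply: (mulfI (cexp_neq0 z)); rewrite -cexpD subrr cexp0 mulfV ?cexp_neq0.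
Qed.

(** Only e^y >= 1 + y is used, at y = x and y = -x; the upper bound follows from e^x (1 - x) <=
    1. *)
Lemma expR_le_quad x : `|x| <= 1 / 2 -> 0 <= expR x - 1 - x <= 2 * x ^+ 2.
Proof.
rewrite ler_norml => /andP[h1 h2]; have e1 := expR_ge1Dx x.
have e2 := expR_ge1Dx (- x); have e3 := expRxMexpNx_1 x; have := expR_gt0 x.
move: (expR x) (expR (- x)) e1 e2 e3 => a b e1 e2 e3 a0.
apply/andP; split; first lra.
have h : a * (1 - x) <= 1 by nra.
have h' : 0 <= x ^+ 2 by rewrite sqr_ge0.
have : (a - (1 + x + 2 * x ^+ 2)) * (1 - x) <= 0.
  have -> : (a - (1 + x + 2 * x ^+ 2)) * (1 - x) = a * (1 - x) - 1 - x ^+ 2 * (1 - 2 * x) by ring.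
  nra.
by rewrite pmulr_lle0; lra.
Qed.

Lemma cexp_small w : cabs w <= 1 / 2 -> cabs (cexp w - 1 - w) <= 8 * cabs w ^+ 2.
Proof.
move=> hw; rewrite cabs_sqr.
have hx := le_trans (Re_le_cabs w) hw; have hy := le_trans (Im_le_cabs w) hw.
have -> : cexp w - 1 - w = Complex (expR (complex.Re w) * cos (complex.Im w) - 1 - complex.Re w)
   (expR (complex.Re w) * sin (complex.Im w) - complex.Im w).
  by case: w {hw hx hy} => a b; apply: rect_eq; rewrite /cexp /=; ring.
apply: le_trans (cabs_rect _ _) _.
set x := complex.Re w in hx *; set y := complex.Im w in hy *.
have /andP[ex1 ex2] := expR_le_quad hx.
have cy := cos_ge y; have cy1 := cos_le1 y; have sy := norm_sin_le y.
have sy2 : `|sin y - y| <= y ^+ 2.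
  wlog y0 : y hy {cy cy1 sy} / 0 <= y => [H|].
    have [|y0] := leP 0 y; first exact: H.
    have := H (- y); rewrite normrN hy oppr_ge0 (ltW y0) sinN sqrrN -opprD normrN.
    exact.
  move: y0; rewrite le_eqVlt => /predU1P[<-|y0].
    by rewrite sin0 subr0 normr0 sqr_ge0.
  have [s /andP[s0 st] ->] := sin_mvt y0.
  have := cos_ge s; have := cos_le1 s; move: (cos s) => c c1 c2.
  move: hy; rewrite (gtr0_norm y0) => hy.
  rewrite ler_norml; apply/andP; split; nra.
move: hx hy sy sy2; rewrite !ler_norml.
move: (expR x) (sin y) (cos y) ex1 ex2 cy cy1 => e s c ex1 ex2 cy cy1.
move=> /andP[x1 x2] /andP[y1 y2] sy0 /andP[s1 s2].
have sy : `|s| <= `|y| by rewrite ler_norml.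
have h1 : `|e * c - 1 - x| <= 2 * x ^+ 2 + 2 * y ^+ 2.
  have x0 := sqr_ge0 x; have y0 := sqr_ge0 y.
  have -> : e * c - 1 - x = (e - 1 - x) * c + (1 + x) * (c - 1) by ring.
  have c1 : `|c| <= 1 by rewrite ler_norml; apply/andP; split; nra.
  apply: le_trans (ler_normD _ _) _; rewrite !normrM lerD //.
    by rewrite -[leRHS]mulr1 ler_pM // ger0_norm.
  apply: (@le_trans _ _ ((3 / 2) * (y ^+ 2 / 2))); last lra.
  by rewrite ler_pM // ler_norml; apply/andP; split; lra.
have h2 : `|e * s - y| <= 6 * x ^+ 2 + 6 * y ^+ 2.
    have e1 : `|e - 1| <= 2 * `|x|.
    have x0 := sqr_ge0 x; have := ler_norm x; have := ler_norm (- x); rewrite normrN => n1 n2.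
    have n3 : x ^+ 2 = `|x| ^+ 2 by rewrite real_normK ?num_real.
    have n4 : `|x| <= 1 / 2 by rewrite ler_norml x1.
    by rewrite ler_norml; apply/andP; split; nra.
  have -> : e * s - y = (e - 1) * s + (s - y) by ring.
  apply: le_trans (ler_normD _ _) _; rewrite normrM.
  have s3 : `|s - y| <= y ^+ 2 by rewrite ler_norml s1.
  have : `|e - 1| * `|s| <= (2 * `|x|) * `|y| by rewrite ler_pM.
  have : 0 <= (`|x| - `|y|) ^+ 2 by rewrite sqr_ge0.
  have -> : (`|x| - `|y|) ^+ 2 = `|x| ^+ 2 + `|y| ^+ 2 - 2 * `|x| * `|y| by ring.
  rewrite !real_normK ?num_real //.
  have x0 := sqr_ge0 x; have y0 := sqr_ge0 y; lra.
lra.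
Qed.

(** The factor [expR (cabs w)] extends the quadratic remainder to all [w]. In termwise
    differentiation of a q-series the argument grows with the index, so a bound for small [w] is not
    enough. *)
Lemma cexp_quad w : cabs (cexp w - 1 - w) <= 8 * cabs w ^+ 2 * expR (cabs w).
Proof.
have [h|h] := leP (cabs w) (1 / 2).
  apply: le_trans (cexp_small h) _; rewrite ler_peMr ?mulr_ge0 ?sqr_ge0 ?cabs_ge0 //.
  by have := expR_ge1Dx (cabs w); have := cabs_ge0 w; lra.
apply: (@le_trans _ _ (2 * expR (cabs w))); last first.
  by rewrite ler_wpM2r ?expR_ge0 //; nra.
have := expR_ge1Dx (cabs w).
have : cabs (cexp w) <= expR (cabs w).
  by rewrite cabs_cexp ler_expR (le_trans (ler_norm _)) ?Re_le_cabs.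
have := cabsD (cexp w - 1) (- w); have := cabsD (cexp w) (- 1).
rewrite !cabsN cabs1; lra.
Qed.

Lemma cos_half t : cos t = 1 - 2 * sin (t / 2) ^+ 2.
Proof.
have {1}-> : t = (t / 2) *+ 2 by rewrite mulr2n -splitr.
rewrite cos_mulr2n cos2sin2; ring.
Qed.

Lemma cabs_cexp_sub1 z : cabs (1 - cexp z) ^+ 2 =
  (1 - expR (complex.Re z)) ^+ 2 + 4 * expR (complex.Re z) * sin (complex.Im z / 2) ^+ 2.
Proof.
rewrite cabs_sqr.
have -> : complex.Re (1 - cexp z) = 1 - expR (complex.Re z) * cos (complex.Im z) by [].
have -> : complex.Im (1 - cexp z) = - (expR (complex.Re z) * sin (complex.Im z)).
  by rewrite /= sub0r.
have -> : cos (complex.Im z) = 1 - 2 * sin (complex.Im z / 2) ^+ 2.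
  exact: cos_half.
have h : sin (complex.Im z) ^+ 2 = 1 - cos (complex.Im z) ^+ 2 by rewrite sin2cos2.
rewrite sqrrN exprMn h.
have -> : cos (complex.Im z) = 1 - 2 * sin (complex.Im z / 2) ^+ 2.
  exact: cos_half.
ring.
Qed.

(** On this rectangle 1 - e^w vanishes only at w = 0, and to first order. The linear lower bound
    supplies the dominating family in the proof of Lipschitz's formula. *)
Lemma cexp_sub1_ge (A : R) : 0 <= A -> forall w,
  - A <= complex.Re w <= 0 -> `|complex.Im w| <= pi ->
  expR (- A) / 4 * cabs w <= cabs (1 - cexp w).
Proof.
move=> A0 w /andP[h1 h2] h3.
have e0 := expR_gt0 (- A).
rewrite -ler_sqr ?nnegrE ?mulr_ge0 ?cabs_ge0 ?divr_ge0 ?(ltW e0) //.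
rewrite cabs_cexp_sub1 exprMn cabs_sqr.
have hs : (complex.Im w / 4) ^+ 2 <= sin (complex.Im w / 2) ^+ 2.
  rewrite -[leRHS]real_normK ?num_real // -[leLHS]real_normK ?num_real //.
  rewrite ler_sqr ?nnegrE ?normr_ge0 //.
  have -> : `|sin (complex.Im w / 2)| = `|sin (`|complex.Im w| / 2)|.
    have [y0|y0] := leP 0 (complex.Im w); first by rewrite (ger0_norm y0).
    by rewrite (ltr0_norm y0) mulNr sinN normrN.
  rewrite normrM (ger0_norm (_ : 0 <= 4^-1)) //.
  apply: le_trans (ler_norm _); have := normr_ge0 (complex.Im w).
  move: (`|_|) h3 => y h3 y0.
  have -> : y / 4 = (y / 2) / 2 by field.
  by apply: sin_ge_half; apply/andP; split; lra.
set x := complex.Re w in h1 h2 *; set y := complex.Im w in hs *.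
have ex1 : expR (- A) <= expR x by rewrite ler_expR.
have eA1 : expR (- A) <= 1 by rewrite -expR0 ler_expR; lra.
have hx : expR (- A) * - x <= 1 - expR x.
  have := expR_ge1Dx (- x); have := expRxMexpNx_1 x.
  move: (expR x) (expR (- x)) (expR_gt0 x) ex1 => a b a0 ex1 ab hb.
  suff : - x * a <= 1 - a by nra.
  nra.
have hx2 : (expR (- A) * - x) ^+ 2 <= (1 - expR x) ^+ 2.
  by rewrite ler_sqr ?nnegrE //; nra.
move: (expR (- A)) (expR x) (sin (y / 2)) e0 ex1 eA1 hx hx2 hs => a b s e0 ex1 eA1 hx hx2 hs.
have y2 := sqr_ge0 y.
have -> : (a / 4) ^+ 2 * (x ^+ 2 + y ^+ 2) = (a * - x) ^+ 2 / 16 + a * a * (y / 4) ^+ 2 by field.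
apply: lerD.
  by have := sqr_ge0 (a * - x); lra.
have s2 := sqr_ge0 s; have y4 := sqr_ge0 (y / 4).
apply: (@le_trans _ _ (1 * b * (y / 4) ^+ 2)).
  by rewrite ler_wpM2r // ler_pM // ltW.
rewrite ler_pM // ?mul1r ?(le_trans (ltW e0)) //; nra.
Qed.

End ComplexExponential.

(** * The parameter q = e^(2 pi i z) *)

Section QParameter.
Variable R : realType.
Implicit Types (z w : R[i]).

Lemma cabs_qparam z : cabs (qparam z) = expR (- (2 * pi * complex.Im z)).
Proof. by rewrite cabs_cexp cReM /= mul0r sub0r. Qed.

Lemma cabs_qparam_lt1 z : upper_half_plane z -> cabs (qparam z) < 1.
Proof.
move=> hz; rewrite cabs_qparam -expR0 ltr_expR oppr_lt0.
by rewrite !mulr_gt0 // pi_gt0.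
Qed.

Lemma qparam_neq0 z : qparam z != 0. Proof. exact: cexp_neq0. Qed.

Lemma qparamD z w : qparam (z + w) = qparam z * qparam w.
Proof. by rewrite /qparam mulrDr cexpD. Qed.

Lemma qparamMn z n : qparam (n%:R * z) = qparam z ^+ n.
Proof. by rewrite /qparam mulrCA cexpMn. Qed.

Lemma qparam1 : qparam (1 : R[i]) = 1.
Proof.
rewrite /qparam mulr1 /cexp /= expR0 !mul1r mulrC mulr_natr.
by rewrite cos2pi sin2pi.
Qed.

Lemma qparamN z : qparam (- z) = (qparam z)^-1.
Proof. by rewrite /qparam mulrN cexpN. Qed.

Lemma qparam_nat n : qparam (n%:R : R[i]) = 1.
Proof. by rewrite -[n%:R]mulr1 qparamMn qparam1 expr1n. Qed.

Lemma qparam_int (n : int) : qparam (n%:~R : R[i]) = 1.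
Proof.
case: n => n; first by rewrite -pmulrn qparam_nat.
by rewrite NegzE rmorphN /= qparamN -pmulrn qparam_nat invr1.
Qed.

Lemma qparamDint z (n : int) : qparam (z + n%:~R) = qparam z.
Proof. by rewrite qparamD qparam_int mulr1. Qed.

End QParameter.

(** * The series of r^p w^r and its closed form *)

Section PowerSums.
Variable R : realType.

(** By Pascal's rule, multiplication by 1 - x lowers the order of the binomial coefficient by one;
    the extra term is the effect of truncation. *)
Lemma binomial_series_identity (K : comNzRingType) (x : K) m N :
  (1 - x) * (\sum_(0 <= r < N) 'C(r + m.+1, m.+1)%:R * x ^+ r)
    + 'C(N + m, m.+1)%:R * x ^+ N = \sum_(0 <= r < N) 'C(r + m, m)%:R * x ^+ r.
Proof.
elim: N => [|N IH].
  by rewrite !big_nil mulr0 add0r add0n bin_small // mul0r.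
rewrite !big_nat_recr //= -IH addSn addnS binS natrD exprS.
ring.
Qed.

Lemma geometric_bound (x : R) N : 0 <= x -> x < 1 ->
  \sum_(0 <= r < N) x ^+ r <= (1 - x)^-1.
Proof.
move=> x0 x1; have h : 0 < 1 - x by lra.
rewrite -[leRHS]mul1r ler_pdivlMr // big_mkord mulrC.
have := subrX1 x N; have := exprn_ge0 N x0.
by move=> h1 h2; move: h2; rewrite -opprB -[x - 1]opprB mulNr => /oppr_inj <-; lra.
Qed.

Lemma binomial_series_bound (x : R) m N : 0 <= x -> x < 1 ->
  \sum_(0 <= r < N) 'C(r + m, m)%:R * x ^+ r <= (1 - x)^-1 ^+ m.+1.
Proof.
move=> x0 x1; have h : 0 < 1 - x by lra.
elim: m => [|m IH].
  rewrite expr1; apply: le_trans (geometric_bound N x0 x1).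
  by apply: ler_sum => r _; rewrite addn0 bin0 mul1r.
rewrite exprS ler_pdivlMl //; apply: le_trans IH.
by rewrite -[leRHS]binomial_series_identity lerDl mulr_ge0 ?exprn_ge0.
Qed.

Lemma hsum_binomial (w : R[i]) m : cabs w < 1 ->
  hsum (fun r => 'C(r + m, m)%:R * w ^+ r) ((1 - w)^-1 ^+ m.+1).
Proof.
move=> w1; have w0 := cabs_ge0 w.
have w1' : 1 - w != 0.
  by rewrite subr_eq0; apply: contraTneq w1 => <-; rewrite cabs1 ltxx.
have ex k : exists s, hsum (fun r => 'C(r + k, k)%:R * w ^+ r) s.
  apply: (@asum_hsum _ _ _ ((1 - cabs w)^-1 ^+ k.+1)); apply: asum_nat => N.
  by under eq_bigr do rewrite cabsM cabs_nat cabsX; exact: binomial_series_bound.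
have shift k s : hsum (fun r => 'C(r + k, k)%:R * w ^+ r) s ->
    hsum (fun r => if r is r'.+1 then 'C(r' + k, k)%:R * w ^+ r'.+1 else 0) (w * s).
  move=> Hs; apply: (@hsum_inj _ _ _ S) => [? ? []//|[|r] // /(_ r)/eqP//|].
  by apply: eq_hsum (hsumZ w Hs) => r; rewrite exprS mulrCA.
elim: m => [|m IH].
  have [s Hs] := ex 0%N; suff -> : (1 - w)^-1 ^+ 1 = s by [].
  have h := hsumB Hs (shift _ _ Hs).
  have h' : hsum (fun r => if r is 0%N then 1 else 0 : R[i]) 1.
    have := @hsum_fin R _ (fun r => if r is 0%N then 1 else 0 : R[i]) [fset 0%N]%fset.
    rewrite big_seq_fset1; apply => -[|//]; by rewrite inE.
  have /(hsum_unique h') E : hsum (fun r => if r is 0%N then 1 else 0 : R[i]) (s - w * s).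
    by apply: eq_hsum h => -[|r]; rewrite ?addn0 ?bin0 ?expr0 ?mul1r ?subr0 ?subrr.
  by rewrite expr1; apply: (mulfI w1'); rewrite mulfV // mulrBl mul1r.
have [s Hs] := ex m.+1.
have h := hsumB Hs (shift _ _ Hs).
have /(hsum_unique IH) E : hsum (fun r => 'C(r + m, m)%:R * w ^+ r) (s - w * s).
  apply: eq_hsum h => -[|r]; first by rewrite add0n !binn subr0.
  by rewrite !addSn !addnS binS natrD mulrDl addrAC subrr add0r.
suff <- : s = (1 - w)^-1 ^+ m.+2 by [].
by rewrite exprS E; apply: (mulfI w1'); rewrite mulrA mulfV // mul1r mulrBl mul1r.
Qed.

(** Induction by r C(r+m,m) = (m+1) C(r+m+1,m+1) - (m+1) C(r+m,m). The top coefficient is singled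
    out because it belongs to the pole of highest order, the only one that survives in the Lipschitz
    limit. *)
Lemma pow_binomial p : exists c : nat -> R, c p = p`!%:R /\
  forall r : nat, r%:R ^+ p = \sum_(m < p.+1) c m * 'C(r + m, m)%:R.
Proof.
elim: p => [|p [c [cp Hc]]].
  by exists (fun=> 1); split => // r; rewrite expr0 big_ord1 addn0 bin0 mul1r.
exists (fun m => (if m is m'.+1 then m%:R * c m' else 0) - (if (m <= p)%N then m.+1%:R * c m else 0)).
rewrite ltnn subr0 cp factS natrM; split => // r.
rewrite exprS Hc mulr_sumr.
under [RHS]eq_bigr do rewrite mulrBl.
rewrite [RHS]sumrB [X in X - _]big_ord_recl /= mul0r add0r.
rewrite [X in _ - X]big_ord_recr /= ltnn mul0r addr0 -sumrB.
apply: eq_bigr => m _; rewrite /bump /= add1n -ltnS ltn_ord.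
have E : m.+1%:R * 'C(r + m.+1, m.+1)%:R = (r + m.+1)%:R * 'C(r + m, m)%:R :> R.
  by rewrite -!natrM addnS -mul_bin_diag.
rewrite add0n mulrAC E natrD; ring.
Qed.

Lemma hsum_pow p : exists2 c : nat -> R, c p = p`!%:R &
  forall w : R[i], cabs w < 1 -> hsum (fun r => r%:R ^+ p * w ^+ r)
    (\sum_(m < p.+1) (c m)%:C * (1 - w)^-1 ^+ m.+1).
Proof.
have [c [cp Hc]] := pow_binomial p; exists c => // w w1.
have := hsum_sum (index_enum 'I_p.+1) (fun m : 'I_p.+1 => hsumZ (c m)%:C (hsum_binomial m w1)).
apply: eq_hsum => r.
rewrite -(rmorph_nat (real_complex R)) -rmorphXn /= Hc rmorph_sum /= mulr_suml.
by apply: eq_bigr => m _; rewrite rmorphM /= rmorph_nat mulrA.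
Qed.

(** r^p is at most the falling factorial (r+p)...(r+1) = p! C(r+p,p), which reduces the sum to a
    binomial series. *)
Lemma pow_sum_bound p (x : R) : 0 <= x -> x < 1 ->
  exists M, forall N, \sum_(0 <= r < N) r%:R ^+ p * x ^+ r <= M.
Proof.
move=> x0 x1; exists (p`!%:R * (1 - x)^-1 ^+ p.+1) => N.
apply: le_trans (ler_wpM2l _ (binomial_series_bound p N x0 x1)); last exact: ler0n.
rewrite mulr_sumr; apply: ler_sum => r _; rewrite mulrA ler_wpM2r ?exprn_ge0 //.
rewrite -natrX -natrM ler_nat mulnC bin_ffact.
elim: p => [|p IH]; first by rewrite expn0 ffactn0.
by rewrite expnS addnS ffactSS leq_mul // leqW // leq_addr.
Qed.

End PowerSums.

(** * Lipschitz summation *)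

Section ComplexLimits.
Variable R : realType.

Lemma cvgC_eps (u : nat -> R[i]) (l : R[i]) :
  (forall e : R, 0 < e -> exists N0, forall N, (N0 <= N)%N -> cabs (u N - l) <= e) ->
  ((u N : R[i]^o) @[N --> \oo] --> (l : R[i]^o))%classic.
Proof.
move=> H; apply/cvgrPdist_le => e e0.
have e0' : 0 < complex.Re e by move: e0; rewrite ltcE => /andP[].
have -> : e = (complex.Re e)%:C by rewrite RRe_real // gtr0_real.
have [N0 HN] := H _ e0'.
near=> N; rewrite normE lecR cabsB; apply: HN; near: N.
exact: nbhs_infty_ge.
Unshelve. all: by end_near. Qed.

Lemma cvgC_epsP (u : nat -> R[i]) (l : R[i]) :
  ((u N : R[i]^o) @[N --> \oo] --> (l : R[i]^o))%classic ->
  (forall e : R, 0 < e -> exists N0, forall N, (N0 <= N)%N -> cabs (u N - l) <= e).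
Proof.
move=> /cvgrPdist_le H e e0; have := H e%:C; rewrite ltcR => /(_ e0) [N0 _ HN].
exists N0 => N hN; have := HN N hN.
by rewrite /= normE lecR cabsB.
Qed.

Lemma cvgC_sum (J : Type) (r : seq J) (f : J -> nat -> R[i]^o) (l : J -> R[i]^o) :
  (forall j, (f j N @[N --> \oo] --> l j)%classic) ->
  (\sum_(j <- r) f j N @[N --> \oo] --> \sum_(j <- r) l j)%classic.
Proof.
move=> H; elim: r => [|j r IH].
  by rewrite big_nil; under eq_cvg do rewrite big_nil; exact: cvg_cst.
rewrite big_cons.
have -> : (fun N => \sum_(j0 <- j :: r) f j0 N) = f j \+ (fun N => \sum_(j0 <- r) f j0 N).
  by apply/funext => N; rewrite big_cons.
exact: (cvgD (H j) IH).
Qed.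

Lemma cvgC_X (u : nat -> R[i]^o) (l : R[i]^o) n :
  (u N @[N --> \oo] --> l)%classic -> (((u N : R[i]) ^+ n : R[i]^o) @[N --> \oo] --> ((l : R[i]) ^+ n : R[i]^o))%classic.
Proof.
move=> ul; elim: n => [|n IH].
  by rewrite expr0; under eq_cvg do rewrite expr0; exact: cvg_cst.
have -> : (fun N => (u N : R[i]) ^+ n.+1) = u \* (fun N => (u N : R[i]) ^+ n).
  by apply/funext => N; rewrite exprS.
rewrite exprS; exact: (cvgM ul IH).
Qed.

End ComplexLimits.

Section Lipschitz.
Variable R : realType.
Implicit Types (z w : R[i]).

Lemma asum_int (f : int -> R[i]) (M M' : R) :
  (forall N, \sum_(0 <= k < N) cabs (f (Posz k)) <= M) ->
  (forall N, \sum_(0 <= k < N) cabs (f (Negz k)) <= M') -> asum f (M + M').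
Proof.
move=> h1 h2 A; rewrite (big_fsetID _ (fun n : int => 0 <= n)) /=; apply: lerD.
  have inj : {in [fset x in A | 0 <= x]%fset &, injective (fun n : int => `|n|%N)}.
    by move=> x y; rewrite !inE /= => /andP[_ x0] /andP[_ y0] h; lia.
  have := asum_nat h1 [fset `|n|%N | n in [fset x in A | (0 : int) <= x]]%fset.
  rewrite big_imfset //; apply: le_trans; rewrite le_eqVlt; apply/orP; left; apply/eqP.
  apply: eq_big_seq => x; rewrite !inE /= => /andP[_ x0]; congr (cabs (f _)); lia.
have inj : {in [fset x in A | ~~ (0 <= x)]%fset &, injective (fun n : int => `|n|.-1%N)}.
  by move=> x y; rewrite !inE /= => /andP[_ x0] /andP[_ y0] h; lia.
have := asum_nat h2 [fset `|n|.-1%N | n in [fset x in A | ~~ ((0 : int) <= x)]]%fset.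
rewrite big_imfset //; apply: le_trans; rewrite le_eqVlt; apply/orP; left; apply/eqP.
apply: eq_big_seq => x; rewrite !inE /= => /andP[_ x0]; congr (cabs (f _)); lia.
Qed.

Lemma inv_sqr_sum_bound N : \sum_(0 <= k < N) (1 + k%:R ^+ 2)^-1 <= (4 : R).
Proof.
(* Telescoping: 1/(1+N^2) <= 4/(N+1) - 4/(N+2). *)
suff : \sum_(0 <= k < N) (1 + k%:R ^+ 2)^-1 <= (4 - 4 / N.+1%:R : R).
  by move=> h; apply: le_trans h _; rewrite gerBl divr_ge0.
elim: N => [|N IH]; first by rewrite big_nil divr1 subrr.
rewrite big_nat_recr //=; apply: le_trans (lerD IH (lexx _)) _.
have n0 : 0 <= (N%:R : R) by [].
rewrite -[N.+2]addn2 -[N.+1]addn1 !natrD; move: (N%:R) n0 => x x0.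
rewrite -subr_ge0.
have -> : 4 - 4 / (x + 2) - (4 - 4 / (x + 1) + (1 + x ^+ 2)^-1) =
   (3 * x ^+ 2 - 3 * x + 2) / ((x + 1) * (x + 2) * (1 + x ^+ 2)).
  by field; rewrite !lt0r_neq0 //; nra.
by apply: divr_ge0; [nra|rewrite !mulr_ge0 //; nra].
Qed.

Definition inv1sqr (n : int) : R[i] := ((1 + n%:~R ^+ 2)^-1 : R)%:C.

Lemma asum_inv1sqr : asum inv1sqr 8.
Proof.
have -> : 8 = 4 + 4 :> R by ring.
have cE n : cabs (inv1sqr n) = (1 + n%:~R ^+ 2)^-1.
  by rewrite cabsC ger0_norm // invr_ge0 addr_ge0 ?sqr_ge0.
apply: asum_int => N; under eq_bigr do rewrite cE.
  exact: inv_sqr_sum_bound.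
apply: le_trans (inv_sqr_sum_bound N); apply: ler_sum => k _.
rewrite lef_pV2 ?posrE ?ltr_wpDr ?sqr_ge0 // lerD2l NegzE rmorphN sqrrN /=.
by rewrite -pmulrn ler_sqr ?nnegrE // ler_nat.
Qed.

(** A constant comparing the forms c^2 + d^2 and |cz+d|^2. It stays bounded where |Re z| <= 1 and Im
    z >= 1/D, the region on which the test forms are estimated. *)
Definition kappa z : R := 2 + (1 + 2 * complex.Re z ^+ 2) / complex.Im z ^+ 2.

Lemma lattice_norm_ge z (c d : R) : upper_half_plane z ->
  c ^+ 2 + d ^+ 2 <= kappa z * cabs (c%:C * z + d%:C) ^+ 2.
Proof.
rewrite /upper_half_plane /= => y0; rewrite cabs_sqr.
have -> : complex.Re (c%:C * z + d%:C) = c * complex.Re z + d.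
  by rewrite cReD cReM /= mul0r subr0.
have -> : complex.Im (c%:C * z + d%:C) = c * complex.Im z.
  by rewrite cImD cImM /= mul0r !addr0.
rewrite /kappa; move: (complex.Re z) (complex.Im z) y0 => x y y0.
have y2 : 0 < y ^+ 2 by rewrite exprn_gt0.
have -> : (2 + (1 + 2 * x ^+ 2) / y ^+ 2) * ((c * x + d) ^+ 2 + (c * y) ^+ 2) =
  2 * (c * x + d) ^+ 2 + (1 + 2 * x ^+ 2) * c ^+ 2 +
  (2 * (c * y) ^+ 2 + (1 + 2 * x ^+ 2) / y ^+ 2 * (c * x + d) ^+ 2).
  by field; rewrite lt0r_neq0.
have h : 0 <= 2 * (c * y) ^+ 2 + (1 + 2 * x ^+ 2) / y ^+ 2 * (c * x + d) ^+ 2.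
  apply: addr_ge0; first by rewrite mulr_ge0 ?sqr_ge0.
  apply: mulr_ge0; last exact: sqr_ge0.
  by apply: divr_ge0; [have := sqr_ge0 x; lra|exact: sqr_ge0].
(* The first two terms exceed c^2 + d^2 by exactly (2cx + d)^2. *)
apply: ler_wpDr h _; have := sqr_ge0 (2 * c * x + d); nra.
Qed.

Lemma kappa_gt0 z : upper_half_plane z -> 0 < kappa z.
Proof.
move=> y0; rewrite ltr_wpDr // divr_ge0 ?sqr_ge0 //.
by have := sqr_ge0 (complex.Re z); lra.
Qed.

Lemma uhp_int z (n : int) : upper_half_plane z -> upper_half_plane (z + n%:~R).
Proof. by rewrite /upper_half_plane /= cImD Im_int addr0. Qed.

Lemma uhp_neq0 z : upper_half_plane z -> z != 0.
Proof. by apply: contraTneq => ->; rewrite /upper_half_plane /= ltxx. Qed.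

Lemma asum_shift_pow z p : (0 < p)%N -> upper_half_plane z ->
  exists M, asum (fun n : int => (z + n%:~R)^-1 ^+ p.+1) M.
Proof.
move=> p0 hz; have y0 : 0 < complex.Im z by [].
have k0 := kappa_gt0 hz.
exists (cabs (((complex.Im z)^-1 ^+ p.-1 * kappa z)%:C : R[i]) * 8).
apply: le_asum (asumZ _ asum_inv1sqr) => n.
rewrite cabsM !cabsC ger0_norm ?mulr_ge0 ?exprn_ge0 ?invr_ge0 ?(ltW k0) ?(ltW y0) //.
rewrite ger0_norm ?invr_ge0 ?addr_ge0 ?sqr_ge0 //.
have -> : p.+1 = (p.-1 + 2)%N by rewrite addn2 prednK.
rewrite exprD cabsM !cabsX -mulrA; apply: ler_pM; rewrite ?exprn_ge0 ?cabs_ge0 //.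
  rewrite lerXn2r ?nnegrE ?cabs_ge0 ?invr_ge0 ?(ltW y0) // cabsV lef_pV2 ?posrE //.
    have := Im_le_cabs (z + n%:~R); rewrite cImD Im_int addr0 gtr0_norm //.
  by rewrite cabs_gt0; apply/uhp_neq0/uhp_int.
have h := lattice_norm_ge 1 n%:~R hz.
rewrite cabsV exprVn ler_pdivlMr ?ltr_wpDr ?sqr_ge0 // ler_pdivrMl; last first.
  by rewrite exprn_gt0 // cabs_gt0; apply/uhp_neq0/uhp_int.
by move: h; rewrite expr1n rmorph1 mul1r rmorph_int mulrC.
Qed.

Lemma root_of_unity_sum N r : (0 < N)%N ->
  \sum_(j < N) (qparam (N%:R^-1 : R[i]) ^+ r) ^+ j = if (N %| r)%N then N%:R else 0.
Proof.
move=> N0; have Nn : N%:R != 0 :> R[i] by rewrite pnatr_eq0 -lt0n.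
set o := qparam _; have oN : o ^+ N = 1 by rewrite -qparamMn divff // qparam1.
case: ifPn => [/dvdnP[k ->]|nd].
  by under eq_bigr do rewrite mulnC exprM oN !expr1n; rewrite sumr_const card_ord.
have orN : (o ^+ r) ^+ N = 1 by rewrite exprAC oN expr1n.
have : (o ^+ r - 1) * (\sum_(j < N) (o ^+ r) ^+ j) = 0 by rewrite -subrX1 orN subrr.
move/eqP; rewrite mulf_eq0 => /orP[|/eqP //]; rewrite subr_eq0 => /eqP or1.
exfalso; have : o ^+ (r %% N) = 1.
  by move: or1; rewrite {1}(divn_eq r N) exprD mulnC exprM oN expr1n mul1r.
have rm0 : (0 < r %% N)%N by rewrite lt0n.
have rmN : (r %% N < N)%N by rewrite ltn_mod.
move: (r %% N)%N rm0 rmN => m m0 mN; rewrite -qparamMn => E.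
(* If the root of unity had m-th power 1 with 0 < m < N, then 4 sin(pi m/N)^2 = 0 while pi m/N lies
   strictly between 0 and pi. *)
have := cabs_cexp_sub1 (Complex 0 (2 * pi) * (m%:R * N%:R^-1 : R[i])).
rewrite -/(qparam _) E subrr cabs0.
have -> : m%:R * N%:R^-1 = ((m%:R / N%:R : R))%:C :> R[i].
  by rewrite rmorphM /= fmorphV /= !rmorph_nat.
rewrite cReM cImM /= mul0r mulr0 subrr expR0 subrr mul0r add0r mulr1 expr0n /= add0r.
have -> : 2 * pi * (m%:R / N%:R) / 2 = pi * (m%:R / N%:R) :> R by field; rewrite pnatr_eq0 -lt0n.
move/esym/eqP; rewrite mulf_eq0 pnatr_eq0 /= sqrf_eq0 gt_eqF //.
have N0' : 0 < (N%:R : R) by rewrite ltr0n.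
apply: sin_gt0_pi; rewrite mulr_gt0 ?pi_gt0 ?divr_gt0 ?ltr0n //=.
by rewrite gtr_pMr ?pi_gt0 // ltr_pdivrMr // mul1r ltr_nat.
Qed.

Section ClosedForm.
Variables (p : nat) (c : nat -> R).
Hypothesis p_gt0 : (0 < p)%N.
Hypothesis cp : c p = p`!%:R.
Let F w : R[i] := \sum_(m < p.+1) (c m)%:C * (1 - w)^-1 ^+ m.+1.
Hypothesis HF : forall w, cabs w < 1 -> hsum (fun r => r%:R ^+ p * w ^+ r) (F w).

(** A finite form of Lipschitz's formula. Summation over the N-th roots of q keeps the exponents
    divisible by N and rescales r^p by N^p. Since N = 2M+1, the shifts j-M are symmetric and exhaust
    the integers as M grows. *)
Lemma multisection z M : upper_half_plane z -> let N := M.*2.+1 in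
  \sum_(j < N) F (qparam ((z + (j%:R - M%:R)) / N%:R)) = N%:R ^+ p.+1 * F (qparam z).
Proof.
move=> hz N; have N0 : (0 < N)%N by [].
have Nn : N%:R != 0 :> R[i] by rewrite pnatr_eq0.
have lt1 (j : 'I_N) : cabs (qparam ((z + (j%:R - M%:R)) / N%:R)) < 1.
  apply: cabs_qparam_lt1; rewrite /upper_half_plane /=.
  have -> : N%:R^-1 = ((N%:R : R)^-1)%:C :> R[i] by rewrite fmorphV /= rmorph_nat.
  rewrite cImM /= mulr0 add0r cImD cImD; have -> : complex.Im (- M%:R : R[i]) = 0.
    by rewrite -(rmorph_nat (real_complex R)) -rmorphN.
  by rewrite Im_nat !addr0 mulr_gt0 // invr_gt0 ltr0n.
have h1 := hsum_sum (index_enum 'I_N) (fun j => HF (lt1 j)).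
apply: (hsum_unique h1).
have h2 := hsumZ (N%:R ^+ p.+1) (HF (cabs_qparam_lt1 hz)).
have inj : injective (muln N) by move=> a b /eqP; rewrite eqn_pmul2l // => /eqP.
have term r : \sum_(j < N) r%:R ^+ p * qparam ((z + (j%:R - M%:R)) / N%:R) ^+ r =
   if (N %| r)%N then N%:R ^+ p.+1 * ((r %/ N)%:R ^+ p * qparam z ^+ (r %/ N)) else 0.
  rewrite -mulr_sumr.
  have -> : \sum_(j < N) qparam ((z + (j%:R - M%:R)) / N%:R) ^+ r =
     qparam ((z - M%:R) / N%:R) ^+ r * \sum_(j < N) (qparam (N%:R^-1 : R[i]) ^+ r) ^+ j.
    rewrite mulr_sumr; apply: eq_bigr => j _.
    rewrite [(qparam _ ^+ r) ^+ j]exprAC -exprMn -(qparamMn N%:R^-1 j) -qparamD; congr (qparam _ ^+ _).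
    by rewrite -mulrDl; congr (_ / _); ring.
  rewrite root_of_unity_sum //; case: ifPn => [/dvdnP[k ->]|_]; last by rewrite !mulr0.
  have -> : qparam ((z - M%:R) / N%:R) ^+ (k * N) = qparam z ^+ k.
    rewrite mulnC exprM -(qparamMn _ N) mulrCA divff // mulr1.
    by rewrite qparamD qparamN qparam_nat invr1 mulr1.
  rewrite mulnK // natrM exprMn exprS; ring.
apply: (@hsum_inj _ _ _ (muln N)) => // [r hr|].
  rewrite term; case: ifPn => // /dvdnP[k rk]; by have := hr k; rewrite rk mulnC eqxx.
apply: eq_hsum h2 => r; rewrite term dvdn_mulr //.
by rewrite mulKn.
Qed.


(** Because |1 - w| <= 2, the poles of lower order are absorbed by the one of order p+1. *)
Lemma closed_form_bound w : cabs w < 1 -> w != 1 ->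
  cabs (F w) <= (\sum_(m < p.+1) `|c m| * 2 ^+ (p - m)) * (cabs (1 - w))^-1 ^+ p.+1.
Proof.
move=> w1 wn1; have d0 : 0 < cabs (1 - w) by rewrite cabs_gt0 subr_eq0 eq_sym.
have d2 : cabs (1 - w) <= 2.
  by have := cabsD 1 (- w); rewrite cabs1 cabsN; lra.
rewrite mulr_suml; apply: le_trans (cabs_sum _ _ _) _; apply: ler_sum => m _.
rewrite cabsM cabsC cabsX cabsV -mulrA ler_wpM2l ?normr_ge0 //.
have mp : (m <= p)%N by rewrite -ltnS.
have -> : (cabs (1 - w))^-1 ^+ p.+1 = (cabs (1 - w))^-1 ^+ (p - m) * (cabs (1 - w))^-1 ^+ m.+1.
  by rewrite -exprD addnS subnK.
rewrite mulrA ler_peMl ?exprn_ge0 ?invr_ge0 ?(ltW d0) //.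
rewrite -exprMn exprn_ege1 // ler_pdivlMr ?mul1r //.
Qed.

Let u z (n : int) : R[i] := - (Complex 0 (2 * pi) * (z + n%:~R)).

Lemma cabs_u z n : cabs (u z n) = 2 * pi * cabs (z + n%:~R).
Proof.
rewrite /u cabsN cabsM; congr (_ * _); rewrite cabsE /= expr0n add0r sqrtr_sqr.
by rewrite ger0_norm // mulr_ge0 // pi_ge0.
Qed.

Lemma u_neq0 z n : upper_half_plane z -> u z n != 0.
Proof.
move=> hz; rewrite -cabs_eq0 cabs_u !mulf_neq0 ?pnatr_eq0 ?gt_eqF ?pi_gt0 //.
by rewrite cabs_gt0; apply/uhp_neq0/uhp_int.
Qed.

Lemma qparam_u z n (N : R[i]) : qparam ((z + n%:~R) / N) = cexp (- (u z n / N)).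
Proof. by rewrite /qparam /u mulNr opprK mulrA. Qed.

Lemma natV_rc N : (N%:R)^-1 = ((N%:R : R)^-1)%:C :> R[i].
Proof. by rewrite fmorphV /= rmorph_nat. Qed.

Lemma dilation_cvg z n : upper_half_plane z ->
  (((M.*2.+1)%:R * (1 - qparam ((z + n%:~R) / (M.*2.+1)%:R)) : R[i]^o) @[M --> \oo]
    --> (u z n : R[i]^o))%classic.
Proof.
move=> hz; apply: cvgC_eps => e e0; set v := u z n.
pose K := 8 * cabs v ^+ 2 * expR (cabs v).
have K0 : 0 <= K by rewrite mulr_ge0 ?expR_ge0 // mulr_ge0 ?sqr_ge0.
exists (Num.bound (K / e)) => M hM.
have N0 : 0 < ((M.*2.+1)%:R : R) by rewrite ltr0n.
have Nn : (M.*2.+1)%:R != 0 :> R[i] by rewrite pnatr_eq0.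
rewrite qparam_u -/v.
have -> : (M.*2.+1)%:R * (1 - cexp (- (v / (M.*2.+1)%:R))) - v =
    - ((M.*2.+1)%:R * (cexp (- (v / (M.*2.+1)%:R)) - 1 - (- (v / (M.*2.+1)%:R)))).
  by move: (cexp _) => E; move: (_%:R) Nn => N Nn; field.
rewrite cabsN cabsM cabs_nat.
apply: le_trans (ler_wpM2l (ltW N0) (cexp_quad _)) _.
rewrite cabsN natV_rc cabsM cabsC ger0_norm ?invr_ge0 //.
apply: (@le_trans _ _ (K / (M.*2.+1)%:R)).
  rewrite exprMn.
  have -> : (M.*2.+1)%:R * (8 * (cabs v ^+ 2 * (M.*2.+1)%:R^-1 ^+ 2) * expR (cabs v / (M.*2.+1)%:R))
    = 8 * cabs v ^+ 2 * expR (cabs v / (M.*2.+1)%:R) / (M.*2.+1)%:R.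
    move: (expR _) => E; move: ((M.*2.+1)%:R : R) N0 => N N0; field; exact: lt0r_neq0.
  rewrite /K; apply: ler_wpM2r; first by rewrite invr_ge0 ltW.
  apply: ler_wpM2l; first by rewrite mulr_ge0 ?sqr_ge0.
  rewrite ler_expR.
  rewrite ler_pdivrMr // ler_peMr ?cabs_ge0 //.
  by rewrite ler1n.
rewrite ler_pdivrMr // mulrC -ler_pdivrMr //.
have h := archi_boundP (divr_ge0 K0 (ltW e0)).
apply: le_trans (ltW h) _; rewrite ler_nat.
by apply: leq_trans hM _; rewrite -addnn leqW // leq_addr.
Qed.

Lemma inv_dilation_cvg :
  ((((M.*2.+1)%:R)^-1 : R[i]^o) @[M --> \oo] --> (0 : R[i]^o))%classic.
Proof.
apply: cvgC_eps => e e0; exists (Num.bound (e^-1)) => M hM.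
rewrite subr0 cabsV cabs_nat -[leRHS]invrK lef_pV2 ?posrE ?invr_gt0 ?ltr0n //.
have := archi_boundP (_ : 0 <= e^-1); rewrite invr_ge0 => /(_ (ltW e0)) h.
apply: le_trans (ltW h) _; rewrite ler_nat.
by apply: leq_trans hM _; rewrite -addnn leqW // leq_addr.
Qed.

(** Since N (1 - q((z+n)/N)) has a nonzero limit, division by N^(p+1) kills every pole except that
    of order p+1, and only the coefficient p! remains. *)
Lemma closed_form_cvg z n : upper_half_plane z ->
  (((((M.*2.+1)%:R)^-1 ^+ p.+1 * F (qparam ((z + n%:~R) / (M.*2.+1)%:R))) : R[i]^o) @[M --> \oo]
    --> ((p`!%:R * (u z n)^-1 ^+ p.+1) : R[i]^o))%classic.
Proof.
move=> hz.
have E M : ((M.*2.+1)%:R)^-1 ^+ p.+1 * F (qparam ((z + n%:~R) / (M.*2.+1)%:R)) =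
  \sum_(m < p.+1) (c m)%:C * ((M.*2.+1)%:R)^-1 ^+ (p - m) *
     ((M.*2.+1)%:R * (1 - qparam ((z + n%:~R) / (M.*2.+1)%:R)))^-1 ^+ m.+1.
  rewrite mulr_sumr; apply: eq_bigr => m _.
  have mp : (m <= p)%N by rewrite -ltnS.
  have -> : ((M.*2.+1)%:R : R[i])^-1 ^+ p.+1 = ((M.*2.+1)%:R)^-1 ^+ (p - m) * ((M.*2.+1)%:R)^-1 ^+ m.+1.
    by rewrite -exprD addnS subnK.
  rewrite invfM exprMn; ring.
have -> : p`!%:R * (u z n)^-1 ^+ p.+1 =
   \sum_(m < p.+1) (c m)%:C * 0 ^+ (p - m) * (u z n)^-1 ^+ m.+1.
  rewrite big_ord_recr /= subnn expr0 mulr1 cp rmorph_nat big1 ?add0r // => m _.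
  by rewrite expr0n subn_eq0 leqNgt ltn_ord /= mulr0 mul0r.
under eq_cvg do rewrite E.
apply: cvgC_sum => m; apply: cvgM; last first.
  by apply: cvgC_X; apply: cvgV; [exact: u_neq0|exact: dilation_cvg].
by apply: cvgMr; apply: cvgC_X; exact: inv_dilation_cvg.
Qed.

Lemma hsum_finType (T : finType) (f : T -> R[i]) : hsum f (\sum_x f x).
Proof.
have -> : \sum_x f x = \sum_(x <- [fset x in enum T]%fset) f x.
  rewrite -big_enum /=; apply: perm_big; apply: uniq_perm; rewrite ?enum_uniq ?fset_uniq //.
  by move=> x; rewrite inE.
by apply: hsum_fin => x; rewrite inE mem_enum.
Qed.

(** [multisection], divided by N^(p+1), is passed to the limit by [tannery]. The bound on Re z gives
    |Re z + n| <= N/2 whenever |n| <= M, so the arguments stay in the rectangle of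
    [cexp_sub1_ge]. *)
Lemma lipschitz_strip z : upper_half_plane z -> `|complex.Re z| <= 1 / 2 ->
  hsum (fun n => p`!%:R * (u z n)^-1 ^+ p.+1) (F (qparam z)).
Proof.
move=> hz hx; have y0 : 0 < complex.Im z by [].
pose N M := M.*2.+1.
pose f M (n : int) : R[i] := if (`|n| <= M)%N then
  (((N M)%:R)^-1 ^+ p.+1 * F (qparam ((z + n%:~R) / (N M)%:R))) else 0.
have [G HG] := asum_shift_pow p_gt0 hz.
have fsum M : hsum (f M) (F (qparam z)).
  pose h (j : 'I_(N M)) : int := (j : nat)%:Z - M%:Z.
  apply: (@hsum_inj _ _ _ h) => [i j /addIr[]/val_inj //|n hn|].
    rewrite /f; case: ifPn => // nM; exfalso.
    have jN : (`|((n : int) + M%:Z)%R| < N M)%N by rewrite /N; lia.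
    have := hn (Ordinal jN); rewrite /h /= => /eqP; apply; lia.
  have -> : F (qparam z) = \sum_j f M (h j).
    have Nn : (N M)%:R != 0 :> R[i] by rewrite pnatr_eq0.
    apply: (mulfI (expf_neq0 p.+1 Nn)); rewrite -multisection // mulr_sumr.
    apply: eq_bigr => j _; rewrite /f.
    have -> : (`|h j| <= M)%N by rewrite /h; have := ltn_ord j; rewrite /N; lia.
    by rewrite mulrA -exprMn divff // expr1n mul1r /h rmorphB /= -!pmulrn.
  exact: hsum_finType.
have u0 n := u_neq0 n hz.
have sum0 : exists s, hsum (fun n => p`!%:R * (u z n)^-1 ^+ p.+1) s.
  apply: (@asum_hsum _ _ _ (cabs (p`!%:R * (- Complex 0 (2 * pi) : R[i])^-1 ^+ p.+1) * G)).
  move=> A; apply: le_trans (asumZ _ HG A).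
  by apply: ler_sum => n _; rewrite -mulrA -exprMn -invfM /u mulNr.
have [s Hs] := sum0; suff -> : F (qparam z) = s by [].
(* The constant of [cexp_sub1_ge] for A = 2 pi Im z. This A bounds the real parts for every N >= 1,
   so the dominating family does not depend on M. *)
pose a := expR (- (2 * pi * complex.Im z)) / 4.
have a0 : 0 < a by rewrite divr_gt0 ?expR_gt0.
pose B := \sum_(m < p.+1) `|c m| * 2 ^+ (p - m).
have B0 : 0 <= B by apply: sumr_ge0 => m _; rewrite mulr_ge0 ?exprn_ge0.
pose D : R := B * (a * (2 * pi))^-1 ^+ p.+1.
have D0 : 0 <= D by rewrite mulr_ge0 // exprn_ge0 // invr_ge0 !mulr_ge0 ?pi_ge0 // ltW.
apply/eqP; rewrite -subr_eq0 -cabs_eq0 eq_le cabs_ge0 andbT.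
apply/ler_addgt0Pr => e e0; rewrite add0r.
suff [N0 /(_ N0 (leqnn _))] : exists N0 : nat, forall M, (N0 <= M)%N -> cabs (F (qparam z) - s) <= e by [].
apply: (tannery (asumZ D%:C HG) _ _ fsum Hs e0) => [M n|n e' e'0].
  rewrite cabsM cabsC ger0_norm // /f; case: ifPn => nM; last first.
    by rewrite cabs0 mulr_ge0 ?cabs_ge0.
  have N0 : 0 < ((N M)%:R : R) by rewrite ltr0n.
  have NV0 : 0 < ((N M)%:R : R)^-1 by rewrite invr_gt0.
  have N1 : ((N M)%:R : R)^-1 <= 1 by rewrite invf_le1 // ler1n.
  set w := qparam _; have hw : a * (2 * pi * cabs (z + n%:~R) / (N M)%:R) <= cabs (1 - w).
    have -> : 2 * pi * cabs (z + n%:~R) / (N M)%:R = cabs (- (u z n / (N M)%:R)).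
      by rewrite cabsN cabsM cabs_u cabsV cabs_nat.
    rewrite /w qparam_u; apply: cexp_sub1_ge.
    - by rewrite !mulr_ge0 ?pi_ge0 // ltW.
    - have -> : complex.Re (- (u z n / (N M)%:R)) = - (2 * pi * complex.Im z) / (N M)%:R.
        rewrite natV_rc /u mulNr opprK cReM cReM cImM /= cImD Im_int addr0 !mul0r mulr0 subr0 sub0r.
        by rewrite mulNr.
      have h : 0 <= 2 * pi * complex.Im z by rewrite !mulr_ge0 ?pi_ge0 // ltW.
      move: (2 * pi * _) h => t t0; rewrite mulNr oppr_le0 lerN2.
      by rewrite divr_ge0 ?(ltW N0) // andbT ler_piMr.
    - have -> : complex.Im (- (u z n / (N M)%:R)) = 2 * pi * ((complex.Re z + n%:~R) / (N M)%:R).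
        rewrite natV_rc /u mulNr opprK cImM cReM cImM /= cReD Re_int !mul0r !mulr0 add0r.
        by rewrite ?addr0 ?add0r mulrA.
      rewrite normrM ger0_norm ?mulr_ge0 ?pi_ge0 //.
      rewrite [leRHS](_ : pi = 2 * pi * (1 / 2)); last by field.
      rewrite ler_wpM2l ?mulr_ge0 ?pi_ge0 // -{1}[1 / 2]mul1r.
      rewrite normrM (ger0_norm (ltW NV0)) ler_pdivrMr //.
      apply: le_trans (ler_normD _ _) _.
      have -> : `|n%:~R| = (`|n|%N)%:R :> R by rewrite -intr_norm -abszE -pmulrn.
      have : (`|n|%N)%:R <= (M%:R : R) by rewrite ler_nat.
      have -> : (N M)%:R = 2 * M%:R + 1 :> R by rewrite /N -addnn -addn1 !natrD; ring.
      lra.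
  have z0 : 0 < cabs (z + n%:~R) by rewrite cabs_gt0; apply/uhp_neq0/uhp_int.
  have ww : 0 < a * (2 * pi * cabs (z + n%:~R) / (N M)%:R).
    by rewrite mulr_gt0 // divr_gt0 // mulr_gt0 // mulr_gt0 // pi_gt0.
  have w1 : w != 1.
    by apply: contraTneq (lt_le_trans ww hw) => ->; rewrite subrr cabs0 ltxx.
  have wlt1 : cabs w < 1.
    apply: cabs_qparam_lt1; rewrite /upper_half_plane /= natV_rc cImM /= mulr0 add0r.
    by rewrite cImD Im_int addr0 mulr_gt0.
  rewrite cabsM !cabsX !cabsV cabs_nat.
  apply: le_trans (ler_wpM2l _ (closed_form_bound wlt1 w1)) _; first by rewrite exprn_ge0 // ltW.
  have api : 0 < a * (2 * pi) by rewrite mulr_gt0 // mulr_gt0 // pi_gt0.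
  have w10 : 0 < cabs (1 - w) := lt_le_trans ww hw.
  have h1 : 0 <= (N M)%:R^-1 * (cabs (1 - w))^-1 by rewrite ltW // mulr_gt0 // invr_gt0.
  have h2 : 0 <= (a * (2 * pi))^-1 * (cabs (z + n%:~R))^-1.
    by rewrite ltW // mulr_gt0 // invr_gt0.
  rewrite -/B mulrCA -mulrA ler_wpM2l // -!exprMn lerXn2r //.
  rewrite -!invfM lef_pV2 ?posrE; [|exact: mulr_gt0|exact: mulr_gt0].
  apply: le_trans (ler_wpM2l (ltW N0) hw); rewrite le_eqVlt; apply/orP; left.
  by apply/eqP; field; apply: lt0r_neq0.
have [N0 HN0] := cvgC_epsP (@closed_form_cvg z n hz) e'0.
exists (maxn N0 `|n|%N) => M; rewrite geq_max => /andP[h1 h2].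
by rewrite /f h2; apply: HN0.
Qed.

End ClosedForm.

Lemma hsum_int_shift (f : int -> R[i]) s (k : int) : hsum f s -> hsum (fun n => f (n + k)) s.
Proof.
apply: (@hsum_bij _ _ _ (fun n => n + k)); exists (fun n => n - k) => n.
  by rewrite addrK.
by rewrite subrK.
Qed.

(** Both sides are invariant under z -> z + 1, so z may be moved to the strip |Re z| <= 1/2. *)
Lemma lipschitz z p t : (0 < p)%N -> upper_half_plane z ->
  hsum (fun r => r%:R ^+ p * qparam z ^+ r) t ->
  hsum (fun n : int => (z + n%:~R)^-1 ^+ p.+1)
    ((- Complex 0 (2 * pi)) ^+ p.+1 / p`!%:R * t).
Proof.
move=> p0 hz ht; have [c cp HF] := hsum_pow R p.
pose k := Num.floor (complex.Re z + 1 / 2); pose z0 := z + (- k)%:~R.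
have hz0 : upper_half_plane z0 by apply: uhp_int.
have hx0 : `|complex.Re z0| <= 1 / 2.
  have /andP[] := mem_rg1_floor (complex.Re z + 1 / 2); rewrite -/k.
  rewrite /z0 cReD Re_int rmorphN /= ler_norml => h1 h2; lra.
have h := lipschitz_strip p0 cp HF hz0 hx0.
have tE : t = \sum_(m < p.+1) (c m)%:C * (1 - qparam z0)^-1 ^+ m.+1.
  apply: (hsum_unique ht); rewrite -(@qparamDint _ z (- k)); apply: HF.
  exact: cabs_qparam_lt1.
have h' := hsumZ ((- Complex 0 (2 * pi)) ^+ p.+1 / p`!%:R) (hsum_int_shift k h).
rewrite tE; apply: eq_hsum h' => n.
have w0 : (- Complex 0 (2 * pi) : R[i]) != 0.
  by rewrite oppr_eq0 eq_complex /= eqxx mulf_eq0 pnatr_eq0 /= gt_eqF ?pi_gt0.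
have f0 : p`!%:R != 0 :> R[i] by rewrite pnatr_eq0 -lt0n fact_gt0.
have -> : z0 + (n + k)%:~R = z + n%:~R by rewrite /z0 rmorphD rmorphN /=; ring.
rewrite -mulNr invfM exprMn [(_^-1 ^+ _ * _)%R]mulrC mulrA mulrA divfK //.
by rewrite mulrAC -exprMn mulfV // expr1n mul1r.
Qed.

End Lipschitz.

(** * Power series in q *)

Section QSeries.
Variable R : realType.
Implicit Types (z w q : R[i]) (a b : nat -> R[i]) (f g : R[i] -> R[i]).

Lemma asum_fiber (T I : choiceType) (p : T -> I) (f : T -> R[i]) (g : I -> R[i]) M :
  asum f M -> (forall i, hsum (fun x => if p x == i then f x else 0) (g i)) ->
  asum g M.
Proof.
move=> fM fg B; apply/ler_addgt0Pr => e e0.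
have /choice [K HK] : forall i, exists K : {fset T}, forall D, (K `<=` D)%fset ->
    cabs (\sum_(x <- D) (if p x == i then f x else 0) - g i) <= e / (size B).+1%:R.
  by move=> i; apply: fg; rewrite divr_gt0 ?ltr0n.
pose D := (\bigcup_(i <- B) K i)%fset.
apply: (@le_trans _ _ (\sum_(i <- B) (\sum_(x <- D) (if p x == i then cabs (f x) else 0)
    + e / (size B).+1%:R))).
  rewrite big_seq_cond [leRHS]big_seq_cond; apply: ler_sum => i /andP[iB _].
  have := HK i D (bigfcup_sup _ iB isT).
  set S := \sum_(x <- D) _ => h.
  have -> : g i = S - (S - g i) by ring.
  apply: le_trans (cabsD _ _) _; rewrite cabsN; apply: lerD h.
  apply: le_trans (cabs_sum _ _ _) _; apply: ler_sum => x _.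
  by case: ifP => //; rewrite cabs0.
rewrite big_split /=; apply: lerD.
  rewrite exchange_big /=; apply: le_trans (fM D); apply: ler_sum => x _.
  case: (boolP (p x \in B)) => pB.
    rewrite (big_fsetD1 _ pB) /= eqxx big1_seq ?addr0 // => i /=.
    by rewrite !inE => /andP[/negPf]; rewrite eq_sym => ->.
  rewrite big1_seq ?cabs_ge0 // => i /= iB.
  by case: eqP => // pi; rewrite pi iB in pB.
rewrite sum_const_seq -mulrA ler_piMr ?(ltW e0) //.
by rewrite mulrC ler_pdivrMr ?ltr0n // mul1r ler_nat.
Qed.

(** Absolute convergence in the whole open unit disc. It is recorded along with the values of the
    series because it passes to Cauchy products and provides the larger radii used in termwise
    differentiation. *)
Definition qbounded a : Prop := forall r : R, 0 <= r -> r < 1 ->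
  exists M, asum (fun k => a k * r%:C ^+ k) M.

Definition qseries a f : Prop := qbounded a /\
  forall z, upper_half_plane z -> hsum (fun k => a k * qparam z ^+ k) (f z).

Lemma qbounded_asum a q : qbounded a -> cabs q < 1 ->
  exists M, asum (fun k => a k * q ^+ k) M.
Proof.
move=> ab q1; have [M HM] := ab _ (cabs_ge0 q) q1; exists M.
apply: le_asum HM => k; rewrite !cabsM !cabsX cabsC ger0_norm ?cabs_ge0 //.
Qed.

Lemma hsum_delta0 (c : R[i]) : hsum (fun k : nat => if k == 0%N then c else 0) c.
Proof.
have := @hsum_fin R _ (fun k => if k == 0%N then c else 0 : R[i]) [fset 0%N]%fset.
by rewrite big_seq_fset1; apply => k; rewrite inE => /negPf ->.
Qed.

Lemma asum_delta0 (c : R[i]) : asum (fun k : nat => if k == 0%N then c else 0) (cabs c).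
Proof.
apply: asum_nat => -[|N]; first by rewrite big_nil cabs_ge0.
rewrite big_nat_recl //= big1 ?addr0 // => k _; exact: cabs0.
Qed.

Lemma qseries_cst (c : R[i]) : qseries (fun k => if k == 0%N then c else 0) (fun=> c).
Proof.
split => [r _ _|z hz].
  exists (cabs c); apply: le_asum (asum_delta0 c) => -[|k] /=; first by rewrite mulr1.
  by rewrite mul0r.
by apply: eq_hsum (hsum_delta0 c) => -[|k] /=; rewrite ?mulr1 ?mul0r.
Qed.

Lemma qseriesD a b f g : qseries a f -> qseries b g ->
  qseries (fun k => a k + b k) (fun z => f z + g z).
Proof.
move=> [ab af] [bb bg]; split => [r r0 r1|z hz].
  have [M HM] := ab r r0 r1; have [N HN] := bb r r0 r1; exists (M + N).
  by apply: le_asum (asumD HM HN) => k; rewrite mulrDl.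
by apply: eq_hsum (hsumD (af z hz) (bg z hz)) => k; rewrite mulrDl.
Qed.

Lemma qseriesZ (c : R[i]) a f : qseries a f -> qseries (fun k => c * a k) (fun z => c * f z).
Proof.
move=> [ab af]; split => [r r0 r1|z hz].
  have [M HM] := ab r r0 r1; exists (cabs c * M).
  by apply: le_asum (asumZ c HM) => k; rewrite mulrA.
by apply: eq_hsum (hsumZ c (af z hz)) => k; rewrite mulrA.
Qed.

Definition cauchy_prod a b (n : nat) : R[i] := \sum_(i < n.+1) a i * b (n - i)%N.

Lemma hsum_cauchy_fiber a b q n :
  hsum (fun p : nat * nat => if (p.1 + p.2)%N == n then a p.1 * q ^+ p.1 * (b p.2 * q ^+ p.2) else 0)
    (cauchy_prod a b n * q ^+ n).
Proof.
pose h (i : 'I_n.+1) : nat * nat := (i : nat, (n - i)%N).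
apply: (@hsum_inj _ _ _ h) => [i j []/val_inj //|[i j] /= hn|].
  case: eqP => // ijn; have iN : (i < n.+1)%N by rewrite ltnS -ijn leq_addr.
  by have := hn (Ordinal iN); rewrite /h /= -ijn addKn eqxx.
rewrite /cauchy_prod mulr_suml; apply: eq_hsum (hsum_finType _) => i /=.
have iN : (i <= n)%N by rewrite -ltnS.
have E : q ^+ n = q ^+ i * q ^+ (n - i) by rewrite -exprD subnKC.
by rewrite subnKC // eqxx E; ring.
Qed.

Lemma qseriesM a b f g : qseries a f -> qseries b g ->
  qseries (cauchy_prod a b) (fun z => f z * g z).
Proof.
move=> [ab af] [bb bg]; split => [r r0 r1|z hz].
  have [M HM] := ab r r0 r1; have [N HN] := bb r r0 r1; exists (M * N).
  by apply: asum_fiber (asum_prod HM HN) _ => n; exact: hsum_cauchy_fiber.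
have [M HM] := qbounded_asum ab (cabs_qparam_lt1 hz).
have [N HN] := qbounded_asum bb (cabs_qparam_lt1 hz).
by apply: hsum_fiber (hsum_prod HM HN (af z hz) (bg z hz)) _ => n; exact: hsum_cauchy_fiber.
Qed.

Lemma qseriesX a f n : qseries a f -> exists2 b, qseries b (fun z => f z ^+ n) &
  ((0 < n)%N -> a 0%N = 0 -> b 0%N = 0).
Proof.
move=> af; elim: n => [|n [b bf b0]].
  by exists (fun k => if k == 0%N then 1 else 0) => //; exact: (qseries_cst 1).
exists (cauchy_prod a b) => [|_ a0].
  by have := qseriesM af bf; under [X in qseries _ X]eq_fun do rewrite -exprS.
by rewrite /cauchy_prod big_ord1 a0 mul0r.
Qed.

Lemma qbounded_pow p a : qbounded a -> qbounded (fun k => k%:R ^+ p * a k).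
Proof.
(* A radius strictly between r and 1: then k^p (r/s)^k is bounded, and the series at s takes care of
   the rest. *)
move=> ab r r0 r1; pose s := (1 + r) / 2.
have s0 : 0 < s by rewrite /s; lra. have s1 : s < 1 by rewrite /s; lra.
have rs : r < s by rewrite /s; lra.
have [M HM] := ab s (ltW s0) s1.
have rs0 : 0 <= r / s by rewrite divr_ge0 // ltW.
have rs1 : r / s < 1 by rewrite ltr_pdivrMr // mul1r.
have [B HB] := pow_sum_bound p rs0 rs1.
exists (cabs (B%:C : R[i]) * M); apply: le_asum (asumZ B%:C HM) => k.
rewrite !cabsM !cabsX !cabsC cabs_nat (ger0_norm r0) (ger0_norm (ltW s0)).
have -> : r ^+ k = (r / s) ^+ k * s ^+ k by rewrite -exprMn divfK // gt_eqF.
have -> : forall A B' C D : R, A * B' * (C * D) = A * C * (B' * D) by move=> *; ring.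
rewrite ler_wpM2r ?mulr_ge0 ?cabs_ge0 ?exprn_ge0 ?(ltW s0) //.
apply: le_trans (ler_norm _); apply: le_trans (HB k.+1).
rewrite big_nat_recr //= lerDr sumr_ge0 // => i _.
by rewrite mulr_ge0 ?exprn_ge0.
Qed.

(** Termwise differentiation: the increment of f minus its linear part is a sum of second-order
    remainders, bounded by |h|^2 times a convergent series with coefficients k^2 |a_k|. *)
Lemma qseries_holomorphic a f : qseries a f -> holomorphic_on_uhp f.
Proof.
move=> [ab af] z hz; have y0 : 0 < complex.Im z by [].
have pi0 := pi_gt0 R.
have q1 := cabs_qparam_lt1 hz.
have [M1 HM1] := qbounded_asum (qbounded_pow 1 ab) q1.
have [L0 HL0] := asum_hsum HM1.
pose I2 : R[i] := Complex 0 (2 * pi).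
have cI2 : cabs I2 = 2 * pi.
  by rewrite cabsE /= expr0n add0r sqrtr_sqr ger0_norm // mulr_ge0 // ltW.
(* The value of |q| at height Im z / 2. For |h| <= Im z / 2 it dominates |q(z)| e^(2 pi |h|), the
   ratio of the remainders. *)
pose rho := expR (- (pi * complex.Im z)).
have rho1 : rho < 1 by rewrite -expR0 ltr_expR oppr_lt0 mulr_gt0.
have [M2 HM2] := qbounded_pow 2 ab (expR_ge0 (- (pi * complex.Im z))) rho1.
have M20 := asum_ge0 HM2.
apply/cvg_ex; exists (I2 * L0); apply/cvgrPdist_le => e e0.
have e0' : 0 < complex.Re e by move: e0; rewrite ltcE => /andP[].
have -> : e = (complex.Re e)%:C by rewrite RRe_real // gtr0_real.
set e' := complex.Re e in e0' *.
pose C := 8 * (2 * pi) ^+ 2 * M2.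
have C0 : 0 <= C by rewrite mulr_ge0 // mulr_ge0 // sqr_ge0.
have d0 : 0 < Num.min (complex.Im z / 2) (e' / (C + 1)).
  by rewrite lt_min !divr_gt0 // ltr_wpDl.
near=> h.
have h0 : h != 0 by near: h; exact: nbhs_dnbhs_neq.
have : `|h| < (Num.min (complex.Im z / 2) (e' / (C + 1)))%:C.
  by near: h; apply: dnbhs0_lt; rewrite ltcR.
rewrite normE ltcR lt_min => /andP[h1 h2].
rewrite normE lecR cabsB /=.
have ch0 : 0 < cabs h by rewrite cabs_gt0.
have -> : h^-1 *: (f (h *: 1 + z) - f z) - I2 * L0 =
    h^-1 * (f (h *: 1 + z) - f z - h * (I2 * L0)).
  by rewrite mulrBr mulKf.
have -> : h *: 1 + z = z + h by rewrite addrC /GRing.scale /= mulr1.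
have hzh : upper_half_plane (z + h).
  rewrite /upper_half_plane /= cImD; have := Im_le_cabs h.
  rewrite ler_norml => /andP[h3 _]; have : cabs h < complex.Im z / 2 by []. lra.
have hs := hsumB (hsumB (af _ hzh) (af _ hz)) (hsumZ (h * I2) HL0).
rewrite -mulrA in hs.
rewrite cabsM cabsV ler_pdivrMl //.
have bd : asum (fun k => a k * qparam (z + h) ^+ k - a k * qparam z ^+ k -
    h * I2 * (k%:R ^+ 1 * a k * qparam z ^+ k)) (cabs ((8 * cabs (I2 * h) ^+ 2)%:C : R[i]) * M2).
  apply: le_asum (asumZ _ HM2) => k.
  have -> : a k * qparam (z + h) ^+ k - a k * qparam z ^+ k - h * I2 * (k%:R ^+ 1 * a k * qparam z ^+ k)
     = a k * qparam z ^+ k * (cexp (k%:R * (I2 * h)) - 1 - k%:R * (I2 * h)).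
    have -> : cexp (k%:R * (I2 * h)) = qparam h ^+ k by rewrite cexpMn.
    by rewrite qparamD exprMn expr1; ring.
  rewrite [cabs (a k * _ * _)]cabsM; apply: le_trans (ler_wpM2l (cabs_ge0 _) (cexp_quad _)) _.
  have -> : cabs ((8 * cabs (I2 * h) ^+ 2)%:C * (k%:R ^+ 2 * a k * (expR (- (pi * complex.Im z)))%:C ^+ k))
     = (8 * (2 * pi * cabs h) ^+ 2 * (k%:R ^+ 2 * cabs (a k))) * rho ^+ k.
    rewrite cabsM cabsC ger0_norm; last by rewrite mulr_ge0 ?sqr_ge0.
    rewrite [cabs (_ * _ ^+ k)]cabsM [cabs (_ * a k)]cabsM !cabsX cabs_nat cabsC.
    by rewrite ger0_norm ?expR_ge0 // cabsM cI2 mulrA.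
  have -> : cabs (a k * qparam z ^+ k) * (8 * cabs (k%:R * (I2 * h)) ^+ 2 * expR (cabs (k%:R * (I2 * h))))
     = (8 * (2 * pi * cabs h) ^+ 2 * (k%:R ^+ 2 * cabs (a k))) *
       expR (2 * pi * cabs h + - (2 * pi * complex.Im z)) ^+ k.
    rewrite !cabsM cabs_nat cI2 cabsX cabs_qparam expRM_natl expRD.
    rewrite [(_ * expR (- _)) ^+ k]exprMn; ring.
  apply: ler_wpM2l.
    by apply: mulr_ge0; apply: mulr_ge0; rewrite ?sqr_ge0 ?exprn_ge0 ?cabs_ge0.
  rewrite lerXn2r ?nnegrE ?expR_ge0 // ler_expR; nra.
apply: le_trans (hsum_le hs bd) _.
rewrite [cabs _%:C]cabsC ger0_norm; last by rewrite mulr_ge0 ?sqr_ge0.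
have -> : cabs (I2 * h) = 2 * pi * cabs h by rewrite cabsM cI2.
rewrite exprMn.
have -> : 8 * ((2 * pi) ^+ 2 * cabs h ^+ 2) * M2 = cabs h * (C * cabs h) by rewrite /C; ring.
rewrite ler_wpM2l ?(ltW ch0) //.
have : cabs h * (C + 1) < e' by rewrite -ltr_pdivlMr // ltr_wpDl.
nra.
Unshelve. all: by end_near. Qed.

Lemma qseries_q_expansion a f : qseries a f -> q_expansion f a.
Proof. by move=> [_ af] z hz; apply: cvgC_eps; apply: hsum_nat; exact: af. Qed.

(** The imaginary axis suffices. Once the first m differences of coefficients are known to vanish,
    the m-th term dominates as t tends to infinity. Convergence at t = 1 bounds the coefficients
    geometrically, which controls the later terms. *)
Lemma q_expansion_unique f a b : q_expansion f a -> q_expansion f b -> a = b.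
Proof.
move=> fa fb; pose c k := a k - b k.
have pi0 := pi_gt0 R.
pose it (t : R) : R[i] := Complex 0 t.
have hc t : 0 < t -> forall e : R, 0 < e -> exists N0, forall N, (N0 <= N)%N ->
    cabs (\sum_(0 <= k < N) c k * qparam (it t) ^+ k) <= e.
  move=> t0 e e0; have e2 : 0 < e / 2 by rewrite divr_gt0.
  have [N1 H1] := cvgC_epsP (fa (it t) t0) e2.
  have [N2 H2] := cvgC_epsP (fb (it t) t0) e2.
  exists (maxn N1 N2) => N; rewrite geq_max => /andP[h1 h2].
  have -> : \sum_(0 <= k < N) c k * qparam (it t) ^+ k =
     (\sum_(0 <= k < N) a k * qparam (it t) ^+ k - f (it t)) -
     (\sum_(0 <= k < N) b k * qparam (it t) ^+ k - f (it t)).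
    rewrite opprB addrA subrK -sumrB; apply: eq_bigr => k _; exact: mulrBl.
  by rewrite [e]splitr; apply: le_trans (cabsD _ _) _; rewrite cabsN lerD ?H1 ?H2.
have cq t : cabs (qparam (it t)) = expR (- (2 * pi * t)) by rewrite cabs_qparam.
pose r0 := expR (- (2 * pi * 1) : R).
have r00 : 0 < r0 := expR_gt0 _.
have [B B0 HB] : exists2 B : R, 0 <= B & forall k, cabs (c k) * r0 ^+ k <= B.
  have [N0 HN] := hc 1 ltr01 1 ltr01.
  exists (2 + \sum_(0 <= k < N0) cabs (c k) * r0 ^+ k).
    by rewrite addr_ge0 // sumr_ge0 // => k _; rewrite mulr_ge0 ?cabs_ge0 ?exprn_ge0 // ltW.
  move=> k; have [kN|Nk] := ltnP k N0.
    rewrite (big_rem k) /=; last by rewrite mem_index_iota.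
    rewrite addrCA lerDl addr_ge0 // sumr_ge0 // => i _.
    by rewrite mulr_ge0 ?cabs_ge0 ?exprn_ge0 // ltW.
  have := HN _ Nk; have := HN _ (leqW Nk); rewrite big_nat_recr //=.
  set S := \sum_(0 <= i < k) _ => h1 h2.
  have -> : cabs (c k) * r0 ^+ k = cabs (c k * qparam (it 1) ^+ k).
    by rewrite cabsM cabsX cq.
  have -> : c k * qparam (it 1) ^+ k = (S + c k * qparam (it 1) ^+ k) - S by ring.
  apply: le_trans (cabsD _ _) _; rewrite cabsN.
  have : 0 <= \sum_(0 <= i < N0) cabs (c i) * r0 ^+ i.
    by rewrite sumr_ge0 // => i _; rewrite mulr_ge0 ?cabs_ge0 ?exprn_ge0 // ltW.
  lra.
suff c0 : forall m, c m = 0 by apply/funext => m; apply/eqP; rewrite -subr_eq0; apply/eqP/c0.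
elim/ltn_ind => m IH.
apply/eqP; rewrite -cabs_eq0 eq_le cabs_ge0 andbT.
apply/ler_addgt0Pr => e e0; rewrite add0r.
(* With this K the estimate [main] reads |c m| <= K rho, and the choice of [t] makes K rho <= e. *)
pose K := (2 * B + 1) / r0 ^+ m.+1.
have K0 : 0 < K by rewrite divr_gt0 ?exprn_gt0 // ltr_wpDl // mulr_ge0.
pose t := 2 + K / e.
have t2 : 2 <= t by rewrite lerDl divr_ge0 // ltW.
have t0 : 0 < t by lra.
pose rho := expR (- (2 * pi * t) : R).
have rho0 : 0 < rho := expR_gt0 _.
have rhoe : K * rho <= e.
  have h1 := expR_ge1Dx (2 * pi * t); have h2 : 0 < expR (2 * pi * t) := expR_gt0 _.
  rewrite /rho expRN ler_pdivrMr //.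
  have h3 : K / e <= expR (2 * pi * t).
    apply: (@le_trans _ _ t); first by rewrite /t lerDr.
    apply: le_trans h1; have := pi_ge2 R; nra.
  by move: h3; rewrite ler_pdivrMr // mulrC.
have ratio : rho / r0 <= 1 / 2.
  rewrite /rho /r0 -expRB.
  have -> : - (2 * pi * t) - - (2 * pi * 1) = - (2 * pi * (t - 1)) by ring.
  rewrite expRN mul1r lef_pV2 ?posrE ?expR_gt0 //.
  apply: le_trans (expR_ge1Dx _); have := pi_ge2 R; nra.
have ratio0 : 0 <= rho / r0 by rewrite divr_ge0 // ltW.
have main : cabs (c m) * rho ^+ m <= (2 * B + 1) * (rho / r0) ^+ m.+1.
  (* A partial sum is made smaller than this power, which gives the 1 in 2B+1; the terms after the
     m-th give 2B, being geometric with ratio at most 1/2. *)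
  have e1 : 0 < (rho / r0) ^+ m.+1 by rewrite exprn_gt0 // divr_gt0.
  have [N0 HN] := hc t t0 _ e1.
  pose N := (N0 + m.+1)%N.
  have := HN N (leq_addr _ _); rewrite -{1}[N]/(N0 + m.+1)%N.
  rewrite (@big_cat_nat _ _ _ m.+1) //=; last by rewrite leq_addl.
  rewrite big_nat_recr //= big_nat big1 ?add0r; last first.
    by move=> k /andP[_ km]; rewrite IH // mul0r.
  set T := \sum_(m.+1 <= k < _) _ => h.
  have hT : cabs T <= 2 * B * (rho / r0) ^+ m.+1.
    apply: le_trans (cabs_sum _ _ _) _.
    apply: (@le_trans _ _ (\sum_(m.+1 <= k < N0 + m.+1) B * (rho / r0) ^+ k)).
      apply: ler_sum => k _; rewrite cabsM cabsX cq -/rho.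
      have -> : rho ^+ k = r0 ^+ k * (rho / r0) ^+ k by rewrite -exprMn mulrC divfK // gt_eqF.
      by rewrite mulrA ler_wpM2r ?exprn_ge0.
    rewrite -mulr_sumr [2 * B]mulrC -mulrA ler_wpM2l //.
    rewrite -{1}[m.+1]add0n big_addn addnK.
    under eq_bigr do rewrite exprD.
    rewrite -mulr_suml ler_wpM2r ?exprn_ge0 //.
    apply: le_trans (geometric_bound _ ratio0 _) _; first lra.
    by rewrite -[leRHS]invrK lef_pV2 ?posrE ?invr_gt0 //; lra.
  have -> : cabs (c m) * rho ^+ m = cabs (c m * qparam (it t) ^+ m) by rewrite cabsM cabsX cq.
  have -> : c m * qparam (it t) ^+ m = (c m * qparam (it t) ^+ m + T) - T by ring.
  apply: le_trans (cabsD _ _) _; rewrite cabsN; lra.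
apply: le_trans rhoe.
have rm : 0 < rho ^+ m by rewrite exprn_gt0.
rewrite -(ler_pM2r rm); apply: le_trans main _.
rewrite /K exprMn exprVn exprSr.
by rewrite le_eqVlt; apply/orP; left; apply/eqP; ring.
Qed.

Lemma fourier_coefE a f : qseries a f -> fourier_coef f = a.
Proof.
move=> /qseries_q_expansion fa; apply: (@q_expansion_unique f) => //.
by rewrite /fourier_coef; case: xgetP => // /(_ a).
Qed.

End QSeries.

(** * Eisenstein series *)

Arguments cabs {R} z : simpl never.

Section Eisenstein.
Variable R : realType.
Implicit Types (z w q : R[i]) (h : nat).

Lemma hsum_ge_fset (T : choiceType) (g : T -> R) S (A : {fset T}) :
  (forall x, 0 <= g x) -> hsum (fun x => (g x)%:C) S%:C -> \sum_(x <- A) g x <= S.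
Proof.
move=> g0 HS; apply/ler_addgt0Pr => d d0; have [A' HA'] := HS _ d0.
have := HA' _ (fsubsetUl A' A); rewrite -rmorph_sum -rmorphB cabsC ler_norml.
have := ler_sum_fset g0 (fsubsetUr A' A).
lra.
Qed.

(** The weight is 2h. The pair (0, 0) stays in the index set: for h >= 1 its term vanishes by the
    convention 0^-1 = 0. *)
Definition lattice_term h z (cd : int * int) : R[i] :=
  (cd.1%:~R * z + cd.2%:~R)^-1 ^+ h.*2.

Definition inv1sqr2 (cd : int * int) : R[i] := inv1sqr R cd.1 * inv1sqr R cd.2.

Lemma asum_inv1sqr2 : asum inv1sqr2 64.
Proof. by have := asum_prod (asum_inv1sqr R) (asum_inv1sqr R); rewrite -natrM. Qed.

Lemma lattice_lower z (cd : int * int) : upper_half_plane z -> cd != (0, 0) ->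
  (kappa z)^-1 <= cabs (cd.1%:~R * z + cd.2%:~R) ^+ 2.
Proof.
move=> hz cd0; have k0 := kappa_gt0 hz.
have := lattice_norm_ge cd.1%:~R cd.2%:~R hz; rewrite !rmorph_int => h.
rewrite -[leLHS]mulr1 ler_pdivrMl //; apply: le_trans h.
case: cd cd0 => c d; rewrite xpair_eqE negb_and /= => cd0.
have cE (n : int) : n != 0 -> 1 <= (n%:~R : R) ^+ 2.
  move=> n0; rewrite -rmorphXn /= ler1z; move: n0; nia.
have c2 := sqr_ge0 (c%:~R : R); have d2 := sqr_ge0 (d%:~R : R).
by case/orP: cd0 => /cE; lra.
Qed.

(** Four powers of |cz+d| pay for summability, through (1+c^2)(1+d^2) <= 3 (c^2+d^2)^2 for integers
    not both zero. The other 2h-4 keep the decay in the weight, whence the -4 in the later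
    exponents. *)
Lemma lattice_term_le h z (cd : int * int) (m : R) : upper_half_plane z ->
  (2 <= h)%N -> cd != (0, 0) -> 0 < m -> m <= cabs (cd.1%:~R * z + cd.2%:~R) ->
  cabs (lattice_term h z cd) <=
    m^-1 ^+ (h.*2 - 4) * (3 * kappa z ^+ 2) * cabs (inv1sqr2 cd).
Proof.
move=> hz h2 cd0 m0 hm; have k0 := kappa_gt0 hz.
set X := cabs _ in hm *.
have X0 : 0 < X by apply: lt_le_trans hm.
have -> : lattice_term h z cd = (cd.1%:~R * z + cd.2%:~R)^-1 ^+ (h.*2 - 4) * (cd.1%:~R * z + cd.2%:~R)^-1 ^+ 4.
  by rewrite -exprD subnK // -[4%N]/(2.*2)%N leq_double.
rewrite cabsM !cabsX cabsV -/X -mulrA; apply: ler_pM; rewrite ?exprn_ge0 ?invr_ge0 ?(ltW X0) //.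
  by rewrite lerXn2r ?nnegrE ?invr_ge0 ?(ltW X0) ?(ltW m0) // lef_pV2.
have h4 := lattice_norm_ge cd.1%:~R cd.2%:~R hz; rewrite !rmorph_int -/X in h4.
rewrite cabsM !cabsC !ger0_norm ?invr_ge0 ?addr_ge0 ?sqr_ge0 //.
rewrite -invfM ler_pdivlMr; last first.
  by rewrite mulr_gt0 // ltr_wpDr ?sqr_ge0.
rewrite exprVn ler_pdivrMl ?exprn_gt0 //.
have cE (n : int) : n != 0 -> 1 <= (n%:~R : R) ^+ 2.
  move=> n0; rewrite -rmorphXn /= ler1z; move: n0; nia.
have c2 := sqr_ge0 (cd.1%:~R : R); have d2 := sqr_ge0 (cd.2%:~R : R).
have S1 : 1 <= cd.1%:~R ^+ 2 + cd.2%:~R ^+ 2 :> R.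
  by case: cd cd0 {hm X X0 h4} c2 d2 => c d; rewrite xpair_eqE negb_and /= => /orP[] /cE; lra.
move: (cd.1%:~R ^+ 2) (cd.2%:~R ^+ 2) c2 d2 S1 h4 => c d c0 d0 S1 h4.
have h5 : (c + d) ^+ 2 <= (kappa z * X ^+ 2) ^+ 2 by rewrite lerXn2r ?nnegrE //; nra.
have -> : X ^+ 4 * (3 * kappa z ^+ 2) = 3 * (kappa z * X ^+ 2) ^+ 2 by ring.
nra.
Qed.

Lemma lattice_term0 h z : (2 <= h)%N -> lattice_term h z (0, 0) = 0.
Proof.
by case: h => // h _; rewrite /lattice_term mul0r add0r invr0 doubleS exprS mul0r.
Qed.

Lemma asum_lattice h z : (2 <= h)%N -> upper_half_plane z ->
  exists M, asum (lattice_term h z) M.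
Proof.
move=> h2 hz; have k0 := kappa_gt0 hz.
pose m := Num.sqrt (kappa z)^-1; have m0 : 0 < m by rewrite sqrtr_gt0 invr_gt0.
exists (cabs ((m^-1 ^+ (h.*2 - 4) * (3 * kappa z ^+ 2))%:C : R[i]) * 64).
apply: le_asum (asumZ _ asum_inv1sqr2) => cd.
have [->|cd0] := eqVneq cd (0, 0); first by rewrite lattice_term0 // cabs0 cabs_ge0.
rewrite cabsM cabsC ger0_norm; last first.
  by rewrite mulr_ge0 ?exprn_ge0 ?invr_ge0 ?(ltW m0) // mulr_ge0 ?sqr_ge0.
apply: lattice_term_le => //.
rewrite -ler_sqr ?nnegrE ?cabs_ge0 ?(ltW m0) // sqr_sqrtr ?invr_ge0 ?(ltW k0) //.
exact: lattice_lower.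
Qed.

Definition eis h z : R[i] := xget 0 [set s | hsum (lattice_term h z) s]%classic.

Lemma eis_unique h z s : hsum (lattice_term h z) s -> eis h z = s.
Proof.
move=> hs; rewrite /eis; case: xgetP => [t _ /= ht|/(_ s)//].
exact: hsum_unique ht hs.
Qed.

Lemma hsum_eis h z : (2 <= h)%N -> upper_half_plane z ->
  hsum (lattice_term h z) (eis h z).
Proof.
move=> h2 hz; have [M /asum_hsum[s hs]] := asum_lattice h2 hz.
by rewrite (eis_unique hs).
Qed.

Lemma uhp_denominator (c d : int) z : upper_half_plane z -> (c, d) != (0, 0) ->
  c%:~R * z + d%:~R != 0.
Proof.
move=> hz cd; have := lattice_lower hz cd; rewrite /= -cabs_gt0 => h.
have k0 := kappa_gt0 hz; rewrite lt_neqAle cabs_ge0 andbT eq_sym.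
apply: contraTneq h => ->; rewrite expr0n /= -ltNge invr_gt0 //.
Qed.

(** A matrix of determinant one permutes the pairs (m, n), and unconditional summation is
    insensitive to the order. *)
Lemma eis_modular h : (2 <= h)%N -> modular_of_weight h.*2 (eis h).
Proof.
move=> h2 a b c d det z hz; apply: eis_unique.
have cd0 : (c, d) != (0, 0).
  by apply: contra_eq_neq det => -[-> ->]; rewrite !mulr0 subr0.
have den := uhp_denominator hz cd0.
pose g (mn : int * int) : int * int := (mn.1 * a + mn.2 * c, mn.1 * b + mn.2 * d).
have bg : bijective g.
  exists (fun mn : int * int => (mn.1 * d - mn.2 * c, mn.2 * a - mn.1 * b)) => -[m n];
    rewrite /g /=; congr (_, _).
  - by transitivity (m * (a * d - b * c)); [ring|rewrite det mulr1].
  - by transitivity (n * (a * d - b * c)); [ring|rewrite det mulr1].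
  - by transitivity (m * (a * d - b * c)); [ring|rewrite det mulr1].
  - by transitivity (n * (a * d - b * c)); [ring|rewrite det mulr1].
have := hsumZ ((c%:~R * z + d%:~R) ^+ h.*2) (hsum_bij bg (hsum_eis h2 hz)).
apply: eq_hsum => -[m n]; rewrite /lattice_term /g /=.
rewrite -[in LHS](invrK (c%:~R * z + d%:~R)) -exprMn -invfM; congr (_^-1 ^+ _).
rewrite !rmorphD !rmorphM /=.
by field.
Qed.

(** For h >= 2 this is 2 zeta(2h): the sum runs over all integers, and the term at 0 vanishes
    because 0^-1 = 0. *)
Definition zeta2 h : R[i] := xget 0 [set s | hsum (fun d : int => (d%:~R : R[i])^-1 ^+ h.*2) s]%classic.

Lemma hsum_zeta2 h : (2 <= h)%N -> hsum (fun d : int => (d%:~R : R[i])^-1 ^+ h.*2) (zeta2 h).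
Proof.
move=> h2; have hi : upper_half_plane (Complex 0 1 : R[i]) by rewrite /upper_half_plane /= ltr01.
have [M HM] := asum_lattice h2 hi.
have inj : injective (fun d : int => (0 : int, d)) by move=> x y [].
have [s hs] := asum_hsum (asum_inj inj HM).
have hs' : hsum (fun d : int => (d%:~R : R[i])^-1 ^+ h.*2) s.
  by apply: eq_hsum hs => d; rewrite /lattice_term /= mul0r add0r.
rewrite /zeta2; case: xgetP => [t _ //|/(_ s)//].
Qed.

Lemma zeta2_ge1 h : (2 <= h)%N -> exists2 x : R, zeta2 h = x%:C & 1 <= x.
Proof.
move=> h2; pose g (d : int) : R := d%:~R^-1 ^+ h.*2.
have g0 d : 0 <= g d by rewrite /g -mul2n exprM exprn_ge0 // sqr_ge0.
have hi : upper_half_plane (Complex 0 1 : R[i]) by rewrite /upper_half_plane /= ltr01.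
have gE d : (g d)%:C = (d%:~R : R[i])^-1 ^+ h.*2.
  by rewrite /g rmorphXn /= fmorphV /= rmorph_int.
have [M HM] := asum_lattice h2 hi.
have inj : injective (fun d : int => (0 : int, d)) by move=> x y [].
have HM' := asum_inj inj HM.
have [x hx] : exists x : R, hsum (fun d => (g d)%:C) x%:C.
  apply: (@hsum_ge0_exists _ _ _ M) => // A; apply: le_trans (HM' A).
  apply: ler_sum => d _; rewrite /lattice_term /= mul0r add0r -gE cabsC.
  exact: ler_norm.
exists x.
  apply: (hsum_unique (hsum_zeta2 h2)); apply: eq_hsum hx => d; exact: gE.
have := hsum_ge_fset [fset 1%R]%fset g0 hx.
by rewrite big_seq_fset1 /g invr1 expr1n.
Qed.

Lemma zeta2_neq0 h : (2 <= h)%N -> zeta2 h != 0.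
Proof.
move=> /zeta2_ge1[x -> x1]; rewrite -cabs_eq0 cabsC normr_eq0 gt_eqF //; lra.
Qed.

(** The terms with c = 0 add up to [zeta2 h]; in all the others |cz+d| >= Im z. *)
Lemma eis_sub_zeta2 h z : (2 <= h)%N -> upper_half_plane z ->
  cabs (eis h z - zeta2 h) <= (complex.Im z)^-1 ^+ (h.*2 - 4) * (3 * kappa z ^+ 2) * 64.
Proof.
move=> h2 hz; have y0 : 0 < complex.Im z by [].
have k0 := kappa_gt0 hz.
pose f0 (cd : int * int) : R[i] := if cd.1 == 0 then lattice_term h z cd else 0.
have hf0 : hsum f0 (zeta2 h).
  apply: (@hsum_inj _ _ _ (fun d : int => (0 : int, d))) => [x y []//|[c d] /= hcd|].
    rewrite /f0 /=; case: eqP => // c0.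
    by have := hcd d; rewrite c0 eqxx.
  by apply: eq_hsum (hsum_zeta2 h2) => d; rewrite /f0 /lattice_term /= mul0r add0r.
apply: (hsum_le (hsumB (hsum_eis h2 hz) hf0)).
set B := _ * (3 * _).
have B0 : 0 <= B.
  by rewrite mulr_ge0 ?exprn_ge0 ?invr_ge0 ?(ltW y0) // mulr_ge0 ?sqr_ge0.
have -> : B = cabs (B%:C : R[i]) by rewrite cabsC ger0_norm.
apply: le_asum (asumZ _ asum_inv1sqr2) => -[c d]; rewrite /f0 /=.
have [_|c0] := eqVneq; first by rewrite subrr cabs0 cabs_ge0.
rewrite subr0 [leRHS]cabsM cabsC ger0_norm //; apply: lattice_term_le => //=.
  by rewrite xpair_eqE negb_and c0.
apply: le_trans (Im_le_cabs _).
have -> : complex.Im (c%:~R * z + d%:~R) = c%:~R * complex.Im z.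
  by rewrite cImD cImM !Im_int Re_int mul0r !addr0.
rewrite normrM (gtr0_norm y0) ler_peMl ?(ltW y0) //.
by rewrite -intr_norm ler1z; move: c0; lia.
Qed.

(** The divisor function sigma_p(n), written over the complementary divisors n/d with d = i+1; it is
    0 at n = 0. *)
Definition sigma (p n : nat) : R[i] :=
  \sum_(i < n) if (i.+1 %| n)%N then (n %/ i.+1)%:R ^+ p else 0.

Definition divisor_term (p : nat) q (cr : nat * nat) : R[i] :=
  cr.2%:R ^+ p * q ^+ (cr.1.+1 * cr.2).

Lemma asum_pow p q : cabs q < 1 -> exists M, asum (fun r => r%:R ^+ p * q ^+ r) M.
Proof.
move=> q1; have [M HM] := pow_sum_bound p (cabs_ge0 q) q1; exists M.
apply: asum_nat => N; under eq_bigr do rewrite cabsM !cabsX cabs_nat; exact: HM.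
Qed.

Lemma asum_divisor p q : (0 < p)%N -> cabs q < 1 -> exists M, asum (divisor_term p q) M.
Proof.
move=> p0 q1; have [M HM] := asum_pow p q1; have [N HN] := asum_pow 0 q1.
exists (N * M); apply: le_asum (asum_prod HN HM) => -[c [|r]] /=.
  by rewrite /divisor_term /= expr0n gtn_eqF //= mul0r cabs0 cabs_ge0.
rewrite /divisor_term /= expr0 mul1r !cabsM !cabsX cabs_nat mulrCA.
rewrite ler_wpM2l ?exprn_ge0 // -exprD ler_wiXn2l ?cabs_ge0 ?(ltW q1) //.
by rewrite mulSn mulnS; lia.
Qed.

(** The double series of r^p q^(cr) over c >= 1 and r >= 0 is grouped by n = cr. The fibre over n =
    0 is infinite, made of the pairs with r = 0, whose terms vanish because p > 0. *)
Lemma hsum_divisor_fiber p q n : (0 < p)%N ->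
  hsum (fun cr => if (cr.1.+1 * cr.2)%N == n then divisor_term p q cr else 0)
    (sigma p n * q ^+ n).
Proof.
move=> p0; pose g (i : 'I_n) : nat * nat := (i : nat, (n %/ i.+1)%N).
apply: (@hsum_inj _ _ _ g) => [i j []/val_inj //|[c r] /= hn|].
  case: eqP => // crn; case: r crn hn => [|r] crn hn.
    by rewrite /divisor_term /= expr0n gtn_eqF //= mul0r.
  have cn : (c < n)%N by rewrite -crn mulnS mulSn; lia.
  have := hn (Ordinal cn); rewrite /g /= -crn mulKn // eqxx //.
rewrite /sigma mulr_suml; apply: eq_hsum (hsum_finType _) => i /=.
rewrite /divisor_term /=; case: ifPn => [dv|nd].
  have E : (i.+1 * (n %/ i.+1))%N = n by rewrite mulnC divnK.
  by rewrite E eqxx.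
rewrite mul0r; case: eqP => // nE; case/negP: nd.
by apply/dvdnP; exists (n %/ i.+1)%N; rewrite [RHS]mulnC nE.
Qed.

Lemma hsum_int_even (g : int -> R[i]) G s : (forall n, g (- n) = g n) ->
  hsum g G -> hsum (fun c : nat => g c.+1%:Z) s -> G = g 0 + 2 * s.
Proof.
move=> ge gG gs.
have h0 : hsum (fun n : int => if n == 0 then g 0 else 0) (g 0).
  have := @hsum_fin R _ (fun n : int => if n == 0 then g 0 else 0) [fset (0 : int)]%fset.
  by rewrite big_seq_fset1 eqxx; apply => k; rewrite inE => /negPf ->.
have hp : hsum (fun n : int => if 0 < n then g n else 0) s.
  apply: (@hsum_inj _ _ _ (fun c : nat => c.+1%:Z)) => [x y []//|[[|n]|n] // hn|//].
  by have := hn n; rewrite eqxx.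
have hm : hsum (fun n : int => if n < 0 then g n else 0) s.
  apply: (@hsum_inj _ _ _ Negz) => [x y []//|[n|n] // hn|].
    by have := hn n; rewrite eqxx.
  by apply: eq_hsum gs => c /=; rewrite NegzE ge.
have h := hsumD h0 (hsumD hp hm).
have -> : 2 * s = s + s by ring.
apply: (hsum_unique gG); apply: eq_hsum h => n.
by have [n0|n0|->] := ltgtP n 0; rewrite ?addr0 ?add0r.
Qed.

Definition lipschitz_cst (k : nat) : R[i] := (- Complex 0 (2 * pi)) ^+ k / k.-1`!%:R.

Lemma qseries_eq (a : nat -> R[i]) f g : (forall z, upper_half_plane z -> f z = g z) ->
  qseries a f -> qseries a g.
Proof. by move=> fg [ab af]; split => // z hz; rewrite -fg //; apply: af. Qed.

(** The row c > 0 of the lattice sum is Lipschitz's formula at cz, the row -c agrees with it because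
    the weight is even, and the row c = 0 is the constant term. *)
Lemma eis_qseries h : (2 <= h)%N ->
  qseries (fun n => (if n == 0%N then zeta2 h else 0) +
     2 * lipschitz_cst h.*2 * sigma h.*2.-1 n) (eis h).
Proof.
move=> h2; set p := h.*2.-1.
have pE : h.*2 = p.+1 by rewrite /p prednK // double_gt0 ltnW.
have p0 : (0 < p)%N by suff : (1 < p.+1)%N by []; rewrite -pE; lia.
pose T z := xget 0 [set s | hsum (divisor_term p (qparam z)) s]%classic.
have HT z : upper_half_plane z -> hsum (divisor_term p (qparam z)) (T z).
  move=> hz; have [M /asum_hsum[s hs]] := asum_divisor p0 (cabs_qparam_lt1 hz).
  by rewrite /T; case: xgetP => [t _ //|/(_ s)//].
have qT : qseries (sigma p) T.
  split => [r r0 r1|z hz].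
    have r1' : cabs (r%:C : R[i]) < 1 by rewrite cabsC ger0_norm.
    have [M HM] := asum_divisor p0 r1'; exists M.
    by apply: asum_fiber HM _ => n; apply: hsum_divisor_fiber.
  by apply: hsum_fiber (HT z hz) _ => n; apply: hsum_divisor_fiber.
apply: qseries_eq (qseriesD (qseries_cst (zeta2 h)) (qseriesZ (2 * lipschitz_cst h.*2) qT)).
move=> z hz.
have [M HM] := asum_lattice h2 hz.
have injc (c : int) : injective (fun d : int => (c, d)) by move=> x y [].
have /choice [g Hg] : forall c : int, exists s, hsum (fun d => lattice_term h z (c, d)) s.
  by move=> c; apply: asum_hsum (asum_inj (@injc c) HM).
have hgz := hsum_fubini (hsum_eis h2 hz) Hg.
have ge n : g (- n) = g n.
  apply: (hsum_unique (Hg (- n))).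
  have bN : bijective (fun d : int => - d) by exists (fun d : int => - d); exact: opprK.
  apply: eq_hsum (hsum_bij bN (Hg n)) => d; rewrite /lattice_term /=.
  have -> : n%:~R * z + (- d)%:~R = - ((- n)%:~R * z + d%:~R) by rewrite !rmorphN /=; ring.
  by rewrite -mul2n !exprM invrN sqrrN.
have g0 : g 0 = zeta2 h.
  apply: (hsum_unique (Hg 0)); apply: eq_hsum (hsum_zeta2 h2) => d.
  by rewrite /lattice_term /= mul0r add0r.
have [M2 HM2] := asum_divisor p0 (cabs_qparam_lt1 hz).
have injc' (c : nat) : injective (fun d : nat => (c, d)) by move=> x y [].
have /choice [t Ht] : forall c : nat, exists s, hsum (fun r => divisor_term p (qparam z) (c, r)) s.
  by move=> c; apply: asum_hsum (asum_inj (@injc' c) HM2).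
have gp (c : nat) : g c.+1%:Z = lipschitz_cst h.*2 * t c.
  apply: (hsum_unique (Hg _)).
  have hcz : upper_half_plane (c.+1%:R * z).
    by rewrite /upper_half_plane /= cImM Im_nat Re_nat mul0r addr0 mulr_gt0.
  have ht : hsum (fun r => r%:R ^+ p * qparam (c.+1%:R * z) ^+ r) (t c).
    by apply: eq_hsum (Ht c) => r; rewrite qparamMn -exprM.
  rewrite /lipschitz_cst /lattice_term pE /=.
  by apply: eq_hsum (lipschitz p0 hcz ht) => d; rewrite -pmulrn.
rewrite -g0 -mulrA; apply/esym; apply: (hsum_int_even ge hgz).
apply: eq_hsum (hsumZ (lipschitz_cst h.*2) (hsum_fubini (HT z hz) Ht)) => c.
  by rewrite gp.
Qed.

End Eisenstein.

(** * Test forms *)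

Section TestForms.
Variable R : realType.
Implicit Types (z w q : R[i]) (f g : R[i] -> R[i]).

Lemma modularM K1 K2 f g : modular_of_weight K1 f -> modular_of_weight K2 g ->
  modular_of_weight (K1 + K2) (fun z => f z * g z).
Proof.
move=> hf hg a b c d det z hz; rewrite (hf a b c d) // (hg a b c d) // exprD; ring.
Qed.

Lemma modularZ K (k : R[i]) f : modular_of_weight K f -> modular_of_weight K (fun z => k * f z).
Proof. by move=> hf a b c d det z hz; rewrite (hf a b c d) // mulrCA. Qed.

Lemma modularD K f g : modular_of_weight K f -> modular_of_weight K g ->
  modular_of_weight K (fun z => f z + g z).
Proof. by move=> hf hg a b c d det z hz; rewrite (hf a b c d) // (hg a b c d) // mulrDr. Qed.

Lemma modularX K f n : modular_of_weight K f -> modular_of_weight (K * n) (fun z => f z ^+ n).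
Proof. by move=> hf a b c d det z hz; rewrite (hf a b c d) // exprMn exprM. Qed.

Definition eis1 h z : R[i] := (zeta2 R h)^-1 * eis h z.

Definition eis1_coef h n : R[i] := (zeta2 R h)^-1 *
  ((if n == 0%N then zeta2 R h else 0) + 2 * lipschitz_cst R h.*2 * sigma R h.*2.-1 n).

Lemma eis1_qseries h : (2 <= h)%N -> qseries (eis1_coef h) (eis1 h).
Proof. by move=> h2; apply/qseriesZ/eis_qseries. Qed.

Lemma eis1_modular h : (2 <= h)%N -> modular_of_weight h.*2 (eis1 h).
Proof. by move=> h2; apply/modularZ/eis_modular. Qed.

Lemma eis1_coef0 h : (2 <= h)%N -> eis1_coef h 0 = 1.
Proof.
by move=> h2; rewrite /eis1_coef /sigma big_ord0 mulr0 addr0 mulVf // zeta2_neq0.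
Qed.

Lemma eis1_coef1 h : (2 <= h)%N -> eis1_coef h 1 = 2 * lipschitz_cst R h.*2 / zeta2 R h.
Proof.
move=> h2; rewrite /eis1_coef /sigma big_ord1 /= add0r divn1 expr1n mulr1 mulrC //.
Qed.

Lemma cauchy_prod0 (a b : nat -> R[i]) : cauchy_prod a b 0 = a 0%N * b 0%N.
Proof. by rewrite /cauchy_prod big_ord1. Qed.

Lemma cauchy_prod1 (a b : nat -> R[i]) :
  cauchy_prod a b 1 = a 0%N * b 1%N + a 1%N * b 0%N.
Proof. by rewrite /cauchy_prod big_ord_recl big_ord1. Qed.

(** Delta is (E_4^3 - E_6^2)/c1. Signs show that c1 > 0: the coefficient of q is positive in E_4 and
    negative in E_6, since (-2 pi i)^4 > 0 > (-2 pi i)^6, and the two contributions 3 a_4(1) and -2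
    a_6(1) add up. *)
Lemma exists_delta : exists a f,
  [/\ qseries a f, modular_of_weight 12 f, a 0%N = 0 & a 1%N = 1].
Proof.
have [x2 hx2 x21] := zeta2_ge1 R (isT : (2 <= 2)%N).
have [x3 hx3 x31] := zeta2_ge1 R (isT : (2 <= 3)%N).
pose y : R := 2 * pi; have y0 : 0 < y by rewrite mulr_gt0 // pi_gt0.
have sq : (- Complex 0 y : R[i]) ^+ 2 = (- y ^+ 2)%:C.
  by apply: rect_eq; rewrite expr2 ?cReM ?cImM /=; ring.
have L4 : lipschitz_cst R 4 = (y ^+ 4 / 6)%:C.
  have -> : y ^+ 4 / 6 = (- y ^+ 2) ^+ 2 / 3`!%:R by rewrite sqrrN -exprM.
  by rewrite /lipschitz_cst -[4%N]/(2 * 2)%N exprM sq rmorphM /= fmorphV /= rmorphXn /= rmorph_nat.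
have L6 : lipschitz_cst R 6 = (- y ^+ 6 / 120)%:C.
  have -> : - y ^+ 6 / 120 = (- y ^+ 2) ^+ 3 / 5`!%:R by congr (_ / _); ring.
  by rewrite /lipschitz_cst -[6%N]/(2 * 3)%N exprM sq rmorphM /= fmorphV /= rmorphXn /= rmorph_nat.
have L6' : lipschitz_cst R 6 = - (y ^+ 6 / 120)%:C by rewrite L6 mulNr; exact: rmorphN.
pose c1 : R := 6 * (y ^+ 4 / 6) / x2 + 4 * (y ^+ 6 / 120) / x3.
have c10 : 0 < c1.
  have p4 : 0 < y ^+ 4 by rewrite exprn_gt0. have p6 : 0 < y ^+ 6 by rewrite exprn_gt0.
  by rewrite addr_gt0 // divr_gt0 //; lra.
have h2 : (2 <= 2)%N by []. have h3 : (2 <= 3)%N by [].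
have Q2 := eis1_qseries h2; have Q3 := eis1_qseries h3.
have M2 := eis1_modular h2; have M3 := eis1_modular h3.
pose b2 := cauchy_prod (eis1_coef 2) (cauchy_prod (eis1_coef 2) (eis1_coef 2)).
pose b3 := cauchy_prod (eis1_coef 3) (eis1_coef 3).
exists (fun k => c1%:C^-1 * (b2 k + (-1) * b3 k)).
exists (fun z => c1%:C^-1 * (eis1 2 z * (eis1 2 z * eis1 2 z) + (-1) * (eis1 3 z * eis1 3 z))).
split.
- apply: qseriesZ; apply: qseriesD; first exact: qseriesM (qseriesM _ _).
  by apply: qseriesZ; exact: qseriesM.
- apply: modularZ; apply: modularD.
    exact: (modularM M2 (modularM M2 M2)).
  by apply: modularZ; exact: (modularM M3 M3).
- rewrite /b2 /b3 /cauchy_prod !big_ord1 !eis1_coef0 //; ring.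
- have E2 : b2 1%N = 3 * eis1_coef 2 1.
    by rewrite /b2 !cauchy_prod1 !cauchy_prod0 !eis1_coef0 //; ring.
  have E3 : b3 1%N = 2 * eis1_coef 3 1.
    by rewrite /b3 !cauchy_prod1 !eis1_coef0 //; ring.
  rewrite E2 E3 !eis1_coef1 // L4 L6' hx2 hx3.
  have -> : 3 * (2 * (y ^+ 4 / 6)%:C / x2%:C) + -1 * (2 * (2 * (- (y ^+ 6 / 120)%:C) / x3%:C)) = c1%:C.
    have lift (A B u v : R) : (6 * A / u + 4 * B / v)%:C = 6 * A%:C / u%:C + 4 * B%:C / v%:C.
      by rewrite rmorphD !rmorphM /= !fmorphV /= !rmorph_nat.
    rewrite /c1 lift.
    move: (_%:C) (_%:C) (_%:C^-1) (_%:C^-1) => A B u v; ring.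
  by rewrite mulVf // -cabs_eq0 cabsC normr_eq0 gt_eqF.
Qed.

(** Beyond the linear term |q|^k <= |q|^2 r0^(k-2), where r0 is |q| at height y0; what remains is
    the convergent series at r0. *)
Lemma qseries_leading (a : nat -> R[i]) f (y0 : R) : 0 < y0 -> qseries a f ->
  a 0%N = 0 -> a 1%N = 1 ->
  exists2 C : R, 0 <= C & forall z, y0 <= complex.Im z ->
    cabs (f z - qparam z) <= C * cabs (qparam z) ^+ 2.
Proof.
move=> y00 [ab af] a0 a1.
pose r0 := expR (- (2 * pi * y0) : R).
have r00 : 0 < r0 := expR_gt0 _.
have r01 : r0 < 1 by rewrite -expR0 ltr_expR oppr_lt0 !mulr_gt0 ?pi_gt0.
have [M HM] := ab r0 (ltW r00) r01.
have M0 := asum_ge0 HM.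
exists (M / r0 ^+ 2) => [|z hy]; first by rewrite divr_ge0 ?sqr_ge0.
have hz : upper_half_plane z by rewrite /upper_half_plane /=; lra.
have qr : cabs (qparam z) <= r0.
  by rewrite cabs_qparam ler_expR lerN2 ler_wpM2l // mulr_ge0 // pi_ge0.
have h1 : hsum (fun k : nat => if k == 1%N then qparam z else 0) (qparam z).
  have := @hsum_fin R _ (fun k => if k == 1%N then qparam z else 0) [fset 1%N]%fset.
  by rewrite big_seq_fset1; apply => k; rewrite inE => /negPf ->.
have hs := hsumB (af z hz) h1.
have -> : M / r0 ^+ 2 * cabs (qparam z) ^+ 2 = cabs (((cabs (qparam z) / r0) ^+ 2)%:C : R[i]) * M.
  rewrite cabsC ger0_norm ?sqr_ge0 // exprMn exprVn; ring.
apply: (hsum_le hs); apply: le_asum (asumZ _ HM) => -[|[|k]].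
- by rewrite a0 mul0r subrr cabs0 cabs_ge0.
- by rewrite a1 mul1r expr1 subrr cabs0 cabs_ge0.
rewrite subr0 cabsM [leRHS]cabsM [cabs (a _ * _%:C ^+ _)]cabsM mulrCA ler_wpM2l ?cabs_ge0 //.
rewrite !cabsX !cabsC (ger0_norm (ltW r00)) ger0_norm ?sqr_ge0 //.
rewrite -addn2 !exprD mulrC exprMn exprVn.
have -> : cabs (qparam z) ^+ 2 * (r0 ^+ 2)^-1 * (r0 ^+ k * r0 ^+ 2) = cabs (qparam z) ^+ 2 * r0 ^+ k.
  by field; rewrite gt_eqF.
by rewrite ler_wpM2l ?sqr_ge0 // lerXn2r ?nnegrE ?cabs_ge0 ?(ltW r00).
Qed.

Lemma expr1D_bounded (j : nat) (B : R) : 0 <= B ->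
  exists2 C : R, 0 <= C & forall e : R[i], cabs e <= B ->
  cabs ((1 + e) ^+ j - 1) <= C * cabs e.
Proof.
move=> B0; elim: j => [|j [C C0 HC]].
  by exists 0 => // e _; rewrite expr0 subrr cabs0 mul0r.
exists ((1 + B) * C + 1) => [|e e1]; first by rewrite addr_ge0 // mulr_ge0 // addr_ge0.
have -> : (1 + e) ^+ j.+1 - 1 = (1 + e) * ((1 + e) ^+ j - 1) + e by rewrite exprS; ring.
apply: le_trans (cabsD _ _) _; rewrite cabsM.
have h1 : cabs (1 + e) <= 1 + B by have := cabsD 1 e; rewrite cabs1; lra.
have h2 := HC e e1.
have h3 : cabs (1 + e) * cabs ((1 + e) ^+ j - 1) <= (1 + B) * (C * cabs e).
  by rewrite ler_pM ?cabs_ge0.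
lra.
Qed.

(** In Delta^j E_(K-12j), [d1] is the relative error of Delta^j against q^j and [d2] that of the
    Eisenstein factor against 1. The constant is fixed before K, which enters only through the
    exponent of 1/Im z; this power is small for Im z > 1 but may reach D^K at height 1/D. *)
Lemma test_form (D j : nat) : (0 < D)%N -> (0 < j)%N ->
  exists2 C : R, 0 <= C & forall K : nat, ~~ odd K -> (12 * j + 4 <= K)%N ->
  exists f a, [/\ cusp_form K f, qseries a f &
    forall z, `|complex.Re z| <= 1 -> D%:R^-1 <= complex.Im z ->
      cabs (f z - qparam z ^+ j) <=
      C * cabs (qparam z) ^+ j * (cabs (qparam z) + (complex.Im z)^-1 ^+ (K - 12 * j - 4))].
Proof.
move=> D0 j0; have Dr0 : 0 < (D%:R : R) by rewrite ltr0n.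
have Di0 : 0 < (D%:R : R)^-1 by rewrite invr_gt0.
have [a [h [qa mh a0 a1]]] := exists_delta.
have [C1 C10 HC1] := qseries_leading Di0 qa a0 a1.
have [C2 C20 HC2] := expr1D_bounded j C10.
(* The constant of [eis_sub_zeta2], since [kappa z] <= 2 + 3 D^2 when |Re z| <= 1 and Im z >=
   1/D. *)
pose C3 : R := 3 * (2 + 3 * D%:R ^+ 2) ^+ 2 * 64.
have C30 : 0 <= C3 by rewrite /C3; have := sqr_ge0 (2 + 3 * D%:R ^+ 2 : R); lra.
pose C := C2 * C1 + C3 + C2 * C1 * C3.
exists C; first by rewrite /C !addr_ge0 // !mulr_ge0.
move=> K oK hK; pose h2 := ((K - 12 * j)./2)%N.
have KE : K = (12 * j + h2.*2)%N by rewrite /h2; lia.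
have hh2 : (2 <= h2)%N by rewrite /h2; lia.
have [b bf b0] := qseriesX j qa.
pose f0 z := h z ^+ j * eis1 h2 z.
(* Cusp forms are represented by their extension by zero, so the product is cut off outside the
   upper half-plane. *)
pose f z := if 0 < complex.Im z then f0 z else 0.
have ff0 z : upper_half_plane z -> f0 z = f z by rewrite /f /upper_half_plane /= => ->.
have q0 : qseries (cauchy_prod b (eis1_coef h2)) f0 by apply: qseriesM => //; exact: eis1_qseries.
have qf := qseries_eq ff0 q0.
have m0 : modular_of_weight K f0.
  by rewrite KE; apply: modularM (eis1_modular hh2); exact: modularX.
exists f, (cauchy_prod b (eis1_coef h2)); split => //.
- split.
  + exact: qseries_holomorphic qf.
  + move=> a' b' c d det z hz.
    rewrite -(ff0 z) // -(m0 a' b' c d) //; apply/esym/ff0.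
    have cd0 : (c, d) != (0, 0).
      by apply: contra_eq_neq det => -[-> ->]; rewrite !mulr0 subr0.
    have den := uhp_denominator hz cd0.
    set w := c%:~R * z + d%:~R in den *.
    rewrite /upper_half_plane /=.
    have -> : complex.Im ((a'%:~R * z + b'%:~R) / w) = complex.Im z / cabs w ^+ 2.
      have wc : w^-1 = (cabs w ^+ 2)^-1%:C * Complex (complex.Re w) (- complex.Im w).
        apply: (mulfI den); rewrite mulfV // mulrCA.
        have -> : w * Complex (complex.Re w) (- complex.Im w) = (cabs w ^+ 2)%:C.
          by rewrite cabs_sqr; apply: rect_eq; rewrite ?cReM ?cImM /=; ring.
        by rewrite -rmorphM /= mulVf // expf_neq0 // cabs_eq0.
      rewrite wc mulrCA cImM /= mul0r addr0 [RHS]mulrC; congr (_ * _).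
      rewrite cImM !cReD !cImD !cReM !cImM !Re_int !Im_int /=.
      move: (complex.Re z) (complex.Im z) => x y.
      have det' : a'%:~R * d%:~R - b'%:~R * c%:~R = 1 :> R by rewrite -!intrM -intrB det.
      transitivity ((a'%:~R * d%:~R - b'%:~R * c%:~R) * y : R); last by rewrite det' mul1r.
      ring.
    by rewrite divr_gt0 // exprn_gt0 // cabs_gt0.
  + exists (cauchy_prod b (eis1_coef h2)); first exact: qseries_q_expansion.
    by rewrite /cauchy_prod big_ord1 b0 // mul0r.
  + by move=> z /negP hz; rewrite /f (negPf hz).
move=> z hx hy.
have hz : upper_half_plane z by rewrite /upper_half_plane /=; apply: lt_le_trans hy.
have y0 : 0 < complex.Im z by [].
rewrite -ff0 // /f0.
have qn := qparam_neq0 z; set q := qparam z in qn *.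
have cq0 : 0 < cabs q by rewrite cabs_gt0.
have cq1 : cabs q < 1 by apply: cabs_qparam_lt1.
pose e1 := (h z - q) / q.
have e1q : cabs e1 <= C1 * cabs q.
  by rewrite cabsM cabsV ler_pdivrMr // -mulrA -expr2; apply: HC1.
have e1b : cabs e1 <= C1 by apply: le_trans e1q _; rewrite ler_piMr // ltW.
have hE : h z = q * (1 + e1) by rewrite /e1; field.
pose d1 := (1 + e1) ^+ j - 1.
have d1q : cabs d1 <= C2 * C1 * cabs q.
  by rewrite -mulrA; apply: le_trans (HC2 _ e1b) _; rewrite ler_wpM2l.
pose d2 := eis1 h2 z - 1.
pose Y := (complex.Im z)^-1 ^+ (K - 12 * j - 4).
have Y0 : 0 <= Y by rewrite exprn_ge0 // invr_ge0 ltW.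
have d2Y : cabs d2 <= C3 * Y.
  have zn := zeta2_neq0 R hh2.
  have -> : d2 = (zeta2 R h2)^-1 * (eis h2 z - zeta2 R h2) by rewrite mulrBr mulVf.
  have [x hx1 x1] := zeta2_ge1 R hh2.
  have zi : cabs (zeta2 R h2)^-1 <= 1.
    by rewrite cabsV hx1 cabsC ger0_norm ?invf_le1 //; lra.
  rewrite cabsM; apply: le_trans (ler_piMl (cabs_ge0 _) zi) _.
  apply: le_trans (eis_sub_zeta2 hh2 hz) _.
  have -> : (h2.*2 - 4 = K - 12 * j - 4)%N by rewrite {1}KE addKn.
  rewrite -/Y mulrC [leRHS]mulrC mulrCA ler_wpM2l // /C3.
  rewrite mulrC ler_wpM2r // ler_wpM2l // lerXn2r ?nnegrE ?(ltW (kappa_gt0 hz)) //.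
  rewrite /kappa lerD2l ler_pdivrMr ?exprn_gt0 //.
  have x2 : complex.Re z ^+ 2 <= 1 by rewrite -real_normK ?num_real // expr_le1.
  have : 1 <= (D%:R * complex.Im z) ^+ 2.
    by rewrite expr_ge1 // ?mulr_ge0 ?(ltW Dr0) ?(ltW y0) // -ler_pdivrMl // mulr1.
  rewrite exprMn; nra.
have -> : h z ^+ j * eis1 h2 z - q ^+ j = q ^+ j * (d1 + d2 + d1 * d2).
  by rewrite hE exprMn /d1 /d2; ring.
rewrite cabsM cabsX [C * _]mulrC -[leRHS]mulrA ler_wpM2l ?exprn_ge0 ?cabs_ge0 //.
apply: le_trans (cabsD _ _) _; apply: le_trans (lerD (cabsD _ _) (lexx _)) _; rewrite cabsM.
have d12 : cabs d1 * cabs d2 <= C2 * C1 * 1 * (C3 * Y).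
  apply: ler_pM; rewrite ?cabs_ge0 //; apply: le_trans d1q _.
  by rewrite ler_wpM2l ?mulr_ge0 // ltW.
rewrite -/Y /C.
have p1 : 0 <= C3 * cabs q by rewrite mulr_ge0 // ltW.
have p2 : 0 <= C2 * C1 * C3 * cabs q by rewrite !mulr_ge0 // ltW.
have p3 : 0 <= C2 * C1 * Y by rewrite !mulr_ge0.
lra.
Qed.

End TestForms.

(** * Primitive characters and cusps *)

Section Characters.
Variables (R : realType) (D : nat) (chi : int -> R[i]).
Hypothesis D_gt0 : (0 < D)%N.
Hypothesis chi_prim : primitive_character D chi.

Let chi_dir : dirichlet_character D chi. Proof. by case: chi_prim. Qed.

Lemma dvdz_oppr (d m : int) : (d %| - m)%Z = (d %| m)%Z.
Proof. by rewrite !dvdzE abszN. Qed.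

Lemma dvdz_addm (d m n : int) : (d %| m)%Z -> (d %| n)%Z -> (d %| m + n)%Z.
Proof.
by move=> /dvdzP[a ->] /dvdzP[b ->]; apply/dvdzP; exists (a + b); rewrite mulrDl.
Qed.

Lemma dvdz_subm (d m n : int) : (d %| m)%Z -> (d %| n)%Z -> (d %| m - n)%Z.
Proof. by move=> dm dn; apply: dvdz_addm; rewrite ?dvdz_oppr. Qed.

Lemma dchar_addM a (k : int) : chi (a + k * D%:Z) = chi a.
Proof.
have per := dchar_periodic chi_dir.
have pos (n : nat) b : chi (b + n%:Z * D%:Z) = chi b.
  elim: n b => [|n IH] b; first by rewrite mul0r addr0.
  by rewrite -addn1 PoszD mulrDl mul1r addrA per IH.
case: k => n; first exact: pos.
by rewrite -[LHS](pos n.+1) NegzE; congr chi; ring.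
Qed.

Lemma dchar_mod a b : (D%:Z %| a - b)%Z -> chi a = chi b.
Proof. by move=> /dvdzP[k E]; rewrite -(dchar_addM b k) -E addrC subrK. Qed.

Lemma dchar1 : chi 1 = 1.
Proof.
have h := dcharM chi_dir 1 1; have n0 : chi 1 != 0 by rewrite (dchar_neq0 chi_dir) /coprimez gcd1z.
by apply: (mulfI n0); rewrite -h !mulr1.
Qed.

Lemma dcharX a n : chi (a ^+ n) = chi a ^+ n.
Proof. by elim: n => [|n IH]; rewrite ?expr0 ?dchar1 // !exprS (dcharM chi_dir) IH. Qed.

(** By Euler's theorem the values at units are roots of unity. *)
Lemma cabs_dchar a : coprimez a D%:Z -> cabs (chi a) = 1.
Proof.
move=> aD; pose b := `|(a %% D%:Z)%Z|%N.
have Dn0 : D%:Z != 0 by rewrite eqz_nat -lt0n.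
have bE : b%:Z = (a %% D%:Z)%Z by rewrite /b gez0_abs // modz_ge0.
have ab : chi a = chi b%:Z.
  by rewrite bE; apply: dchar_mod; rewrite -eqz_mod_dvd modz_mod.
have bD : coprime b D.
  by move: aD; rewrite /coprimez -gcdz_modl -bE.
have h := cyclic.Euler_exp_totient bD.
have : chi (b%:Z ^+ totient D) = 1.
  rewrite -dchar1; apply: dchar_mod; rewrite -eqz_mod_dvd.
  have -> : b%:Z ^+ totient D = (b ^ totient D)%N%:Z by rewrite -!natz natrX.
  by rewrite -[X in _ == X %[mod _]%Z]/(1%N%:Z) !modz_nat h.
rewrite dcharX -ab => /(congr1 (@cabs R)); rewrite cabsX cabs1 => /eqP.
by rewrite pexpr_eq1 ?cabs_ge0 ?totient_gt0 // => /eqP.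
Qed.

Definition eD (x : int) : R[i] := qparam (x%:~R / D%:R).

Let Dn0 : (D%:R : R[i]) != 0. Proof. by rewrite pnatr_eq0 -lt0n. Qed.

Lemma eDD x y : eD (x + y) = eD x * eD y.
Proof. by rewrite /eD rmorphD /= mulrDl qparamD. Qed.

Lemma eD_mod x y : (D%:Z %| x - y)%Z -> eD x = eD y.
Proof.
move=> /dvdzP[k E]; have -> : x = y + k * D%:Z by rewrite -E addrC subrK.
rewrite eDD /eD rmorphM /= -[D%:Z%:~R]/(D%:R) mulfK //.
by rewrite qparam_int mulr1.
Qed.

Lemma eD_natM (x n : nat) : eD (x%:Z * n%:Z) = (qparam (D%:R^-1 : R[i]) ^+ x) ^+ n.
Proof.
by rewrite -exprM -qparamMn /eD; congr qparam; rewrite -PoszM -pmulrn.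
Qed.

Lemma cabs_eD x : cabs (eD x) = 1.
Proof.
rewrite cabs_qparam; have -> : complex.Im (x%:~R / D%:R : R[i]) = 0.
  rewrite natV_rc -(rmorph_int (real_complex R)) -rmorphM //.
by rewrite mulr0 oppr0 expR0.
Qed.

Lemma ord_modI (i j : 'I_D) : (D%:Z %| i%:Z - j%:Z)%Z -> i = j.
Proof.
move=> /dvdzP[k]; have := ltn_ord i; have := ltn_ord j => jD iD E; apply: val_inj => /=.
move: (nat_of_ord i) (nat_of_ord j) iD jD E => a b aD bD E.
have k1 : k < 1 by nia.
have k2 : -1 < k by nia.
have k0 : k = 0 by lia.
by move: E; rewrite k0; lia.
Qed.

Lemma sum_mul_unit (F : int -> R[i]) (v : int) : coprimez v D%:Z ->
  (forall x y, (D%:Z %| x - y)%Z -> F x = F y) ->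
  \sum_(i < D) F i = \sum_(i < D) F (v * i%:Z).
Proof.
move=> vD Fm; have Dz0 : D%:Z != 0 by rewrite eqz_nat -lt0n.
have bd (i : 'I_D) : (`|(v * i%:Z %% D%:Z)%Z| < D)%N.
  by rewrite -ltz_nat gez0_abs ?modz_ge0 // ltz_pmod // ltz_nat.
pose h (i : 'I_D) := Ordinal (bd i).
have hE i : (h i : nat)%:Z = (v * i%:Z %% D%:Z)%Z by rewrite /h /= gez0_abs ?modz_ge0.
have hinj : injective h.
  move=> i j /(congr1 (fun k : 'I_D => (k : nat)%:Z)); rewrite !hE => /eqP.
  rewrite eqz_mod_dvd -mulrBr Gauss_dvdzr; last by rewrite coprimez_sym.
  exact: ord_modI.
rewrite (reindex_inj hinj) /=; apply: eq_bigr => i _; apply: Fm.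
by rewrite -/(h i : nat) -[X in Posz X]/(h i : nat) hE -eqz_mod_dvd modz_mod.
Qed.

(* The finite Fourier transform of chi: its support is the set of units
   because chi is primitive. *)
Definition chat (a : int) : R[i] := D%:R^-1 * \sum_(n < D) chi n * eD (- (n%:Z * a)).

Lemma chat_mul (b v a : int) : coprimez v D%:Z -> (D%:Z %| v * b - a)%Z ->
  chat b = chi v * chat a.
Proof.
move=> vD dv; rewrite /chat (@sum_mul_unit (fun n => chi n * eD (- (n * b))) v vD); last first.
  move=> x y xy; congr (_ * _); first exact: dchar_mod.
  apply: eD_mod; have -> : - (x * b) - - (y * b) = - ((x - y) * b) by ring.
  by rewrite dvdz_oppr dvdz_mulr.
rewrite mulrCA; congr (_ * _); rewrite mulr_sumr; apply: eq_bigr => i _.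
rewrite (dcharM chi_dir) mulrA; congr (_ * _); apply: eD_mod.
rewrite opprK addrC; have -> : i%:Z * a - v * i%:Z * b = - (i%:Z * (v * b - a)) by ring.
by rewrite dvdz_oppr dvdz_mull.
Qed.

(** With g = gcd(a, D) > 1, primitivity yields a unit b = 1 mod D/g with chi b <> 1. Then ba = a mod
    D, and [chat_mul] gives chat a = chi b chat a. *)
Lemma chat_nonunit (a : int) : ~~ coprimez a D%:Z -> chat a = 0.
Proof.
move=> aD; pose g := gcdn `|a| D; pose d := (D %/ g)%N.
have gD : (g %| D)%N by apply: dvdn_gcdr.
have g0 : (0 < g)%N by rewrite gcdn_gt0 D_gt0 orbT.
have g1 : (1 < g)%N.
  rewrite ltn_neqAle g0 andbT eq_sym; apply: contra aD => /eqP g1.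
  by rewrite /coprimez /gcdz /= -/g g1.
have dD : (d %| D)%N by apply: dvdn_div.
have dlt : (d < D)%N by rewrite ltn_Pdiv.
have [b [bD b1 chib]] := chi_prim.2 d dD dlt.
have h : chat a = chi b * chat a.
  apply: chat_mul => //; have -> : b * a - a = (b - 1) * a by ring.
  have -> : D%:Z = d%:Z * g%:Z by rewrite -PoszM divnK.
  apply: dvdz_mul; last by rewrite dvdzE /= dvdn_gcdl.
  by rewrite -eqz_mod_dvd; apply/eqP.
have : (1 - chi b) * chat a = 0 by rewrite mulrBl mul1r -h subrr.
move/eqP; rewrite mulf_eq0 subr_eq0 => /orP[/eqP b1'|/eqP //].
by case: chib.
Qed.

Lemma dchar_inversion (n : nat) : chi n%:Z = \sum_(a < D) chat a * eD (n%:Z * a%:Z).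
Proof.
(* D - m stands for -m, so that the exponent of the root of unity is a natural number. *)
have E (a : 'I_D) : chat a * eD (n%:Z * a%:Z) =
   \sum_(m < D) D%:R^-1 * (chi m * (qparam (D%:R^-1 : R[i]) ^+ (n + (D - m))) ^+ a).
  rewrite /chat mulrAC -mulrA mulr_sumr mulr_sumr; apply: eq_bigr => m _.
  have -> : (qparam (D%:R^-1 : R[i]) ^+ (n + (D - m))) ^+ a = eD (n%:Z * a%:Z) * eD (- (m%:Z * a%:Z)).
    rewrite -eD_natM -eDD; apply: eD_mod.
    have mD : (m <= D)%N by apply: ltnW.
    rewrite PoszD -subzn //.
    have -> : (n%:Z + (D%:Z - m%:Z)) * a%:Z - (n%:Z * a%:Z - m%:Z * a%:Z) = D%:Z * a%:Z by ring.
    by rewrite dvdz_mulr.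
  by ring.
under eq_bigr do rewrite E.
rewrite exchange_big /=.
have mn : (n %% D < D)%N by rewrite ltn_mod.
rewrite (bigD1 (Ordinal mn)) //= [X in _ + X]big1 ?addr0 => [|m mne].
  rewrite -!mulr_sumr root_of_unity_sum //.
  have -> : (D %| n + (D - n %% D))%N.
    rewrite {1}(divn_eq n D) -addnA subnKC; last by rewrite ltnW.
    by rewrite dvdn_add // dvdn_mull.
  rewrite mulrCA mulVf // mulr1; apply: dchar_mod.
  by rewrite -eqz_mod_dvd !modz_nat modn_mod.
rewrite -!mulr_sumr root_of_unity_sum //; case: ifPn => [dv|]; last by rewrite !mulr0.
case/eqP: mne; apply: ord_modI => /=.
have mD : (m <= D)%N by apply: ltnW.
have : (D%:Z %| n%:Z + (D%:Z - m%:Z))%Z by rewrite subzn // -PoszD dvdzE.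
have -> : m%:Z - (n %% D)%N%:Z = - (n%:Z + (D%:Z - m%:Z)) + (n%:Z - (n %% D)%N%:Z) + D%:Z by ring.
move=> h; apply: dvdz_addm; last exact: dvdzz.
apply: dvdz_addm; first by rewrite dvdz_oppr.
by rewrite -eqz_mod_dvd !modz_nat modn_mod.
Qed.

Lemma unit_inverse (a : int) : coprimez a D%:Z ->
  exists2 v : int, coprimez v D%:Z & (D%:Z %| v * a - 1)%Z.
Proof.
move=> /coprimezP[[v k] /= E]; exists v.
  by apply/coprimezP; exists (a, k) => /=; rewrite mulrC.
by apply/dvdzP; exists (- k); rewrite -E; ring.
Qed.

Lemma cabs_chat_unit (a : int) : coprimez a D%:Z -> cabs (chat a) = cabs (chat 1).
Proof.
move=> /unit_inverse[v vD va]; rewrite (chat_mul vD va) cabsM cabs_dchar //.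
by rewrite mul1r.
Qed.

Lemma cabs_chat_le (a : int) : cabs (chat a) <= cabs (chat 1).
Proof.
have [aD|aD] := boolP (coprimez a D%:Z); first by rewrite cabs_chat_unit.
by rewrite chat_nonunit // cabs0 cabs_ge0.
Qed.

(** Fourier inversion at n = 1: a sum of D terms, each of modulus at most |chat 1|, equals chi 1 =
    1. This is the nonvanishing of the Gauss sum in quantitative form. *)
Lemma cabs_chat1_ge : 1 <= D%:R * cabs (chat 1).
Proof.
have h := congr1 (@cabs R) (dchar_inversion 1); rewrite dchar1 cabs1 in h.
rewrite [leLHS]h {h}.
apply: le_trans (cabs_sum _ _ _) _.
apply: (@le_trans _ _ (\sum_(a < D) cabs (chat 1))).
  by apply: ler_sum => a _; rewrite cabsM cabs_eD mulr1 cabs_chat_le.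
by rewrite sumr_const card_ord mulr_natl.
Qed.

(** On units [u] is a -> -1/a mod D: SL_2(Z) takes the cusp a/D to infinity and the translate by a/D
    to the translate by u(a)/D. Fixing the non-units makes [u] an involution of all residues,
    available for reindexing. *)
Lemma neg_inverse : exists u : 'I_D -> 'I_D, [/\ involutive u,
  forall a : 'I_D, coprimez a D%:Z -> (D%:Z %| a%:Z * (u a)%:Z + 1)%Z &
  forall a : 'I_D, ~~ coprimez a D%:Z -> u a = a].
Proof.
have Dz0 : D%:Z != 0 by rewrite eqz_nat -lt0n.
have /choice [u Hu] : forall a : 'I_D, exists u : 'I_D,
    if coprimez a D%:Z then (D%:Z %| a%:Z * u%:Z + 1)%Z else u == a.
  move=> a; case: (boolP (coprimez a D%:Z)) => [/unit_inverse[v _ va]|_]; last by exists a.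
  have bd : (`|(- v %% D%:Z)%Z| < D)%N.
    by rewrite -ltz_nat gez0_abs ?modz_ge0 // ltz_pmod // ltz_nat.
  exists (Ordinal bd); rewrite /= gez0_abs ?modz_ge0 //.
  have -> : a%:Z * (- v %% D%:Z)%Z + 1 = a%:Z * ((- v %% D%:Z)%Z - (- v)) - (v * a%:Z - 1) by ring.
  apply: dvdz_subm => //; rewrite dvdz_mull // -eqz_mod_dvd; apply/eqP; exact: modz_mod.
have u1 (a : 'I_D) : coprimez a D%:Z -> (D%:Z %| a%:Z * (u a)%:Z + 1)%Z.
  by move=> h; have := Hu a; rewrite h.
have u2 (a : 'I_D) : ~~ coprimez a D%:Z -> u a = a.
  by move=> h; have := Hu a; rewrite (negPf h) => /eqP.
have u3 (a : 'I_D) : coprimez a D%:Z -> coprimez (u a) D%:Z.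
  move=> /u1/dvdzP[k E]; apply/coprimezP; exists (- a%:Z, k) => /=.
  by rewrite -E; ring.
exists u; split => // a.
have [aD|aD] := boolP (coprimez a D%:Z); last by rewrite !u2.
apply: ord_modI; rewrite -(@Gauss_dvdzr _ (u a)%:Z); last by rewrite coprimez_sym u3.
have -> : (u a)%:Z * ((u (u a))%:Z - a%:Z) =
   ((u a)%:Z * (u (u a))%:Z + 1) - (a%:Z * (u a)%:Z + 1) by ring.
by apply: dvdz_subm; rewrite ?u1 ?u3.
Qed.

(** Reindex by [u]. For a unit a, (-a) u(a) = 1 mod D, so chat(u a) = chi(-a) chat 1, and the sum
    becomes chat 1 chi(-1) times the Gauss sum D chat(-1). *)
Lemma gauss_sum_abs (u : 'I_D -> 'I_D) : involutive u ->
  (forall a : 'I_D, coprimez a D%:Z -> (D%:Z %| a%:Z * (u a)%:Z + 1)%Z) ->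
  (forall a : 'I_D, ~~ coprimez a D%:Z -> u a = a) ->
  cabs (\sum_(a < D) chat a * eD (u a)) = D%:R * cabs (chat 1) ^+ 2.
Proof.
move=> uK u1 u2.
have N1 : coprimez (-1) D%:Z by rewrite /coprimez gcdNz gcd1z.
have -> : \sum_(a < D) chat a * eD (u a) = chat 1 * (chi (-1) * (D%:R * chat (-1))).
  rewrite (reindex_inj (inv_inj uK)) /=.
  have -> : D%:R * chat (-1) = \sum_(n < D) chi n * eD (- (n%:Z * -1)) by rewrite /chat mulVKf.
  rewrite !mulr_sumr; apply: eq_bigr => a _.
  rewrite uK mulrN1 opprK [chi _ * (_ * _)]mulrA -(dcharM chi_dir) mulrA; congr (_ * _).
  have [aD|aD] := boolP (coprimez a D%:Z).
    rewrite mulrC mulN1r; apply: chat_mul.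
      by rewrite /coprimez gcdNz.
    have -> : - a%:Z * (u a)%:Z - 1 = - (a%:Z * (u a)%:Z + 1) by ring.
    by rewrite dvdz_oppr u1.
  rewrite u2 // chat_nonunit // (dcharM chi_dir).
  have -> : chi a = 0 by apply/eqP; rewrite -[_ == _]negbK (dchar_neq0 chi_dir).
  by rewrite !mulr0.
move: (cabs_chat_unit N1); move: (chat (-1)) (chat 1) => x y xy.
rewrite !cabsM cabs_nat cabs_dchar // xy; ring.
Qed.

Lemma uhp_shift (z : R[i]) (a : nat) : upper_half_plane z ->
  upper_half_plane (z + a%:R / D%:R).
Proof.
by move=> hz; rewrite /upper_half_plane /= cImD natV_rc cImM /= mulr0 Im_nat mul0r !addr0.
Qed.

(** Insert the finite Fourier expansion of chi: the factor e(ka/D) turns q^k at z into q^k at z +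
    a/D. *)
Lemma twist_hsum (A : nat -> R[i]) f z : qseries A f -> upper_half_plane z ->
  hsum (fun k => chi k%:Z * A k * qparam z ^+ k) (\sum_(a < D) chat a * f (z + a%:R / D%:R)).
Proof.
move=> qf hz.
have h := hsum_sum (index_enum 'I_D) (fun a : 'I_D => hsumZ (chat a) (qf.2 _ (uhp_shift a hz))).
apply: eq_hsum h => k; rewrite dchar_inversion !mulr_suml; apply: eq_bigr => a _.
have -> : qparam (z + a%:R / D%:R) ^+ k = eD (k%:Z * a%:Z) * qparam z ^+ k.
  rewrite qparamD exprMn mulrC; congr (_ * _); rewrite -qparamMn /eD; congr qparam.
  by rewrite rmorphM /= -!pmulrn mulrA.
by move: (chat a) => x; ring.
Qed.

(** [twist] starts at index 1 and the q-series at 0; [A 0 = 0] reconciles them, also when D = 1,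
    where chi 0 is not zero. *)
Lemma twist_sum (A : nat -> R[i]) f z : qseries A f -> A 0%N = 0 -> upper_half_plane z ->
  twist chi f z = \sum_(a < D) chat a * f (z + a%:R / D%:R).
Proof.
move=> qf A0 hz; rewrite /twist (fourier_coefE qf).
apply: (@cvg_lim R[i]^o (@norm_hausdorff _ R[i]^o)).
apply: cvgC_eps => e e0; have [N0 HN] := hsum_nat (twist_hsum qf hz) e0.
exists N0.+1 => -[//|N] hN; have := HN N.+1 (leq_trans (leqnSn _) hN).
by rewrite big_nat_recl // A0 mulr0 mul0r add0r big_add1.
Qed.

Lemma modular_cusp (K : nat) f (a u : int) (t : R) : 0 < t -> modular_of_weight K f ->
  (D%:Z %| a * u + 1)%Z ->
  f (Complex 0 t + a%:~R / D%:R) =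
  (Complex 0 (D%:R * t))^-1 ^+ K * f (Complex 0 (D%:R ^+ 2 * t)^-1 + u%:~R / D%:R).
Proof.
move=> t0 mf /dvdzP[k E].
have Dr0 : 0 < (D%:R : R) by rewrite ltr0n.
have itn : (Complex 0 t : R[i]) != 0 by rewrite eq_complex /= eqxx gt_eqF.
(* The matrix has rows (u, -k) and (D, -a), where au + 1 = kD; at z = it + a/D its denominator Dz -
   a is iDt. *)
have det : u * - a - (- k) * D%:Z = 1 by rewrite mulNr opprK -E; ring.
have hz : upper_half_plane (Complex 0 t + a%:~R / D%:R).
  by rewrite /upper_half_plane /= cImD natV_rc cImM /= mulr0 Im_int mul0r !addr0.
have := mf _ _ _ _ det _ hz.
have i2 : (Complex 0 1 : R[i]) ^+ 2 = -1 by apply: rect_eq; rewrite expr2 ?cReM ?cImM /=; ring.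
have in0 : (Complex 0 1 : R[i]) != 0 by rewrite eq_complex /= eqxx oner_eq0.
have cI (x : R) : Complex 0 x = Complex 0 1 * x%:C by apply: rect_eq; rewrite ?cReM ?cImM /=; ring.
have tn : t%:C != 0 :> R[i] by rewrite -cabs_eq0 cabsC normr_eq0 gt_eqF.
have -> : D%:Z%:~R * (Complex 0 t + a%:~R / D%:R) + (- a)%:~R = Complex 0 (D%:R * t).
  rewrite -[D%:Z%:~R]/(D%:R) mulrDr mulrCA mulfV // mulr1 rmorphN /= addrK.
  by rewrite cI [RHS]cI rmorphM /= rmorph_nat; ring.
have Dtn : (Complex 0 (D%:R * t) : R[i]) != 0.
  by rewrite eq_complex /= eqxx mulf_eq0 !gt_eqF.
have -> : (u%:~R * (Complex 0 t + a%:~R / D%:R) + (- k)%:~R) / Complex 0 (D%:R * t) =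
   Complex 0 (D%:R ^+ 2 * t)^-1 + u%:~R / D%:R.
  have kE : k%:~R * D%:R = a%:~R * u%:~R + 1 :> R[i].
    by rewrite -[D%:R]/(D%:Z%:~R) -rmorphM /= -E rmorphD rmorphM.
  have -> : (- k)%:~R = - ((a%:~R * u%:~R + 1) / D%:R) :> R[i] by rewrite -kE mulfK // rmorphN.
  rewrite (cI t) (cI (D%:R * t)) (cI (D%:R ^+ 2 * t)^-1).
  have -> : (D%:R * t)%:C = D%:R * t%:C :> R[i] by rewrite rmorphM /= rmorph_nat.
  have -> : (D%:R ^+ 2 * t)^-1%:C = (D%:R * D%:R * t%:C)^-1 :> R[i].
    by rewrite fmorphV /= expr2 !rmorphM /= rmorph_nat.
  (* The imaginary unit becomes a variable; after multiplication by D i t the identity uses i^2 = -1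
     exactly once. *)
  move: (Complex 0 1) i2 in0 => i i2 in0; move: (t%:C) tn (D%:R : R[i]) Dn0 => x xn N Nn.
  move: (a%:~R) (u%:~R) => a' u'.
  apply: (mulIf (mulf_neq0 (mulf_neq0 Nn in0) xn)).
  transitivity (u' * i * x - N^-1); first by field; rewrite Nn in0 xn.
  transitivity (u' * i * x + i ^+ 2 / N); first by rewrite i2 mulN1r.
  by field; rewrite Nn xn.
by move=> ->; rewrite mulrA -exprMn mulVf // expr1n mul1r.
Qed.

End Characters.

(** * Gamma integrals *)

Section GammaIntegrals.
Variable R : realType.
Local Notation mu := (@lebesgue_measure R).
Implicit Types (b t u : R).
Local Open Scope classical_set_scope.

(** At 0 only right-hand limits are assumed: t^-n exp(-b/t), with value 0 at 0, is continuous there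
    from the right only. *)
Lemma ftc_oy (f F : R -> R) (l : R) :
  (forall x : R, 0 <= x -> 0 <= f x) ->
  (forall x : R, 0 < x -> is_derive x 1 F (f x)) ->
  (forall x : R, 0 < x -> {for x, continuous f}) ->
  f x @[x --> 0^'+] --> f 0 -> F x @[x --> 0^'+] --> F 0 ->
  F x @[x --> +oo%R] --> l ->
  mu.-integrable `]0, +oo[ (EFin \o f) /\
  Rintegral mu `]0, +oo[ f = l - F 0.
Proof.
move=> f0 dF cf lf lF lFy.
have cw : {within `[0, +oo[, continuous f}.
  by apply/continuous_within_itvcyP; split => // x; rewrite in_itv /= andbT; exact: cf.
have dF' : {in `]0, +oo[%R, F^`() =1 f}.
  move=> x; rewrite in_itv /= andbT => x0; rewrite derive1E.
  exact: (@derive_val _ _ _ _ _ _ _ (dF x x0)).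
have E := ge0_continuous_FTC2y f0 cw lFy (fun x x0 => @ex_derive _ _ _ _ _ _ _ (dF x x0)) lF dF'.
have mf : measurable_fun (`[0, +oo[ : set R) f.
  exact: subspace_continuous_measurable_fun.
have int0 : mu.-integrable `[0, +oo[ (EFin \o f).
  apply/integrableP; split; first exact/measurable_EFinP.
  have -> : (\int[mu]_(x in `[0%R, +oo[) `|(EFin \o f) x| = \int[mu]_(x in `[0%R, +oo[) (f x)%:E)%E.
    apply: eq_integral => x; rewrite inE /= in_itv /= andbT => x0.
    by rewrite ger0_norm // f0.
  by rewrite E -EFinB ltry.
have int1 : mu.-integrable `]0, +oo[ (EFin \o f).
  apply: integrableS int0 => //; apply: subset_itvr; by rewrite bnd_simp.
split => //; rewrite Rintegral_itv_obnd_cbnd // /Rintegral E.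
by [].
Qed.

(** Keep the single term (bu)^(n+1)/(n+1)! of the series of e^(bu). *)
Lemma pow_exp_le b n u : 0 < b -> 0 < u ->
  u ^+ n * expR (- (b * u)) <= n.+1`!%:R / b ^+ n.+1 / u.
Proof.
move=> b0 u0; have bu0 : 0 <= b * u by rewrite mulr_ge0 ?ltW.
have := expR_ge1Dxn n bu0; rewrite expRN => h.
have e0 := expR_gt0 (b * u).
rewrite ler_pdivlMr // mulrAC -exprSr ler_pdivrMr // mulrAC ler_pdivlMr ?exprn_gt0 //.
rewrite -exprMn [u * b]mulrC mulrC -ler_pdivrMl ?ltr0n ?fact_gt0 // mulrC.
by rewrite [leLHS]mulrC (le_trans _ h) // lerDr.
Qed.

(** The antiderivative of t^n exp(-bt) that tends to 0 at infinity, for b > 0, by repeated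
    integration by parts. *)
Fixpoint gamma_prim b n t : R := if n is m.+1 then
  - (t ^+ n * expR (- (b * t))) / b + n%:R / b * gamma_prim b m t
  else - expR (- (b * t)) / b.

Lemma is_derive_expNM b t :
  is_derive t 1 (fun t : R => expR (- (b * t))) (- b * expR (- (b * t))).
Proof.
have h1 : is_derive t 1 (fun t : R => - (b * t)) (- b).
  have h := is_deriveN (is_deriveZ b (is_derive_id t 1)).
  by apply: (@is_derive_eq _ _ _ _ _ _ _ _ h); rewrite /GRing.scale /= mulr1.
have h := @is_derive1_comp _ expR (fun t : R => - (b * t)) t _ _ (is_derive_expR _) h1.
by apply: (@is_derive_eq _ _ _ _ _ _ _ _ h); rewrite mulrC.
Qed.

Lemma is_derive_pow n t : is_derive t 1 (fun t : R => t ^+ n) (n%:R * t ^+ n.-1).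
Proof.
elim: n => [|n IH].
  have h := is_derive_cst (1 : R) t 1.
  by apply: (@is_derive_eq _ _ _ _ _ _ _ _ h); rewrite mul0r.
have h := is_deriveM (is_derive_id t 1) IH.
have -> : (fun t : R => t ^+ n.+1) = (fun t => t) * (fun t => t ^+ n).
  by apply/funext => x; rewrite exprS.
apply: (@is_derive_eq _ _ _ _ _ _ _ _ h); rewrite /GRing.scale /= mulr1.
by case: n {IH h} => [|n] /=; rewrite ?mul0r ?mulr0 ?add0r ?expr0 ?mulr1 // exprS -[n.+2]addn1 natrD; ring.
Qed.

Lemma is_derive_powexp b n t : is_derive t 1 (fun t : R => t ^+ n * expR (- (b * t)))
  (n%:R * t ^+ n.-1 * expR (- (b * t)) - b * (t ^+ n * expR (- (b * t)))).
Proof.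
have h := is_deriveM (is_derive_pow n t) (is_derive_expNM b t).
by apply: (@is_derive_eq _ _ _ _ _ _ _ _ h); rewrite /GRing.scale /=; ring.
Qed.

Lemma is_derive_gamma_prim b n t : b != 0 ->
  is_derive t 1 (gamma_prim b n) (t ^+ n * expR (- (b * t))).
Proof.
move=> b0; elim: n => [|n IH] /=.
  have h := is_deriveZ (- b^-1) (is_derive_expNM b t).
  have -> : (fun t : R => - expR (- (b * t)) / b) = (- b^-1) *: (fun t : R => expR (- (b * t))).
    by apply/funext => x; change (- expR (- (b * x)) / b = - b^-1 * expR (- (b * x))); ring.
  by apply: (@is_derive_eq _ _ _ _ _ _ _ _ h); rewrite /GRing.scale /= expr0; field.
have h := is_deriveD (is_deriveZ (- b^-1) (is_derive_powexp b n.+1 t)) (is_deriveZ (n.+1%:R / b) IH).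
have -> : (fun t : R => - (t ^+ n.+1 * expR (- (b * t))) / b + n.+1%:R / b * gamma_prim b n t) =
   (- b^-1) *: (fun t : R => t ^+ n.+1 * expR (- (b * t))) + (n.+1%:R / b) *: gamma_prim b n.
  apply/funext => x.
  change (- (x ^+ n.+1 * expR (- (b * x))) / b + n.+1%:R / b * gamma_prim b n x =
   - b^-1 * (x ^+ n.+1 * expR (- (b * x))) + n.+1%:R / b * gamma_prim b n x); ring.
by apply: (@is_derive_eq _ _ _ _ _ _ _ _ h); rewrite /GRing.scale /=; field.
Qed.

Lemma gamma_prim0 b n : b != 0 -> gamma_prim b n 0 = - (n`!%:R / b ^+ n.+1).
Proof.
move=> b0; elim: n => [|n IH] /=; first by rewrite mulr0 oppr0 expR0 expr1 mulNr.
rewrite IH expr0n /= mul0r oppr0 mul0r add0r factS natrM [b ^+ n.+2]exprS.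
by field; rewrite b0 expf_neq0.
Qed.

Lemma gamma_prim_le b n : 0 < b -> exists2 C : R, 0 <= C &
  forall u, 0 < u -> `|gamma_prim b n u| <= C / u.
Proof.
move=> b0; elim: n => [|n [C C0 IH]].
  exists (1`!%:R / b ^+ 1 / b) => [|u u0 /=]; first by rewrite !divr_ge0 ?exprn_ge0 ?ltW.
  rewrite mulNr normrN ger0_norm ?divr_ge0 ?expR_ge0 ?(ltW b0) // mulrAC ler_pM2r ?invr_gt0 //.
  by have := pow_exp_le 0 b0 u0; rewrite expr0 mul1r.
exists (n.+2`!%:R / b ^+ n.+2 / b + n.+1%:R / b * C) => [|u u0 /=].
  apply: addr_ge0; first by rewrite !divr_ge0 ?exprn_ge0 ?ltW.
  by rewrite mulr_ge0 // divr_ge0 // ltW.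
apply: le_trans (ler_normD _ _) _; rewrite mulrDl; apply: lerD.
  rewrite mulNr normrN ger0_norm; last first.
    by rewrite divr_ge0 ?(ltW b0) // mulr_ge0 ?expR_ge0 // exprn_ge0 // ltW.
  by rewrite [leRHS]mulrAC ler_pM2r ?invr_gt0 //; exact: pow_exp_le.
rewrite normrM ger0_norm ?divr_ge0 ?(ltW b0) // -[leRHS]mulrA ler_wpM2l ?divr_ge0 ?(ltW b0) //.
exact: IH.
Qed.

Lemma cvgy_le (F : R -> R) l C : 0 <= C -> (forall u, 0 < u -> `|F u - l| <= C / u) ->
  F x @[x --> +oo%R] --> l.
Proof.
move=> C0 H; apply/cvgrPdist_le => e e0; near=> x.
have x0 : 0 < x by near: x; exact: (nbhs_pinfty_gt (num_real _)).
have h : C / e <= x by near: x; exact: (nbhs_pinfty_ge (num_real _)).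
by rewrite distrC; apply: le_trans (H x x0) _; rewrite ler_pdivrMr // mulrC -ler_pdivrMr.
Unshelve. all: by end_near. Qed.

Lemma cvg0r_le (F : R -> R) l C : 0 <= C -> (forall u, 0 < u -> `|F u - l| <= C * u) ->
  F x @[x --> 0^'+] --> l.
Proof.
move=> C0 H; apply/cvgrPdist_le => e e0; near=> x.
have x0 : 0 < x by near: x; exact: nbhs_right_gt.
rewrite distrC; apply: le_trans (H x x0) _.
have h : x <= e / (C + 1).
  by near: x; apply: nbhs_right_le; rewrite divr_gt0 // ltr_wpDl.
have : x * (C + 1) <= e by rewrite -ler_pdivlMr // ltr_wpDl.
nra.
Unshelve. all: by end_near. Qed.

Lemma gamma_integral b n : 0 < b ->
  mu.-integrable `]0, +oo[ (EFin \o (fun t => t ^+ n * expR (- (b * t)))) /\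
  Rintegral mu `]0, +oo[ (fun t => t ^+ n * expR (- (b * t))) = n`!%:R / b ^+ n.+1.
Proof.
move=> b0; have bn : b != 0 by rewrite gt_eqF.
have dF x := is_derive_gamma_prim n x bn.
have cf x : {for x, continuous (fun t => t ^+ n * expR (- (b * t)))}.
  apply: differentiable_continuous; apply/derivable1_diffP.
  exact: (@ex_derive _ _ _ _ _ _ _ (is_derive_powexp b n x)).
have cF x : {for x, continuous (gamma_prim b n)}.
  apply: differentiable_continuous; apply/derivable1_diffP.
  exact: (@ex_derive _ _ _ _ _ _ _ (dF x)).
have [C C0 HC] := gamma_prim_le n b0.
have [h1 h2] : mu.-integrable `]0, +oo[ (EFin \o (fun t => t ^+ n * expR (- (b * t)))) /\
  Rintegral mu `]0, +oo[ (fun t => t ^+ n * expR (- (b * t))) = 0 - gamma_prim b n 0.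
  apply: ftc_oy.
  - by move=> x x0; rewrite mulr_ge0 ?exprn_ge0 ?expR_ge0.
  - by move=> x _; exact: cf.
  - by apply: cvg_at_right_filter; exact: cf.
  - by apply: cvg_at_right_filter; exact: cF.
  - by apply: (cvgy_le C0) => u u0; rewrite subr0; exact: HC.
by split => //; rewrite h2 gamma_prim0 // opprK add0r.
Qed.

(** The substitution t -> 1/t is carried out on antiderivatives: -[gamma_prim] at 1/t is one for
    this integrand. *)
Lemma inverse_gamma_integral b n : 0 < b ->
  mu.-integrable `]0, +oo[ (EFin \o (fun t => t^-1 ^+ n.+2 * expR (- (b / t)))) /\
  Rintegral mu `]0, +oo[ (fun t => t^-1 ^+ n.+2 * expR (- (b / t))) = n`!%:R / b ^+ n.+1.
Proof.
move=> b0; have bn : b != 0 by rewrite gt_eqF.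
pose g t := t^-1 ^+ n.+2 * expR (- (b / t)).
(* The value 0 on t <= 0 agrees with the limit from the right at 0, as [ftc_oy] requires. *)
pose H t : R := if 0 < t then - gamma_prim b n t^-1 else 0.
have [C C0 HC] := gamma_prim_le n b0.
have dV t : 0 < t -> is_derive t 1 (fun t : R => t^-1) (- t ^- 2).
  move=> t0; have tn : id t != 0 by rewrite gt_eqF.
  by apply: (@is_derive_eq _ _ _ _ _ _ _ _ (is_deriveV tn (is_derive_id t 1))); rewrite /GRing.scale /= mulr1.
have dg t : 0 < t -> derivable g t 1.
  move=> t0; have h := is_derive1_comp (is_derive_powexp b n.+2 t^-1) (dV t t0).
  exact: (@ex_derive _ _ _ _ _ _ _ h).
have dH t : 0 < t -> is_derive t 1 H (g t).
  move=> t0; have h := is_deriveN (is_derive1_comp (is_derive_gamma_prim n t^-1 bn) (dV t t0)).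
  have h' : is_derive t 1 (- (gamma_prim b n \o (fun t : R => t^-1))) (g t).
    by apply: (@is_derive_eq _ _ _ _ _ _ _ _ h); rewrite /g -exprVn -[n.+2]addn2 exprD; ring.
  apply: near_eq_is_derive h'; near=> x.
  have x0 : 0 < x by near: x; exact: lt_nbhsr.
  by rewrite /H x0.
have cg t : 0 < t -> {for t, continuous g}.
  by move=> t0; apply: differentiable_continuous; apply/derivable1_diffP; exact: dg.
have H0 : H 0 = 0 by rewrite /H ltxx.
have g0 : g 0 = 0 by rewrite /g invr0 exprS !mul0r.
have c0 : {for 0, continuous (gamma_prim b n)}.
  apply: differentiable_continuous; apply/derivable1_diffP.
  exact: (@ex_derive _ _ _ _ _ _ _ (is_derive_gamma_prim n 0 bn)).
have [h1 h2] : mu.-integrable `]0, +oo[ (EFin \o g) /\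
  Rintegral mu `]0, +oo[ g = n`!%:R / b ^+ n.+1 - H 0.
  apply: ftc_oy.
  - move=> x x0; rewrite mulr_ge0 ?exprn_ge0 ?expR_ge0 //.
    by rewrite invr_ge0.
  - exact: cg.
  - rewrite g0; apply: (@cvg0r_le _ _ (n.+3`!%:R / b ^+ n.+3)).
      by rewrite divr_ge0 // exprn_ge0 // ltW.
    move=> u u0; rewrite subr0 ger0_norm; last first.
      by rewrite mulr_ge0 ?expR_ge0 // exprn_ge0 // invr_ge0 ltW.
    have ui : 0 < u^-1 by rewrite invr_gt0.
    by have := pow_exp_le n.+2 b0 ui; rewrite invrK.
  - rewrite H0; apply: (cvg0r_le C0) => u u0; rewrite subr0 /H u0 normrN.
    have ui : 0 < u^-1 by rewrite invr_gt0.
    by have := HC _ ui; rewrite invrK.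
  - apply/cvgrPdist_le => e e0.
    move/cvgrPdist_le: c0 => /(_ e e0) [d /= d0 Hd].
    near=> x; have x0 : 0 < x by near: x; exact: (nbhs_pinfty_gt (num_real _)).
    rewrite /H x0 opprK.
    have -> : n`!%:R / b ^+ n.+1 + gamma_prim b n x^-1 = - (gamma_prim b n 0 - gamma_prim b n x^-1).
      by rewrite gamma_prim0 //; ring.
    rewrite normrN; apply: Hd => /=; rewrite sub0r normrN ger0_norm ?invr_ge0 ?(ltW x0) //.
    rewrite -[d]invrK ltf_pV2 ?posrE ?invr_gt0 //.
    by near: x; exact: (nbhs_pinfty_gt (num_real _)).
by split => //; rewrite h2 H0 subr0.
Unshelve. all: by end_near. Qed.

End GammaIntegrals.

(** * Error terms *)

Section Estimates.
Variable R : realType.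
Local Notation mu := (@lebesgue_measure R).
Implicit Types (t y : R).

Local Notation halfline := (`]0%R, +oo[%classic : set R).

Lemma Rintegral_near (g m E : R -> R) (c : R) :
  measurable_fun halfline g -> mu.-integrable halfline (EFin \o m) ->
  mu.-integrable halfline (EFin \o E) ->
  (forall t, 0 < t -> `|g t - c * m t| <= E t) ->
  `|Rintegral mu halfline g - c * Rintegral mu halfline m| <= Rintegral mu halfline E.
Proof.
move=> mg im iE h.
have mD : measurable halfline by exact: measurable_itv.
have icm : mu.-integrable halfline (EFin \o (fun t => c * m t)).
  have := @integrableZl _ _ _ mu _ mD c (EFin \o m) im.
  by congr (integrable _ _ _).
have id : mu.-integrable halfline (EFin \o (fun t => g t - c * m t)).
  apply: (@le_integrable _ _ _ mu _ mD _ (EFin \o E)) => //.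
    apply/measurable_EFinP; apply: measurable_funB => //.
    by apply/measurable_EFinP; case/integrableP: icm.
  move=> t; rewrite /= in_itv /= andbT => t0; rewrite lee_fin.
  by apply: le_trans (h t t0) (ler_norm _).
have ig : mu.-integrable halfline (EFin \o g).
  have := @integrableD _ _ _ mu _ mD _ _ id icm; congr (integrable _ _ _).
  by apply/funext => t /=; rewrite -EFinD subrK.
rewrite -RintegralZl // -RintegralB //.
apply: le_trans (@le_normr_Rintegral _ _ _ mu _ _ mD id) _.
apply: le_Rintegral => //.
  have := integrable_abse id; congr (integrable _ _ _).
move=> t; rewrite /= in_itv /= andbT; exact: h.
Qed.

Lemma cReN (z : R[i]) : complex.Re (- z) = - complex.Re z. Proof. by case: z. Qed.
Lemma cImN (z : R[i]) : complex.Im (- z) = - complex.Im z. Proof. by case: z. Qed.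

(** Real and imaginary parts are compared separately, which costs the factor 2. *)
Lemma integral_0_ioo_near (g : R[i] -> R[i]) (m E : R -> R) (c : R[i]) :
  measurable_fun halfline (fun t => complex.Re (g (Complex 0 t))) ->
  measurable_fun halfline (fun t => complex.Im (g (Complex 0 t))) ->
  mu.-integrable halfline (EFin \o m) -> mu.-integrable halfline (EFin \o E) ->
  (forall t, 0 < t -> cabs (g (Complex 0 t) - c * (m t)%:C) <= E t) ->
  cabs (integral_0_ioo g - Complex 0 1 * c * (Rintegral mu halfline m)%:C)
    <= 2 * Rintegral mu halfline E.
Proof.
move=> mR mI im iE h; rewrite /integral_0_ioo -mulrA -mulrBr cabsM.
have -> : cabs (Complex 0 1 : R[i]) = 1 by rewrite cabsE /= expr0n expr1n add0r sqrtr1.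
rewrite mul1r.
have hR : `|Rintegral mu halfline (fun t => complex.Re (g (Complex 0 t))) -
   complex.Re c * Rintegral mu halfline m| <= Rintegral mu halfline E.
  apply: Rintegral_near => // t t0; apply: le_trans (h t t0); apply: le_trans (Re_le_cabs _).
  by rewrite cReD cReN cReM /= mulr0 subr0.
have hI : `|Rintegral mu halfline (fun t => complex.Im (g (Complex 0 t))) -
   complex.Im c * Rintegral mu halfline m| <= Rintegral mu halfline E.
  apply: Rintegral_near => // t t0; apply: le_trans (h t t0); apply: le_trans (Im_le_cabs _).
  by rewrite cImD cImN cImM /= mulr0 add0r.
set I := Complex _ _ in hR hI *; set r := Rintegral mu halfline m in hR hI *.
set X := _ - _.
have -> : X = Complex (complex.Re X) (complex.Im X) by case: X.
apply: le_trans (cabs_rect _ _) _.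
have -> : complex.Re X = complex.Re I - complex.Re c * r.
  by rewrite /X cReD cReN cReM /= mulr0 subr0.
have -> : complex.Im X = complex.Im I - complex.Im c * r.
  by rewrite /X cImD cImN cImM /= mulr0 add0r.
rewrite mulr_natl mulr2n; exact: lerD.
Qed.

Lemma qparam_it t : qparam (Complex 0 t) = (expR (- (2 * pi * t)))%:C :> R[i].
Proof.
rewrite /qparam /cexp cReM cImM /= !mul0r mulr0 sub0r addr0 cos0 sin0 mulr1 mulr0.
by [].
Qed.

Lemma it_pow t m : (Complex 0 t : R[i]) ^+ m = Complex 0 1 ^+ m * (t ^+ m)%:C.
Proof.
rewrite rmorphXn /= -exprMn; congr (_ ^+ _).
by apply: rect_eq; rewrite ?cReM ?cImM /=; ring.
Qed.

(** [p] stands for the real or the imaginary part, through the properties they share. Measurability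
    comes from pointwise convergence of the partial sums. *)
Lemma measurable_qseries (a : nat -> R[i]) (g : R[i] -> R[i]) (m : nat) (p : R[i] -> R)
    (p_lim : forall z w, `|p z - p w| <= cabs (z - w))
    (p_add : forall z w, p (z + w) = p z + p w)
    (p_scale : forall z (x : R), p (z * x%:C) = p z * x) :
  (forall t, 0 < t -> hsum (fun k => a k * qparam (Complex 0 t) ^+ k) (g (Complex 0 t))) ->
  measurable_fun halfline (fun t => p (g (Complex 0 t) * Complex 0 t ^+ m)).
Proof.
move=> hg.
have p0 : p 0 = 0 by have := p_add 0 0; rewrite addr0; lra.
have pDl (x y z : R[i]) : p ((x + y) * z) = p (x * z) + p (y * z) by rewrite mulrDl p_add.
pose h N t := \sum_(0 <= k < N) p (a k * Complex 0 1 ^+ m) * (expR (- (2 * pi * t)) ^+ k * t ^+ m).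
have hE N t : h N t = p ((\sum_(0 <= k < N) a k * qparam (Complex 0 t) ^+ k) * Complex 0 t ^+ m).
  rewrite /h; elim: N => [|N IH]; first by rewrite !big_nil mul0r p0.
  rewrite big_nat_recr //= IH [in RHS]big_nat_recr //= pDl; congr (_ + _).
  rewrite -p_scale qparam_it (it_pow t); congr p.
  rewrite !rmorphM /= !rmorphXn /= -!mulrA; congr (_ * _); by rewrite mulrCA.
apply: (@measurable_fun_cvg _ _ _ _ h) => [N|t].
  apply: measurable_sum => k; apply: measurable_funM; first exact: measurable_cst.
  apply: measurable_funM; last exact: exprn_measurable.
  apply: measurable_funX; apply: measurableT_comp; first exact: measurable_expR.
  by apply: measurableT_comp => //; apply: measurable_funM => //; exact: measurable_cst.
rewrite /= in_itv /= andbT => t0; apply/cvgrPdist_le => e e0.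
pose T := cabs (Complex 0 t ^+ m : R[i]).
have T0 : 0 < T + 1 by rewrite ltr_wpDl ?cabs_ge0.
have [N0 HN] := hsum_nat (hg t t0) (divr_gt0 e0 T0).
exists N0 => // N /= hN; rewrite hE; apply: le_trans (p_lim _ _) _.
rewrite -mulrBl cabsM -/T cabsB; apply: le_trans (ler_wpM2r (cabs_ge0 _) (HN N hN)) _.
rewrite -/T mulrAC ler_pdivrMr // ler_wpM2l ?(ltW e0) // lerDl //.
Qed.

Lemma fact_dominates (X e : R) : 0 < e -> exists n0, forall n, (n0 <= n)%N ->
  X ^+ n <= e * n`!%:R.
Proof.
move=> e0; have := cvg_exp_coeff X; move/cvgrPdist_le => /(_ e e0) [n0 _ H].
exists n0 => n hn; have := H n hn; rewrite /= sub0r normrN /exp_coeff /= => h.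
have f0 : 0 < (n`!%:R : R) by rewrite ltr0n fact_gt0.
by rewrite -ler_pdivrMr //; apply: le_trans h; apply: ler_norm.
Qed.

(* Integrable majorant for those parts of the error which are only exponential
   in K; against the factorial in the main term they are negligible. *)
Definition tail_weight t : R := t^-1 ^+ 2 * expR (- (1 / t)).

Lemma exp_pi_le y : 0 < y -> expR (- (2 * pi * y)) <= y^-1.
Proof.
move=> y0; rewrite expRN lef_pV2 ?posrE ?expR_gt0 //.
apply: le_trans (expR_ge1Dx _); have := pi_ge2 R; nra.
Qed.

(** y = 1/(D^2 t) is the height after the cusp has been moved to infinity. For y >= U the bracket is
    at most e; for 1/D < y < U, t stays in a compact range where every factor is bounded by a K-th
    power and [tail_weight] is bounded below. *)
Lemma error_near0 (D : nat) (C e : R) : (0 < D)%N -> 0 <= C -> 0 < e ->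
  exists2 Q : R, 1 <= Q & forall (K N s : nat) (t E : R),
    (0 < N <= K)%N -> (s < K)%N -> 0 < t -> t < D%:R^-1 -> 0 <= E <= 1 ->
    t^-1 ^+ s.+1 * E * (C * (expR (- (2 * pi * (D%:R ^+ 2 * t)^-1)) + (D%:R ^+ 2 * t) ^+ N))
      <= e * (t^-1 ^+ s.+1 * E) + Q ^+ K * tail_weight t.
Proof.
move=> D0 C0 e0; have Dr0 : 0 < (D%:R : R) by rewrite ltr0n.
have Dr1 : 1 <= (D%:R : R) by rewrite ler1n.
pose U := 1 + 2 * C / e; have U1 : 1 <= U by rewrite lerDl divr_ge0 ?mulr_ge0 // ltW.
pose V := D%:R ^+ 2 * U; have V1 : 1 <= V by rewrite mulr_ege1 // exprn_ege1.
have V0 : 0 < V by lra.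
have eV1 : 1 <= expR V by have := expR_ge1Dx V; lra.
have C1 : 1 <= 1 + 2 * C by lra.
pose Q := V * D%:R * ((1 + 2 * C) * expR V).
have Q1 : 1 <= Q by rewrite /Q !mulr_ege1.
exists Q => // K N s t E /andP[N0 NK] sK t0 tD /andP[E0 E1].
set y := (D%:R ^+ 2 * t)^-1.
have Dt0 : 0 < D%:R ^+ 2 * t by rewrite mulr_gt0 // exprn_gt0.
have y0 : 0 < y by rewrite invr_gt0.
have -> : (D%:R ^+ 2 * t) ^+ N = y^-1 ^+ N by rewrite invrK.
have K0 : (0 < K)%N by apply: leq_trans N0 NK.
have ti0 : 0 < t^-1 by rewrite invr_gt0.
have tE : t^-1 = D%:R ^+ 2 * y by rewrite /y; field; rewrite !gt_eqF.
have Dt : D%:R < t^-1 by rewrite -[D%:R]invrK ltf_pV2 ?posrE ?invr_gt0.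
have X0 : 0 <= t^-1 ^+ s.+1 * E by rewrite mulr_ge0 // exprn_ge0 // ltW.
have w0 : 0 <= tail_weight t by rewrite mulr_ge0 ?expR_ge0 // sqr_ge0.
have QK0 : 0 <= Q ^+ K by rewrite exprn_ge0 //; lra.
have ey := exp_pi_le y0.
have [yU|yU] := leP U y.
  have y1 : 1 <= y by lra.
  have yN : y^-1 ^+ N <= y^-1.
    by rewrite -{2}[y^-1]expr1 ler_wiXn2l ?invf_le1 // invr_ge0 ltW.
  have h : C * (expR (- (2 * pi * y)) + y^-1 ^+ N) <= e.
    apply: (@le_trans _ _ (2 * C / y)).
      have -> : 2 * C / y = C * (y^-1 + y^-1) by ring.
      by rewrite ler_wpM2l // lerD.
    rewrite ler_pdivrMr // [e * y]mulrC -ler_pdivrMr //; rewrite /U in yU; lra.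
  apply: (@le_trans _ _ (e * (t^-1 ^+ s.+1 * E))); last by rewrite lerDl mulr_ge0.
  by rewrite [leRHS]mulrC ler_wpM2l.
apply: (@le_trans _ _ (Q ^+ K * tail_weight t)); last first.
  by rewrite lerDr mulr_ge0 // ltW.
have tV : t^-1 <= V by rewrite tE ler_wpM2l ?sqr_ge0 // ltW.
have yD : y^-1 <= D%:R.
  rewrite /y invrK expr2 -mulrA ler_piMr ?(ltW Dr0) // mulrC -ler_pdivlMr // mul1r ltW //.
have a1 : t^-1 ^+ s.+1 * E <= V ^+ K.
  rewrite -[leRHS]mulr1; apply: ler_pM => //; first by rewrite exprn_ge0 // ltW.
  apply: (@le_trans _ _ (V ^+ s.+1)).
    by rewrite lerXn2r ?nnegrE ?(ltW ti0) ?(ltW V0).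
  by rewrite ler_weXn2l.
have a2 : C * (expR (- (2 * pi * y)) + y^-1 ^+ N) <= D%:R ^+ K * (1 + 2 * C).
  have b1 : expR (- (2 * pi * y)) <= D%:R ^+ K.
    apply: (@le_trans _ _ 1); last by rewrite exprn_ege1.
    rewrite -expR0 ler_expR oppr_le0 !mulr_ge0 ?pi_ge0 // ltW //.
  have b2 : y^-1 ^+ N <= D%:R ^+ K.
    apply: (@le_trans _ _ (D%:R ^+ N)); last by rewrite ler_weXn2l.
    by rewrite lerXn2r // nnegrE ?invr_ge0 ltW.
  have b3 : 0 <= (D%:R : R) ^+ K by rewrite exprn_ge0.
  have : C * (expR (- (2 * pi * y)) + y^-1 ^+ N) <= C * (D%:R ^+ K + D%:R ^+ K).
    by rewrite ler_wpM2l // lerD.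
  lra.
have a3 : 1 <= expR V * tail_weight t.
  rewrite /tail_weight mulrCA mulr_ege1 //.
    by rewrite exprn_ege1 // (le_trans Dr1) // ltW.
  by rewrite -expRD -[leLHS]expR0 ler_expR mul1r; lra.
have a4 : (1 + 2 * C) * expR V <= ((1 + 2 * C) * expR V) ^+ K.
  by rewrite -{1}[X in X <= _]expr1 ler_weXn2l // mulr_ege1.
have c0 : 0 <= C * (expR (- (2 * pi * y)) + y^-1 ^+ N).
  by rewrite mulr_ge0 // addr_ge0 ?expR_ge0 // exprn_ge0 // invr_ge0 ltW.
apply: le_trans (ler_pM X0 c0 a1 a2) _.
have -> : Q ^+ K = V ^+ K * (D%:R ^+ K * ((1 + 2 * C) * expR V) ^+ K) by rewrite mulrA -!exprMn.
rewrite -!mulrA.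
have V00 : 0 <= V ^+ K by rewrite exprn_ge0 // ltW.
have D00 : 0 <= (D%:R : R) ^+ K by rewrite exprn_ge0.
rewrite ler_wpM2l // ler_wpM2l //.
apply: (@le_trans _ _ ((1 + 2 * C) * expR V * tail_weight t)); last by rewrite ler_wpM2r.
by rewrite -mulrA ler_peMr //; lra.
Qed.

(** For t >= U the spare power of t provided by m < n outweighs the constant 1 + 2C; for 1/D <= t <
    U everything is bounded by a K-th power. *)
Lemma error_far (D : nat) (C e : R) : (0 < D)%N -> 0 <= C -> 0 < e ->
  exists2 Q : R, 1 <= Q & forall (K N m n : nat) (t E : R),
    (0 < N <= K)%N -> (m < n)%N -> (m <= K)%N -> D%:R^-1 <= t -> 0 <= E <= 1 ->
    t ^+ m * E * (1 + C * (expR (- (2 * pi * t)) + t^-1 ^+ N))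
      <= e * (t ^+ n * E) + Q ^+ K * tail_weight t.
Proof.
move=> D0 C0 e0; have Dr0 : 0 < (D%:R : R) by rewrite ltr0n.
have Dr1 : 1 <= (D%:R : R) by rewrite ler1n.
pose U := 1 + (1 + 2 * C) / e; have U1 : 1 <= U.
  by rewrite lerDl divr_ge0 ?addr_ge0 ?mulr_ge0 // ltW.
have U0 : 0 < U by lra.
have eD1 : 1 <= expR (D%:R : R) by have := expR_ge1Dx (D%:R : R); lra.
have C1 : 1 <= 1 + 2 * C by lra.
have U21 : 1 <= U ^+ 2 by rewrite exprn_ege1.
pose L := (1 + 2 * C) * (U ^+ 2 * expR D%:R).
have L1 : 1 <= L by rewrite /L !mulr_ege1.
pose Q := U * D%:R * L.
have Q1 : 1 <= Q by rewrite /Q !mulr_ege1.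
exists Q => // K N m n t E /andP[N0 NK] mn mK tD /andP[E0 E1].
have t0 : 0 < t by apply: lt_le_trans tD; rewrite invr_gt0.
have ti0 : 0 < t^-1 by rewrite invr_gt0.
have K0 : (0 < K)%N by apply: leq_trans N0 NK.
have X0 : 0 <= t ^+ m * E by rewrite mulr_ge0 // exprn_ge0 // ltW.
have w0 : 0 <= tail_weight t by rewrite mulr_ge0 ?expR_ge0 // sqr_ge0.
have QK0 : 0 <= Q ^+ K by rewrite exprn_ge0 //; lra.
have e1 : expR (- (2 * pi * t)) <= 1.
  by rewrite -expR0 ler_expR oppr_le0 !mulr_ge0 ?pi_ge0 // ltW.
have tiD : t^-1 <= D%:R by rewrite -[D%:R]invrK lef_pV2 ?posrE ?invr_gt0.
have [tU|tU] := leP U t.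
  have t1 : 1 <= t by lra.
  have tN : t^-1 ^+ N <= 1 by rewrite exprn_ile1 // ?invf_le1 // ltW.
  have h : 1 + C * (expR (- (2 * pi * t)) + t^-1 ^+ N) <= 1 + 2 * C.
    by rewrite lerD2l mulrC ler_wpM2r //; lra.
  apply: (@le_trans _ _ (e * (t ^+ n * E))); last by rewrite lerDl mulr_ge0.
  apply: le_trans (ler_wpM2l X0 h) _.
  rewrite mulrAC [leRHS]mulrA ler_wpM2r //.
  have te : 1 + 2 * C <= e * t.
    by rewrite [e * t]mulrC -ler_pdivrMr //; rewrite /U in tU; lra.
  apply: (@le_trans _ _ (e * t ^+ m.+1)).
    by rewrite exprS mulrA mulrC ler_wpM2r // exprn_ge0 // ltW.
  by rewrite ler_wpM2l ?(ltW e0) // ler_weXn2l.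
apply: (@le_trans _ _ (Q ^+ K * tail_weight t)); last first.
  by rewrite lerDr !mulr_ge0 ?exprn_ge0 // ltW.
have a1 : t ^+ m * E <= U ^+ K.
  rewrite -[leRHS]mulr1; apply: ler_pM => //; first by rewrite exprn_ge0 // ltW.
  apply: (@le_trans _ _ (U ^+ m)).
    by rewrite lerXn2r ?nnegrE ?(ltW t0) ?(ltW U0) // ltW.
  by rewrite ler_weXn2l.
have b3 : 1 <= (D%:R : R) ^+ K by rewrite exprn_ege1.
have a2 : 1 + C * (expR (- (2 * pi * t)) + t^-1 ^+ N) <= D%:R ^+ K * (1 + 2 * C).
  have b2 : t^-1 ^+ N <= D%:R ^+ K.
    apply: (@le_trans _ _ (D%:R ^+ N)); last by rewrite ler_weXn2l.
    by rewrite lerXn2r ?nnegrE ?(ltW ti0).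
  have : C * (expR (- (2 * pi * t)) + t^-1 ^+ N) <= C * (D%:R ^+ K + D%:R ^+ K).
    by rewrite ler_wpM2l // lerD // (le_trans e1).
  lra.
have a3 : 1 <= (U ^+ 2 * expR D%:R) * tail_weight t.
  rewrite /tail_weight mulrACA -exprMn mulr_ege1 //.
    by rewrite exprn_ege1 // ler_pdivlMr // mul1r ltW.
  by rewrite -expRD -[leLHS]expR0 ler_expR mul1r; lra.
have a4 : L <= L ^+ K by rewrite -{1}[L]expr1 ler_weXn2l.
have c0 : 0 <= 1 + C * (expR (- (2 * pi * t)) + t^-1 ^+ N).
  by rewrite addr_ge0 // mulr_ge0 // addr_ge0 ?expR_ge0 // exprn_ge0 // ltW.
apply: le_trans (ler_pM X0 c0 a1 a2) _.
have -> : Q ^+ K = U ^+ K * (D%:R ^+ K * L ^+ K) by rewrite mulrA -!exprMn.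
rewrite -!mulrA.
have U00 : 0 <= U ^+ K by rewrite exprn_ge0 // ltW.
have D00 : 0 <= (D%:R : R) ^+ K by rewrite exprn_ge0.
rewrite ler_wpM2l // ler_wpM2l //.
apply: (@le_trans _ _ (L * tail_weight t)); last by rewrite ler_wpM2r.
by rewrite /L -mulrA ler_peMr //; lra.
Qed.

(** The main term is integrated over the whole half-line although it models the twist only for t <
    1/D; this bounds the excess. *)
Lemma error_main (D : nat) : (0 < D)%N ->
  exists2 Q : R, 1 <= Q & forall (K s : nat) (t E : R),
    (0 < s < K)%N -> D%:R^-1 <= t -> 0 <= E <= 1 ->
    t^-1 ^+ s.+1 * E <= Q ^+ K * tail_weight t.
Proof.
move=> D0; have Dr0 : 0 < (D%:R : R) by rewrite ltr0n.
have Dr1 : 1 <= (D%:R : R) by rewrite ler1n.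
have eD1 : 1 <= expR (D%:R : R) by have := expR_ge1Dx (D%:R : R); lra.
exists (D%:R * expR D%:R) => [|K s t E /andP[s0 sK] tD /andP[E0 E1]].
  exact: mulr_ege1.
have t0 : 0 < t by apply: lt_le_trans tD; rewrite invr_gt0.
have ti0 : 0 < t^-1 by rewrite invr_gt0.
have tiD : t^-1 <= D%:R by rewrite -[D%:R]invrK lef_pV2 ?posrE ?invr_gt0.
rewrite /tail_weight; have -> : s.+1 = (2 + s.-1)%N by lia.
rewrite exprD -mulrA [leRHS]mulrCA ler_wpM2l ?sqr_ge0 // exprMn -mulrA.
apply: ler_pM => //; first by rewrite exprn_ge0 // ltW.
  apply: (@le_trans _ _ (D%:R ^+ s.-1)).
    by rewrite lerXn2r ?nnegrE ?(ltW ti0).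
  by rewrite ler_weXn2l //; lia.
apply: le_trans E1 _.
apply: (@le_trans _ _ (expR D%:R * expR (- (1 / t)))).
  by rewrite -expRD -[leLHS]expR0 ler_expR mul1r; lra.
rewrite ler_wpM2r ?expR_ge0 // -{1}[expR _]expr1 ler_weXn2l //; lia.
Qed.

End Estimates.

(** * Twists of test forms on the imaginary axis *)

Section Periods.
Variable R : realType.
Local Notation mu := (@lebesgue_measure R).
Local Notation halfline := (`]0%R, +oo[%classic : set R).

Definition has_integral (f : R -> R) (I : R) : Prop :=
  mu.-integrable halfline (EFin \o f) /\ Rintegral mu halfline f = I.

Lemma has_integralZ k f I : has_integral f I -> has_integral (fun t => k * f t) (k * I).
Proof.
have mD : measurable halfline by exact: measurable_itv.
move=> [fi <-]; split; last by rewrite RintegralZl.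
have := @integrableZl _ _ _ mu _ mD k (EFin \o f) fi.
by congr (integrable _ _ _).
Qed.

Lemma has_integralD f g I J : has_integral f I -> has_integral g J ->
  has_integral (fun t => f t + g t) (I + J).
Proof.
have mD : measurable halfline by exact: measurable_itv.
move=> [fi <-] [gi <-]; split; last by rewrite RintegralD.
have := @integrableD _ _ _ mu _ mD _ _ fi gi.
by congr (integrable _ _ _).
Qed.

Section Twist.
Variables (D j K n m : nat) (chi : int -> R[i]) (u : 'I_D -> 'I_D).
Hypothesis D_gt0 : (0 < D)%N.
Hypothesis chi_prim : primitive_character D chi.
Hypothesis u_inv : forall a : 'I_D, coprimez a D%:Z -> (D%:Z %| a%:Z * (u a)%:Z + 1)%Z.
Hypothesis j1 : (D%:Z %| j%:Z - 1)%Z.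
Hypothesis KE : K = (n + m).+2.

Variables (f : R[i] -> R[i]) (A : nat -> R[i]) (C : R) (N : nat).
Hypothesis f_mod : modular_of_weight K f.
Hypothesis f_ser : qseries A f.
Hypothesis A0 : A 0%N = 0.
Hypothesis f_near : forall z, `|complex.Re z| <= 1 -> D%:R^-1 <= complex.Im z ->
  cabs (f z - qparam z ^+ j) <=
  C * cabs (qparam z) ^+ j * (cabs (qparam z) + (complex.Im z)^-1 ^+ N).

Let W : R[i] := \sum_(a < D) chat D chi a * eD R D (u a).
Let theta : R := cabs (chat D chi 1).
Let b : R := 2 * pi * j%:R / D%:R ^+ 2.

Let Dr0 : 0 < (D%:R : R). Proof. by rewrite ltr0n. Qed.

(** The use of j = 1 mod D: the phases e(j u(a)/D) reduce to e(u(a)/D), so the leading constant [W]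
    is the same for all j. *)
Lemma eD_pow (x : int) : eD R D x ^+ j = eD R D x.
Proof.
rewrite /eD -qparamMn mulrA.
have -> : j%:R * x%:~R = (j%:Z * x)%:~R :> R[i] by rewrite rmorphM.
rewrite -/(eD R D _) -/(eD R D x); apply: (eD_mod R D_gt0); have -> : j%:Z * x - x = (j%:Z - 1) * x by ring.
by rewrite dvdz_mulr.
Qed.

Lemma it_uhp (t : R) : 0 < t -> upper_half_plane (Complex 0 t : R[i]).
Proof. by []. Qed.

Lemma cabs_i : cabs (Complex 0 1 : R[i]) = 1.
Proof. by rewrite cabsE /= expr0n expr1n add0r sqrtr1. Qed.

Lemma cabs_it (t : R) : 0 <= t -> cabs (Complex 0 t : R[i]) = t.
Proof. by move=> t0; rewrite cabsE /= expr0n add0r sqrtr_sqr ger0_norm. Qed.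

Lemma shift_rect (t : R) (a : 'I_D) :
  complex.Re (Complex 0 t + a%:R / D%:R : R[i]) = a%:R / D%:R /\
  complex.Im (Complex 0 t + a%:R / D%:R : R[i]) = t.
Proof.
rewrite natV_rc cReD cImD cReM cImM /= Re_nat Im_nat mulr0 subr0 mulr0 mul0r !addr0 add0r.
by [].
Qed.

Lemma cabs_qparam_shift (t : R) (a : 'I_D) :
  cabs (qparam (Complex 0 t + a%:R / D%:R)) = expR (- (2 * pi * t)).
Proof. by rewrite cabs_qparam (shift_rect t a).2. Qed.

Lemma shift_near (t : R) (a : 'I_D) : D%:R^-1 <= t ->
  cabs (f (Complex 0 t + a%:R / D%:R) - qparam (Complex 0 t + a%:R / D%:R) ^+ j) <=
  C * expR (- (2 * pi * t)) ^+ j * (expR (- (2 * pi * t)) + t^-1 ^+ N).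
Proof.
move=> tD; have [re im] := shift_rect t a.
have h := @f_near (Complex 0 t + a%:R / D%:R).
rewrite re im (cabs_qparam_shift t a) in h; apply: h => //.
rewrite ger0_norm; last by rewrite divr_ge0.
by rewrite ler_pdivrMr // mul1r ler_nat ltnW.
Qed.

Lemma twist_far (t : R) : D%:R^-1 <= t ->
  cabs (twist chi f (Complex 0 t) * Complex 0 t ^+ m) <=
  D%:R * theta * (t ^+ m * expR (- (2 * pi * t)) ^+ j *
    (1 + C * (expR (- (2 * pi * t)) + t^-1 ^+ N))).
Proof.
move=> tD; have t0 : 0 < t by apply: lt_le_trans tD; rewrite invr_gt0.
rewrite (twist_sum D_gt0 chi_prim f_ser A0 (it_uhp t0)) cabsM cabsX (cabs_it (ltW t0)).
set q := expR _; set B := 1 + _.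
apply: (@le_trans _ _ ((\sum_(a < D) theta * (q ^+ j * B)) * t ^+ m)); last first.
  by rewrite sumr_const card_ord -mulr_natl le_eqVlt; apply/orP; left; apply/eqP; ring.
rewrite ler_wpM2r ?exprn_ge0 ?(ltW t0) //; apply: le_trans (cabs_sum _ _ _) _.
apply: ler_sum => a _; rewrite cabsM ler_pM ?cabs_ge0 ?(cabs_chat_le D_gt0 chi_prim) //.
set z := Complex _ _ + _.
have -> : f z = qparam z ^+ j + (f z - qparam z ^+ j) by rewrite addrC subrK.
apply: le_trans (cabsD _ _) _; apply: le_trans (lerD (lexx _) (shift_near a tD)) _.
by rewrite cabsX cabs_qparam_shift -/q /B le_eqVlt; apply/orP; left; apply/eqP; ring.
Qed.

(** For t < 1/D the height y = 1/(D^2 t) exceeds 1/D, so [f_near] applies after [modular_cusp]. The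
    factors (iDt)^-K and (it)^m leave t^-(n+2) because K = n+m+2, and e^(-2 pi j y) is exp(-b/t). *)
Lemma twist_near0 (t : R) : 0 < t -> t < D%:R^-1 ->
  cabs (twist chi f (Complex 0 t) * Complex 0 t ^+ m -
      W * Complex 0 1 ^+ m * (Complex 0 D%:R)^-1 ^+ K * (t^-1 ^+ n.+2 * expR (- (b / t)))%:C) <=
  D%:R * theta * D%:R^-1 ^+ K * (t^-1 ^+ n.+2 * expR (- (b / t)) *
    (C * (expR (- (2 * pi * (D%:R ^+ 2 * t)^-1)) + (D%:R ^+ 2 * t) ^+ N))).
Proof.
move=> t0 tD; rewrite (twist_sum D_gt0 chi_prim f_ser A0 (it_uhp t0)).
pose y := (D%:R ^+ 2 * t)^-1; rewrite -/y.
have Dt0 : 0 < D%:R ^+ 2 * t by rewrite mulr_gt0 // exprn_gt0.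
have yD : D%:R^-1 <= y.
  rewrite lef_pV2 ?posrE //; apply: (@le_trans _ _ (D%:R ^+ 2 * D%:R^-1)).
    by rewrite ler_wpM2l ?sqr_ge0 // ltW.
  by rewrite expr2 mulfK // gt_eqF.
have -> : D%:R ^+ 2 * t = y^-1 by rewrite invrK.
have qy : expR (- (b / t)) = expR (- (2 * pi * y)) ^+ j.
  rewrite -expRM_natl; congr expR; rewrite /b /y; field.
  by rewrite !gt_eqF.
rewrite qy; set q := expR (- (2 * pi * y)).
pose z (a : 'I_D) : R[i] := Complex 0 y + (u a)%:R / D%:R.
pose X : R[i] := (Complex 0 (D%:R * t))^-1 ^+ K.
have cX : cabs X = D%:R^-1 ^+ K * t^-1 ^+ K.
  by rewrite cabsX cabsV cabs_it ?mulr_ge0 ?(ltW t0) // invfM exprMn.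
have tw : \sum_(a < D) chat D chi a * f (Complex 0 t + a%:R / D%:R) =
    \sum_(a < D) chat D chi a * (X * f (z a)).
  (* The matrix exists only for units; the other translates drop out because [chat] vanishes
     there. *)
  apply: eq_bigr => a _; have [ca|ca] := boolP (coprimez a D%:Z); last first.
    by rewrite (chat_nonunit D_gt0 chi_prim ca) !mul0r.
  by congr (_ * _); exact: (modular_cusp D_gt0 t0 f_mod (u_inv ca)).
have mainE : W * Complex 0 1 ^+ m * (Complex 0 D%:R)^-1 ^+ K * (t^-1 ^+ n.+2 * q ^+ j)%:C =
    (\sum_(a < D) chat D chi a * (X * qparam (z a) ^+ j)) * Complex 0 t ^+ m.
  have -> : \sum_(a < D) chat D chi a * (X * qparam (z a) ^+ j) = X * (q ^+ j)%:C * W.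
    rewrite /W mulr_sumr; apply: eq_bigr => a _.
    have -> : qparam (z a) ^+ j = (q ^+ j)%:C * eD R D (u a).
      by rewrite -(eD_pow (u a)) rmorphXn /= -exprMn /z qparamD qparam_it /eD -pmulrn.
    by move: (chat D chi a) (eD R D _) (X) (_%:C) => *; ring.
  have tn : t%:C != 0 :> R[i] by rewrite -cabs_eq0 cabsC normr_eq0 gt_eqF.
  have XE : X = (Complex 0 D%:R)^-1 ^+ K * (t^-1 ^+ K)%:C.
    rewrite /X -[(t^-1 ^+ K)%:C]/(real_complex R _) rmorphXn fmorphV /= -exprMn -invfM; congr (_^-1 ^+ _).
    by apply: rect_eq; rewrite ?cReM ?cImM /=; ring.
  rewrite it_pow XE; have -> : t^-1 ^+ K = t^-1 ^+ n.+2 * t^-1 ^+ m by rewrite -exprD KE.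
  have tm : (t^-1 ^+ m)%:C * (t ^+ m)%:C = 1 :> R[i].
    by rewrite -rmorphM /= -exprMn mulVf ?expr1n // gt_eqF.
  move: (t^-1 ^+ n.+2) => T; rewrite !rmorphM /=.
  move: (Complex 0 1 ^+ m) (_ ^+ K) (T)%:C (q ^+ j)%:C (t^-1 ^+ m)%:C (t ^+ m)%:C tm W.
  move=> i1 x1 x2 x3 x4 x5 E w.
  transitivity (w * i1 * x1 * x2 * x3 * (x4 * x5)); first by rewrite E; ring.
  by ring.
rewrite tw mainE -mulrBl -sumrB cabsM cabsX (cabs_it (ltW t0)).
set B := q + _.
apply: (@le_trans _ _ ((\sum_(a < D) theta * (D%:R^-1 ^+ K * t^-1 ^+ K * (C * q ^+ j * B))) * t ^+ m)).
  rewrite ler_wpM2r ?exprn_ge0 ?(ltW t0) //; apply: le_trans (cabs_sum _ _ _) _.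
  apply: ler_sum => a _; rewrite -mulrBr -mulrBr (cabsM (chat D chi a)) (cabsM X) cX.
  apply: ler_pM; rewrite ?cabs_ge0 ?(cabs_chat_le D_gt0 chi_prim) //.
    by rewrite !mulr_ge0 ?cabs_ge0 ?exprn_ge0 ?invr_ge0 // ltW.
  rewrite ler_wpM2l ?mulr_ge0 ?exprn_ge0 ?invr_ge0 ?(ltW t0) //.
  exact: shift_near.
rewrite sumr_const card_ord -[_ *+ D]mulr_natl.
have -> : t^-1 ^+ K = t^-1 ^+ n.+2 * t^-1 ^+ m by rewrite -exprD KE.
have tm : t^-1 ^+ m * t ^+ m = 1 by rewrite -exprMn mulVf ?expr1n // gt_eqF.
move: (D%:R^-1 ^+ K) (t^-1 ^+ n.+2) (t^-1 ^+ m) (t ^+ m) tm (q ^+ j) => x1 x2 x3 x4 E x5.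
rewrite le_eqVlt; apply/orP; left; apply/eqP.
transitivity (D%:R * theta * x1 * x2 * (x3 * x4) * C * x5 * B); first by ring.
by rewrite E; ring.
Qed.

Lemma measurable_twist (p : R[i] -> R)
    (p_lim : forall z w, `|p z - p w| <= cabs (z - w))
    (p_add : forall z w, p (z + w) = p z + p w)
    (p_scale : forall z (x : R), p (z * x%:C) = p z * x) :
  measurable_fun halfline (fun t => p (twist chi f (Complex 0 t) * Complex 0 t ^+ m)).
Proof.
apply: (@measurable_qseries _ (fun k => chi k%:Z * A k)) => // t t0.
rewrite (twist_sum D_gt0 chi_prim f_ser A0 (it_uhp t0)).
exact: (twist_hsum D_gt0 chi_prim f_ser (it_uhp t0)).
Qed.

End Twist.

End Periods.

(** * Asymptotics of the periods *)

Section PeriodEstimate.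
Variable R : realType.
Local Notation mu := (@lebesgue_measure R).

Definition gauss_twist D (chi : int -> R[i]) (u : 'I_D -> 'I_D) : R[i] :=
  \sum_(a < D) chat D chi a * eD R D (u a).

(* Near t = 0 the leading term of the twisted test form at it, times (it)^m, is
   gauss_twist * (iDt)^-K * exp(-2 pi j / (D^2 t)) * (it)^m. Its integral is
   main_factor * j^-(n+1), where K = n + m + 2. *)
Definition main_factor D (chi : int -> R[i]) (u : 'I_D -> 'I_D) (n m : nat) : R[i] :=
  Complex 0 1 * (gauss_twist chi u * Complex 0 1 ^+ m * (Complex 0 D%:R)^-1 ^+ (n + m).+2) *
  (n`!%:R * (D%:R ^+ 2 / (2 * pi)) ^+ n.+1)%:C.

Definition neg_inverse_map D (u : 'I_D -> 'I_D) : Prop :=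
  [/\ involutive u,
      forall a : 'I_D, coprimez a D%:Z -> (D%:Z %| a%:Z * (u a)%:Z + 1)%Z &
      forall a : 'I_D, ~~ coprimez a D%:Z -> u a = a].

(** The lower bound is D theta^2 >= theta, from D theta >= 1 with theta = |chat 1|. All error terms
    carry a factor theta, so they become relative errors, uniformly in the character. *)
Lemma gauss_twist_bounds D (chi : int -> R[i]) (u : 'I_D -> 'I_D) : (0 < D)%N -> primitive_character D chi ->
  neg_inverse_map u ->
  0 < cabs (chat D chi 1) /\
  cabs (chat D chi 1) <= cabs (gauss_twist chi u) <= D%:R * cabs (chat D chi 1).
Proof.
move=> D0 cp [u1 u2 u3]; have h := cabs_chat1_ge D0 cp.
have Dr0 : 0 < (D%:R : R) by rewrite ltr0n.
have t0 : 0 < cabs (chat D chi 1) by rewrite -(pmulr_rgt0 _ Dr0); lra.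
split=> //; apply/andP; split.
  by rewrite /gauss_twist (gauss_sum_abs D0 cp u1 u2 u3) expr2 mulrA ler_peMl // ltW.
apply: le_trans (cabs_sum _ _ _) _.
apply: (@le_trans _ _ (\sum_(a < D) cabs (chat D chi 1))).
  apply: ler_sum => a _; rewrite (cabsM (chat D chi a)) cabs_eD mulr1; exact: cabs_chat_le.
by rewrite sumr_const card_ord -[_ *+ D]mulr_natl.
Qed.

Lemma main_factor_neq0 D (chi : int -> R[i]) (u : 'I_D -> 'I_D) n m : (0 < D)%N -> primitive_character D chi ->
  neg_inverse_map u -> main_factor chi u n m != 0.
Proof.
move=> D0 cp hu; have [t0 /andP[tW _]] := gauss_twist_bounds D0 cp hu.
have Dr0 : 0 < (D%:R : R) by rewrite ltr0n.
have W0 : gauss_twist chi u != 0 by rewrite -cabs_gt0; apply: lt_le_trans tW.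
have i0 : (Complex 0 1 : R[i]) != 0 by rewrite -cabs_eq0 cabs_i oner_eq0.
apply: mulf_neq0; last first.
  rewrite -cabs_eq0 cabsC normr_eq0 gt_eqF // mulr_gt0 ?ltr0n ?fact_gt0 //.
  by rewrite exprn_gt0 // divr_gt0 ?exprn_gt0 // mulr_gt0 // pi_gt0.
apply: mulf_neq0 => //; apply: mulf_neq0; first by apply: mulf_neq0 => //; exact: expf_neq0.
by apply: expf_neq0; rewrite invr_eq0 -cabs_eq0 cabs_it ?(ltW Dr0) // gt_eqF.
Qed.

Lemma has_integral_main (D j n : nat) : (0 < D)%N -> (0 < j)%N ->
  has_integral (fun t : R => t^-1 ^+ n.+2 * expR (- (2 * pi * j%:R / D%:R ^+ 2 / t)))
    (n`!%:R * (D%:R ^+ 2 / (2 * pi)) ^+ n.+1 * j%:R^-1 ^+ n.+1).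
Proof.
move=> D0 j0; have Dr0 : 0 < (D%:R : R) by rewrite ltr0n.
have jr0 : 0 < (j%:R : R) by rewrite ltr0n.
have p0 := pi_gt0 R.
have b0 : 0 < 2 * pi * j%:R / D%:R ^+ 2 :> R.
  by rewrite divr_gt0 ?exprn_gt0 // !mulr_gt0.
have [h1 h2] := inverse_gamma_integral n b0; split=> //; rewrite h2.
rewrite -[RHS]mulrA -exprMn -[_ ^- n.+1]exprVn; congr (_ * _ ^+ _).
by rewrite invfM invrK (invfM (2 * pi)); ring.
Qed.

(** Here 2m <= K-4 enters through K <= 2n. It lets n! absorb Q^K, and it gives D^(2(n+1)-K) >= 1, so
    the integral of t^n e^(-2 pi j t), used to majorize the part t >= 1/D, does not exceed the main
    term. *)
Lemma scale_dominates (D K n j : nat) (Q e : R) : (0 < D)%N -> (0 < j)%N ->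
  0 < e -> 1 <= Q -> (0 < n)%N -> (K <= n.*2)%N ->
  ((3 * Q * (2 * pi * j%:R)) ^+ 2) ^+ n <= e * n`!%:R ->
  3 * Q ^+ K <= e * (n`!%:R / (2 * pi * j%:R) ^+ n.+1) /\
  n`!%:R / (2 * pi * j%:R) ^+ n.+1 <=
    D%:R^-1 ^+ K * (n`!%:R * (D%:R ^+ 2 / (2 * pi)) ^+ n.+1 * j%:R^-1 ^+ n.+1) :> R.
Proof.
move=> D0 j0 e0 Q1 n0 Kn; set P := 2 * pi * j%:R => H.
have n2 : (n.+1 <= n.*2)%N by lia.
have Kn2 : (K <= n.+1.*2)%N by lia.
have Dr1 : 1 <= (D%:R : R) by rewrite ler1n.
have Dr0 : 0 < (D%:R : R) by rewrite ltr0n.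
have jr1 : 1 <= (j%:R : R) by rewrite ler1n.
have p0 := pi_gt0 R; have p2 := pi_ge2 R.
have P1 : 1 <= P by rewrite mulr_ege1 //; lra.
have P0 : 0 < P by lra.
have Q0 : 0 < Q by lra.
split.
  rewrite mulrA ler_pdivlMr ?exprn_gt0 //; apply: le_trans H.
  have -> : ((3 * Q * P) ^+ 2) ^+ n = 3 ^+ n.*2 * Q ^+ n.*2 * P ^+ n.*2.
    by rewrite -exprM mul2n -!exprMn.
  apply: ler_pM; rewrite ?mulr_ge0 ?exprn_ge0 ?(ltW P0) ?(ltW Q0) //; last by rewrite ler_weXn2l.
  apply: ler_pM; rewrite ?exprn_ge0 ?(ltW Q0) //; last by rewrite ler_weXn2l.
  by rewrite -{1}[3]expr1 ler_weXn2l ?ler1n // double_gt0.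
have Pn : 0 < P ^+ n.+1 by rewrite exprn_gt0.
have -> : n`!%:R * (D%:R ^+ 2 / (2 * pi)) ^+ n.+1 * j%:R^-1 ^+ n.+1 =
   n`!%:R / P ^+ n.+1 * (D%:R ^+ 2) ^+ n.+1.
  rewrite -mulrA -exprMn -exprVn -mulrA -exprMn; congr (_ * _ ^+ _).
  by rewrite /P; field; rewrite !gt_eqF //; lra.
rewrite mulrCA ler_peMr ?divr_ge0 ?ler0n ?(ltW Pn) //.
by rewrite exprVn mulrC ler_pdivlMr ?exprn_gt0 // mul1r -exprM mul2n ler_weXn2l.
Qed.

Lemma weight_bounds (j n m n0 : nat) : (m.+2 <= n)%N -> (12 * j + 5 <= (n + m).+2)%N ->
  (n0.*2 <= (n + m).+2)%N ->
  [/\ (0 < (n + m).+2 - 12 * j - 4 <= (n + m).+2)%N, (n0 <= n)%N, (0 < n)%N &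
      ((n + m).+2 <= n.*2)%N].
Proof. by move=> h1 h2 h3; split; lia. Qed.

Lemma sum3_expr_le (x y z : R) K : 1 <= x -> 1 <= y -> 1 <= z ->
  x ^+ K + y ^+ K + z ^+ K <= 3 * (x + y + z) ^+ K.
Proof.
move=> x1 y1 z1; have h w : 1 <= w -> w <= x + y + z -> w ^+ K <= (x + y + z) ^+ K.
  by move=> w1 wle; rewrite lerXn2r ?nnegrE //; lra.
have hx := h x x1; have hy := h y y1; have hz := h z z1.
have -> : 3 * (x + y + z) ^+ K = (x + y + z) ^+ K + (x + y + z) ^+ K + (x + y + z) ^+ K by ring.
by rewrite !lerD // ?hx ?hy ?hz //; lra.
Qed.

(** The form depends only on K and j, and [K1] only on D, j and e, so one form serves all characters
    and all m. The errors are compared with D^-K times the integral of the main profile, which is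
    the size of the main term up to the Gauss sum. *)
Lemma period_estimate (D j : nat) (e : R) : (0 < D)%N -> (0 < j)%N ->
  (D%:Z %| j%:Z - 1)%Z -> 0 < e ->
  exists K1, forall K, (K1 <= K)%N -> ~~ odd K ->
  exists2 f, cusp_form K f & forall (chi : int -> R[i]) (u : 'I_D -> 'I_D) n m,
    primitive_character D chi -> neg_inverse_map u -> (m.+2 <= n)%N -> K = (n + m).+2 ->
    cabs (twisted_period m chi f - main_factor chi u n m * (j%:R^-1 ^+ n.+1)%:C) <=
    e * (cabs (main_factor chi u n m) * j%:R^-1 ^+ n.+1).
Proof.
have near_arith (x d m f w b1 b2 b3 : R) : x * (b1 * w) <= b1 * w -> 0 <= d * f ->
    0 <= b2 * w -> 0 <= b3 * w ->
    x * (d * m + b1 * w) <= x * d * m + d * f + (b1 + b2 + b3) * w by lra.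
have far_arith (x d m f w b1 b2 b3 : R) : 0 <= x * d * m -> 0 <= b1 * w ->
    d * f + b2 * w + b3 * w <= x * d * m + d * f + (b1 + b2 + b3) * w by lra.
have sum3 (a b c : R) : b <= a -> c <= b -> a + b + c <= 3 * a by lra.
have add3 (a b c : R) : 1 <= a -> 1 <= b -> 1 <= c -> 1 <= a + b + c by lra.
move=> D0 j0 j1 e0; have Dr0 : 0 < (D%:R : R) by rewrite ltr0n.
have Dr1 : 1 <= (D%:R : R) by rewrite ler1n.
have jr0 : 0 < (j%:R : R) by rewrite ltr0n.
have pi0 := pi_gt0 R.
have [C C0 HC] := test_form R D0 j0.
(* 6 = 2 * 3 accounts for real and imaginary parts and for three error terms of equal size; D
   accounts for the number of translates. *)
pose d := e / (6 * D%:R).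
have d0 : 0 < d by rewrite divr_gt0 ?mulr_gt0.
have [Q1 Q11 H1] := error_near0 D0 C0 d0.
have [Q2 Q21 H2] := error_far D0 C0 d0.
have [Q3 Q31 H3] := error_main R D0.
pose Q := Q1 + Q2 + Q3; pose P : R := 2 * pi * j%:R.
have P0 : 0 < P by rewrite /P !mulr_gt0.
have [n0 Hn0] := fact_dominates ((3 * Q * P) ^+ 2) d0.
exists (maxn (12 * j + 5) n0.*2) => K; rewrite geq_max => /andP[Kj Kn0] Kev.
pose N := (K - 12 * j - 4)%N.
have Kj4 : (12 * j + 4 <= K)%N by apply: leq_trans Kj; rewrite leq_add2l.
have [f [A [cf fA fn]]] := HC K Kev Kj4.
have [_ fm [A' fA' A'0] _] := cf.
have A0 : A 0%N = 0 by rewrite (q_expansion_unique (qseries_q_expansion fA) fA').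
exists f => // chi u n m cp hu mn KE.
have [NK n0n ngt0 Kn2] : [/\ (0 < N <= K)%N, (n0 <= n)%N, (0 < n)%N & (K <= n.*2)%N].
  by move: Kj Kn0; rewrite /N KE; apply: weight_bounds.
have nK : (0 < n.+1 < K)%N by rewrite KE !ltnS leq_addr.
have mlt : (m < n)%N by apply: ltnW.
have mK : (m <= K)%N by rewrite KE -addn2 -addnA addnCA leq_addr.
have [u1 u2 u3] := hu.
have [t0 /andP[tW WD]] := gauss_twist_bounds D0 cp hu.
set theta := cabs (chat D chi 1) in t0 tW WD.
pose b : R := 2 * pi * j%:R / D%:R ^+ 2.
have b0 : 0 < b by rewrite divr_gt0 ?exprn_gt0.
pose c : R[i] := gauss_twist chi u * Complex 0 1 ^+ m * (Complex 0 D%:R)^-1 ^+ K.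
pose M := n`!%:R / P ^+ n.+1; pose x : R := D%:R^-1 ^+ K.
pose M1 : R := n`!%:R * (D%:R ^+ 2 / (2 * pi)) ^+ n.+1 * j%:R^-1 ^+ n.+1.
have x0 : 0 <= x by rewrite exprn_ge0 // invr_ge0 ltW.
have x1 : x <= 1 by rewrite exprn_ile1 ?invr_ge0 ?(ltW Dr0) // invf_le1.
have cc : cabs c = cabs (gauss_twist chi u) * x.
  rewrite /c cabsM cabsM !cabsX cabs_i expr1n mulr1 cabsV cabs_it //.
have Dt0 : 0 <= D%:R * theta by rewrite mulr_ge0 // ltW.
pose S := Q1 ^+ K + Q2 ^+ K + Q3 ^+ K.
pose mt (t : R) := t^-1 ^+ n.+2 * expR (- (b / t)).
pose ft (t : R) := t ^+ n * expR (- (P * t)).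
(* The three parts are a relative error of the main profile, the majorant for large t, and what is
   only exponential in K. *)
pose E t := D%:R * theta * x * d * mt t + D%:R * theta * d * ft t + D%:R * theta * S * tail_weight t.
have imt : has_integral mt M1 by exact: has_integral_main.
have ift : has_integral ft M by exact: gamma_integral.
have itw : has_integral (@tail_weight R) 1.
  have [h1 h2] := inverse_gamma_integral 0 (ltr01 : 0 < 1 :> R).
  by split=> //; rewrite [LHS]h2 fact0 expr1 divr1.
have [iE EE] : has_integral E (D%:R * theta * x * d * M1 + D%:R * theta * d * M + D%:R * theta * S * 1).
  by apply: has_integralD; [apply: has_integralD|]; apply: has_integralZ.
have main t : 0 < t -> cabs (twist chi f (Complex 0 t) * Complex 0 t ^+ m - c * (mt t)%:C) <= E t.
  move=> tp; have ti : 0 <= t^-1 by rewrite invr_ge0 ltW.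
  have w0 : 0 <= tail_weight t by rewrite mulr_ge0 ?expR_ge0 // sqr_ge0.
  have mt0 : 0 <= mt t by rewrite mulr_ge0 ?exprn_ge0 ?expR_ge0.
  have ft0 : 0 <= ft t by rewrite mulr_ge0 ?exprn_ge0 ?expR_ge0 // ltW.
  have e1 (y : R) : 0 <= y -> 0 <= expR (- y) <= 1.
    by move=> y0; rewrite expR_ge0 -[leRHS]expR0 ler_expR oppr_le0.
  have Q1w : 0 <= Q1 ^+ K * tail_weight t := mulr_ge0 (exprn_ge0 _ (le_trans ler01 Q11)) w0.
  have Q2w : 0 <= Q2 ^+ K * tail_weight t := mulr_ge0 (exprn_ge0 _ (le_trans ler01 Q21)) w0.
  have Q3w : 0 <= Q3 ^+ K * tail_weight t := mulr_ge0 (exprn_ge0 _ (le_trans ler01 Q31)) w0.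
  have xm0 : 0 <= x * d * mt t := mulr_ge0 (mulr_ge0 x0 (ltW d0)) mt0.
  have fd0 : 0 <= d * ft t := mulr_ge0 (ltW d0) ft0.
  have -> : E t = D%:R * theta * (x * d * mt t + d * ft t + S * tail_weight t).
    by rewrite /E; ring.
  have [tD|tD] := ltP t (D%:R^-1).
    apply: le_trans (twist_near0 D0 cp u2 j1 KE fm fA A0 fn tp tD) _.
    rewrite -[leLHS]mulrA ler_wpM2l // -/x -/b -/(mt t).
    have h := H1 K N n.+1 t (expR (- (b / t))) NK _ tp tD (e1 _ (divr_ge0 (ltW b0) (ltW tp))).
    apply: (@le_trans _ _ (x * (d * mt t + Q1 ^+ K * tail_weight t))).
      by rewrite ler_wpM2l //; apply: h; case/andP: nK.
    by apply: near_arith => //; rewrite ler_piMl.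
  (* For t >= 1/D the main term approximates nothing; it and the twist are bounded separately. *)
  apply: le_trans (cabsD _ _) _; rewrite cabsN.
  have h1 := twist_far m D0 cp fA A0 fn tD.
  have qj : expR (- (2 * pi * t)) ^+ j = expR (- (P * t)).
    by rewrite -expRM_natl; congr expR; rewrite /P; ring.
  rewrite qj in h1.
  have h2 := H2 K N m n t (expR (- (P * t))) NK mlt mK tD (e1 _ (mulr_ge0 (ltW P0) (ltW tp))).
  have h3 := H3 K n.+1 t (expR (- (b / t))) nK tD (e1 _ (divr_ge0 (ltW b0) (ltW tp))).
  have h4 : cabs (c * (mt t)%:C) <= D%:R * theta * (Q3 ^+ K * tail_weight t).
    rewrite cabsM cabsC (ger0_norm mt0) cc.
    apply: (ler_pM (mulr_ge0 (cabs_ge0 _) x0) mt0 _ h3).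
    by apply: le_trans WD; rewrite ler_piMr ?cabs_ge0.
  apply: le_trans (lerD (le_trans h1 (ler_wpM2l Dt0 h2)) h4) _.
  by rewrite -mulrDr ler_wpM2l // -/(ft t); apply: far_arith.
have near := integral_0_ioo_near (g := fun z => twist chi f z * z ^+ m) (c := c) _ _ imt.1 iE main.
rewrite imt.2 EE in near.
have mainE : main_factor chi u n m * (j%:R^-1 ^+ n.+1)%:C = Complex 0 1 * c * M1%:C.
  by rewrite /main_factor -KE -/c /M1 -[RHS]mulrA -[LHS]mulrA -rmorphM mulrA.
have cmain : cabs (main_factor chi u n m) * j%:R^-1 ^+ n.+1 = cabs (gauss_twist chi u) * x * M1.
  have jn0 : 0 <= (j%:R^-1 : R) ^+ n.+1 by rewrite exprn_ge0.
  rewrite -{1}[j%:R^-1 ^+ n.+1]ger0_norm // -cabsC -cabsM mainE (cabsM (_ * c)) (cabsM _ c) cabs_i mul1r.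
  rewrite cc cabsC ger0_norm // /M1; apply: mulr_ge0 => //; apply: mulr_ge0 => //.
  by rewrite exprn_ge0 // divr_ge0 ?sqr_ge0 // mulr_ge0 // ltW.
rewrite mainE cmain; apply: le_trans (near _ _) _.
- apply: (measurable_twist m D0 cp fA A0 (p := fun z => complex.Re z)) => [z w|z w|z y].
  + have -> : complex.Re z - complex.Re w = complex.Re (z - w) by rewrite cReD cReN.
    exact: Re_le_cabs.
  + exact: cReD.
  + by rewrite cReM /= mulr0 subr0.
- apply: (measurable_twist m D0 cp fA A0 (p := fun z => complex.Im z)) => [z w|z w|z y].
  + have -> : complex.Im z - complex.Im w = complex.Im (z - w) by rewrite cImD cImN.
    exact: Im_le_cabs.
  + exact: cImD.
  + by rewrite cImM /= mulr0 add0r.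
have Q0 : 1 <= Q := add3 _ _ _ Q11 Q21 Q31.
(* [s1] puts the exponential terms below d M, and [s2] puts M below x M1, so the three errors have a
   common bound. *)
have [s1 s2] := scale_dominates D0 j0 d0 Q0 ngt0 Kn2 (Hn0 n n0n).
rewrite -/P -/M -/x -/M1 in s1 s2.
have SQ : S <= 3 * Q ^+ K := sum3_expr_le K Q11 Q21 Q31.
have dM : d * M <= d * (x * M1) by rewrite ler_wpM2l // ltW.
have M0 : 0 <= x * M1 by apply: le_trans s2; rewrite divr_ge0 // exprn_ge0 // ltW.
apply: (@le_trans _ _ (2 * (D%:R * theta * (3 * (d * (x * M1)))))).
  rewrite ler_wpM2l //.
  have -> : D%:R * theta * x * d * M1 + D%:R * theta * d * M + D%:R * theta * S * 1 =
     D%:R * theta * (d * (x * M1) + d * M + S) by ring.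
  by rewrite ler_wpM2l //; apply: sum3 dM _; apply: le_trans SQ s1.
have -> : 2 * (D%:R * theta * (3 * (d * (x * M1)))) = e * (theta * (x * M1)).
  by rewrite /d; field; rewrite gt_eqF.
by rewrite ler_wpM2l ?(ltW e0) // -mulrA ler_wpM2r.
Qed.

End PeriodEstimate.

(** * Linear independence *)

(* Against the decreasing s, the weight a has the slopes -(2i+1); hence
   a i + 2 k (s i) is smallest at i = k. *)
Lemma convex_weights (n : nat) (s : nat -> nat) :
  (forall i k, (i < k < n)%N -> (s k < s i)%N) ->
  exists a : nat -> nat, forall i k, (i < n)%N -> (k < n)%N -> i != k ->
    (a k + 2 * k * s k < a i + 2 * k * s i)%N.
Proof.
move=> sd; pose a i := (\sum_(l < i) (2 * l + 1) * (s l - s l.+1))%N.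
have aS i : (a i.+1 = a i + (2 * i + 1) * (s i - s i.+1))%N by rewrite /a big_ord_recr.
have up c k d : (k + d < n)%N -> (c <= 2 * k + 1)%N ->
    (a k + c * s k <= a (k + d) + c * s (k + d))%N.
  elim: d => [|d IH] kd ck; first by rewrite addn0.
  rewrite addnS in kd; have h : (s (k + d).+1 < s (k + d))%N by apply: sd; rewrite ltnSn.
  apply: leq_trans (IH (ltnW kd) ck) _; rewrite addnS aS.
  move: (s (k + d)%N) (s (k + d).+1) h (a _) => x y xy z.
  have : (c * (x - y) <= (2 * (k + d) + 1) * (x - y))%N by rewrite leq_mul2r; lia.
  have -> : (c * x = c * (x - y) + c * y)%N by rewrite -mulnDr subnK // ltnW.
  lia.
have down c i d : (i + d < n)%N -> (2 * (i + d) <= c.+1)%N ->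
    (a (i + d) + c * s (i + d) <= a i + c * s i)%N.
  elim: d => [|d IH] kd ck; first by rewrite addn0.
  rewrite addnS in kd; have h : (s (i + d).+1 < s (i + d))%N by apply: sd; rewrite ltnSn.
  have ck' : (2 * (i + d) <= c.+1)%N by apply: leq_trans ck; rewrite leq_mul2l leq_add2l ltnW.
  apply: leq_trans (IH (ltnW kd) ck'); rewrite addnS aS.
  move: (s (i + d)%N) (s (i + d).+1) h (a _) => x y xy z.
  have : ((2 * (i + d) + 1) * (x - y) <= c * (x - y))%N by rewrite leq_mul2r; lia.
  have -> : (c * x = c * (x - y) + c * y)%N by rewrite -mulnDr subnK // ltnW.
  lia.
exists a => i k iN kN; rewrite neq_ltn => /orP[ik|ki].
  have h : (s k < s i)%N by apply: sd; rewrite ik.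
  have E : (2 * k = (2 * k - 1).+1)%N by lia.
  have := down (2 * k - 1)%N i (k - i)%N; rewrite subnKC ?(ltnW ik) // -E => /(_ kN (leqnn _)).
  by move: (2 * k - 1)%N E => c ->; rewrite !mulSn; lia.
have := up (2 * k + 1)%N k (i - k)%N; rewrite subnKC ?(ltnW ki) // => /(_ iN (leqnn _)).
have h : (s i < s k)%N by apply: sd; rewrite ki.
rewrite !mulnDl !mul1n; lia.
Qed.

Section Independence.
Variable R : realType.

(** Diagonal dominance in extremal form: for the index k that maximizes |c_i A_i| B^(a_i), the k-th
    equation has its diagonal term larger than all the others together. So this maximum is 0, and
    with it every c_i. *)
Lemma dominance (n : nat) (B : nat) (s : 'I_n -> nat) (A : 'I_n -> R[i])
    (M : 'I_n -> 'I_n -> R[i]) (c : 'I_n -> R[i]) :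
  (3 * n < B)%N -> (forall i k : 'I_n, (i < k)%N -> (s k < s i)%N) ->
  (forall i, A i != 0) ->
  (forall i k, cabs (M i k - A i * ((B ^ (2 * k))%:R^-1 ^+ s i)%:C) <=
     2^-1 * (cabs (A i) * (B ^ (2 * k))%:R^-1 ^+ s i)) ->
  (forall k, \sum_(i < n) c i * M i k = 0) ->
  forall i, c i = 0.
Proof.
move=> nB sd An0 MA Mc i0.
have Br0 : 0 < (B%:R : R) by rewrite ltr0n; lia.
pose s' l := if insub l is Some i then s i else 0%N.
have s'E (i : 'I_n) : s' i = s i by rewrite /s' valK.
have [|a Ha] := @convex_weights n s'.
  move=> i k /andP[ik kn]; have iN := ltn_trans ik kn.
  by have := sd (Ordinal iN) (Ordinal kn) ik; rewrite -!s'E.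
pose beta i := cabs (c i) * cabs (A i).
have b0 i : 0 <= beta i by rewrite mulr_ge0 ?cabs_ge0.
pose v : R := B%:R^-1; have v0 : 0 < v by rewrite invr_gt0.
have vn : 3 * n%:R * v < 1.
  by rewrite ltr_pdivrMr // mul1r -natrM ltr_nat.
(* The weights [a] rescale the rows; the choice of k plays the part of the largest coordinate of the
   rescaled vector. *)
have [k _ Hk] := @Order.TotalTheory.arg_maxP _ _ _ i0 xpredT (fun i => beta i * B%:R ^+ a i) isT.
pose X i : R := (B ^ (2 * k))%:R^-1 ^+ s i.
have XE i : X i = v ^+ (2 * k * s i) by rewrite /X natrX -exprVn -exprM.
have X0 i : 0 < X i by rewrite XE exprn_gt0.
have Bv : B%:R * v = 1 by rewrite mulfV // gt_eqF.
(* The strict inequality of integers in [convex_weights] yields one full factor v = 1/B. *)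
have off i : i != k -> beta i * X i <= v * (beta k * X k).
  move=> ik; have := Ha i k (ltn_ord i) (ltn_ord k) ik; rewrite !s'E => h.
  have Bva : B%:R ^+ a i * v ^+ a i = 1 by rewrite -exprMn Bv expr1n.
  have Bvk : B%:R ^+ a k * v ^+ a k = 1 by rewrite -exprMn Bv expr1n.
  have v1 : v <= 1 by rewrite invf_le1 // ler1n; lia.
  have -> : beta i * X i = beta i * B%:R ^+ a i * v ^+ (a i + 2 * k * s i).
    by rewrite exprD -XE mulrA -[_ * _ * v ^+ _]mulrA Bva mulr1.
  have -> : v * (beta k * X k) = beta k * B%:R ^+ a k * v ^+ (a k + 2 * k * s k).+1.
    by rewrite exprS exprD -XE [RHS]mulrCA; congr (_ * _); rewrite mulrA -[_ * _ * v ^+ _]mulrA Bvk mulr1.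
  apply: (ler_pM (mulr_ge0 (b0 i) (exprn_ge0 _ (ltW Br0))) (exprn_ge0 _ (ltW v0)) (Hk i isT)).
  by rewrite ler_wiXn2l // ltW.
have upper i : cabs (c i * M i k) <= 3 / 2 * (beta i * X i).
  have -> : M i k = A i * (X i)%:C + (M i k - A i * (X i)%:C) by rewrite addrC subrK.
  rewrite cabsM; apply: (@le_trans _ _ (cabs (c i) * (3 / 2 * (cabs (A i) * X i)))); last first.
    by rewrite /beta; lra.
  rewrite ler_wpM2l ?cabs_ge0 //; apply: le_trans (cabsD _ _) _.
  by have := MA i k; rewrite -/(X i) (cabsM (A i)) cabsC (ger0_norm (ltW (X0 i))); lra.
have lower : 2^-1 * (beta k * X k) <= cabs (c k * M k k).
  rewrite cabsM; apply: (@le_trans _ _ (cabs (c k) * (2^-1 * (cabs (A k) * X k)))).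
    by rewrite /beta; lra.
  rewrite ler_wpM2l ?cabs_ge0 //; have h := MA k k; rewrite -/(X k) in h.
  have : cabs (A k * (X k)%:C) <= cabs (M k k) + cabs (A k * (X k)%:C - M k k).
    by apply: le_trans (cabsD _ _); rewrite addrC subrK.
  by rewrite cabsB (cabsM (A k)) cabsC (ger0_norm (ltW (X0 k))); lra.
(* At least half of the diagonal term against n terms of at most 3/2 v each: as 3nv < 1, this leaves
   only zero. *)
have bX : 2^-1 * (beta k * X k) <= n%:R * (3 / 2 * (v * (beta k * X k))).
  have E : c k * M k k = - \sum_(i < n | i != k) c i * M i k.
    by have := Mc k; rewrite (bigD1 k) //= => /eqP; rewrite addr_eq0 => /eqP.
  apply: le_trans lower _; rewrite E cabsN; apply: le_trans (cabs_sum _ _ _) _.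
  apply: (@le_trans _ _ (\sum_(i < n) 3 / 2 * (v * (beta k * X k)))); last first.
    by rewrite sumr_const card_ord -[_ *+ n]mulr_natl.
  rewrite big_mkcond /=; apply: ler_sum => i _; case: ifP => [ik|_].
    by apply: le_trans (upper i) _; rewrite ler_wpM2l ?off.
  by have := mulr_ge0 (ltW v0) (mulr_ge0 (b0 k) (ltW (X0 k))); lra.
have bk : beta k = 0.
  have z0 : 0 <= beta k * X k by rewrite mulr_ge0 // ltW.
  have : (1 - 3 * n%:R * v) * (beta k * X k) <= 0 by lra.
  rewrite pmulr_rle0 ?subr_gt0 // => z1.
  have /eqP : beta k * X k = 0 by apply/eqP; rewrite eq_le z1.
  by rewrite mulf_eq0 (gt_eqF (X0 k)) orbF => /eqP.
have : beta i0 * B%:R ^+ a i0 <= 0 by have := Hk i0 isT; rewrite bk mul0r.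
rewrite pmulr_lle0 ?exprn_gt0 // => h.
have /eqP : beta i0 = 0 by apply/eqP; rewrite eq_le h b0.
by rewrite mulf_eq0 [X in _ || X]cabs_eq0 (negPf (An0 i0)) orbF cabs_eq0 => /eqP.
Qed.

End Independence.

Lemma expn_mod1 (D B e : nat) : (D %| B - 1)%N -> (0 < B)%N -> (D%:Z %| (B ^ e)%:Z - 1)%Z.
Proof.
move=> /dvdnP[q E] B0; have {E B0}-> : B = (q * D + 1)%N by lia.
suff [r ->] : exists r, ((q * D + 1) ^ e = r * D + 1)%N.
  by apply/dvdzP; exists r%:Z; rewrite PoszD addrK PoszM.
elim: e => [|e [r IH]]; first by exists 0%N.
by exists (q * (r * D + 1) + r)%N; rewrite expnS IH; ring.
Qed.

Theorem theorem1p2 (R : realType) (n D : nat) :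
  (1 <= n)%N -> (1 <= D)%N -> odd D -> squarefree D ->
  exists K0 : nat,
  forall chi : int -> R[i], primitive_character D chi ->
  forall K : nat, (K0 <= K)%N -> ~~ odd K ->
  forall ell : 'I_n -> nat,
    (forall i j : 'I_n, (i < j)%N -> (ell i < ell j)%N) ->
    (forall i : 'I_n, (3 <= ell i)%N) ->
    (forall i : 'I_n, (ell i <= (K - 4) %/ 2)%N) ->
    (forall i : 'I_n, chi (-1) = (-1) ^+ ell i) ->
    lin_indep_on (cusp_form K) (fun i : 'I_n => twisted_period (ell i) chi).
Proof.
(* B = 1 mod D is inherited by all its powers, and B > 3n is what [dominance] asks for. *)
move=> n_gt0 D_gt0 _ _; pose B := (4 * n * D + 1)%N.
have nB : (3 * n < B)%N by rewrite /B; nia.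
have B0 : (0 < B)%N by rewrite /B addn1.
have half0 : 0 < 2^-1 :> R by rewrite invr_gt0.
have DB : (D %| B - 1)%N by rewrite /B addnK dvdn_mull.
have DBk k := expn_mod1 (2 * k) DB B0.
have Bk0 k : (0 < B ^ (2 * k))%N by rewrite expn_gt0 B0.
have /choice [K1 HK1] := fun k : 'I_n => period_estimate D_gt0 (Bk0 k) (DBk k) half0.
have [u Hu] := neg_inverse R D_gt0.
(* The bound is fixed before the character and the exponents; the test forms then depend on K and k
   alone. *)
exists (\max_(k < n) K1 k)%N => chi cp K hK Kev ell mono e3 eK _ c Hc.
have /choice [f Hf] : forall k : 'I_n, exists f, cusp_form K f /\ _ := fun k =>
  let: ex_intro2 f f1 f2 := HK1 k K (leq_trans (leq_bigmax k) hK) Kev in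
  ex_intro _ f (conj f1 f2).
(* The exponent of 1/j is K - ell i - 1 = N i + 1, strictly decreasing in i as [dominance]
   requires. *)
pose N i := (K - ell i - 2)%N.
have KE i : K = (N i + ell i).+2 by move: (e3 i) (eK i); rewrite /N; lia.
have mN i : ((ell i).+2 <= N i)%N by move: (e3 i) (eK i); rewrite /N; lia.
apply: (@dominance R n B (fun i => (N i).+1) (fun i => main_factor chi u (N i) (ell i))
  (fun i k => twisted_period (ell i) chi (f k)) c nB).
- by move=> i k ik; have := mono i k ik; have := mN i; have := mN k; have := KE i; have := KE k; lia.
- by move=> i; apply: main_factor_neq0.
- by move=> i k; apply: (Hf k).2.
- by move=> k; apply: Hc; case: (Hf k).
Qed.
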